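(* Let $\mathbf U_h$ be the numerical solutions computed, on meshes with $\Delta x,\Delta t\to0$, either by the forward Euler DG scheme $\mathbf U_h^{n+1,(\mathrm{pre})}=\mathbf U_h^n+\Delta t\,\mathcal L_h(\mathbf U_h^n)$ or by the SSP multistep DG scheme $\mathbf U_h^{n+1,(\mathrm{pre})}=\sum_{l=1}^m(\alpha_l\mathbf U_h^{n+1-l}+\beta_l\Delta t\,\mathcal L_h(\mathbf U_h^{n+1-l}))$, in each case followed by the entropy stable limiter, so that the discrete cell entropy inequality $$\tilde{\mathcal U}_i^{n+1}\le\sum_{l=1}^m\Big(\alpha_l\,\tilde{\mathcal U}_i^{n+1-l}-\beta_l\tfrac{\Delta t}{\Delta x}\big(\hat{\mathcal F}_{i+\frac12}^{n+1-l}-\hat{\mathcal F}_{i-\frac12}^{n+1-l}\big)\Big)$$ holds for all $i,n$ (with $m=1$, $\alpha_1=\beta_1=1$ for forward Euler). Suppose: (i) (Convergence) the numerical solutions take values in a fixed compact subset of the admissible set $G$; $\mathbf U_h^0\to\mathbf U_0$ in $L^1_{\rm loc}(\mathbb R)$ as $\Delta x\to0$; and $\mathbf U_h\to\mathbf U^\star$ in $L^1_{\rm loc}(\mathbb R\times\mathbb R^+)$ as $\Delta x,\Delta t\to0$; (ii) (TVB-like property) with $B_i=I_{i-1}\cup I_i\cup I_{i+1}$ and $x_i$ the center of $I_i$, $$\sup_n\Delta x\sum_i\max_{x\in B_i}\|\mathbf U_h^n(x)-\mathbf U_h^n(x_i)\|\to0\quad\text{as }\Delta x,\Delta t\to0;$$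 (iii) for the multistep scheme, the starting values are consistent. Then for every $\phi\in C_0^\infty(\mathbb R\times\mathbb R^+)$ with $\phi\ge0$, the limit $\mathbf U^\star$ satisfies $$\int_{\mathbb R^+}\int_{\mathbb R}\big(\mathcal U(\mathbf U^\star)\phi_t+\mathcal F(\mathbf U^\star)\phi_x\big)\,\mathrm dx\,\mathrm dt\ge-\int_{\mathbb R}\mathcal U(\mathbf U_0(x))\phi(x,0)\,\mathrm dx .$$
   Context: **MHD system (flow varying in $x$ only).** The state is $\mathbf U=(\rho,\rho\mathbf u,\mathcal E,\mathbf B)\in\mathbb R^p$ with $\mathbf u,\mathbf B\in\mathbb R^M$ ($M\in\{1,2,3\}$, $p=2M+2$); $u_x,B_x$ are the first components of $\mathbf u,\mathbf B$. With $\gamma=5/3$, the pressure $P$ is defined by $\mathcal E=\frac{P}{\gamma-1}+\frac12\rho\|\mathbf u\|^2+\frac12\|\mathbf B\|^2$, and $P^\star=P+\frac12\|\mathbf B\|^2$. $G=\{\mathbf U:\rho>0,\ P>0\}$. The $x$-flux is $\mathbf F(\mathbf U)=(\rho u_x,\ \rho u_x\mathbf u+P^\star\mathbf e_1-B_x\mathbf B,\ u_x(\mathcal E+P^\star)-B_x(\mathbf u\cdot\mathbf B),\ u_x\mathbf B-B_x\mathbf u)$. Entropy and entropy flux: $\mathcal U=-\frac{\rho s}{\gamma-1}$, $\mathcal F=-\frac{\rho su_x}{\gamma-1}$, $s=\ln(P\rho^{-\gamma})$; $\mathcal U$ is strictly convex on $G$. $\mathcal U'$ is the gradient as a row vector,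 $\mathbf V=\mathcal U'(\mathbf U)^T$. With $\beta=\rho/(2P)$, $\phi_0(\mathbf V)=2\beta(\mathbf u\cdot\mathbf B)$, set $\mathbf S(\mathbf U)=\phi_0'(\mathbf V)^T=(0,\mathbf B,\mathbf u\cdot\mathbf B,\mathbf u)^T$. $B_x'=\partial B_x/\partial\mathbf U$ is a constant row vector. The system discretized is $\partial_t\mathbf U+\partial_x\mathbf F(\mathbf U)=-\mathbf S(\mathbf U)\partial_xB_x$, $\mathbf U(x,0)=\mathbf U_0(x)$. **Paths and wave speeds.** A prescribed path is a Lipschitz function $\Psi(\xi;\mathbf U^-,\mathbf U^+)$, $\xi\in[0,1]$, with $\Psi(0;\cdot)=\mathbf U^-$, $\Psi(1;\cdot)=\mathbf U^+$, $\Psi(\xi;\mathbf U,\mathbf U)=\mathbf U$. For $\mathbf a,\mathbf b\in G$ and a path $\Phi$ from $\mathbf a$ to $\mathbf b$ write $J(\Phi)=\int_0^1\mathbf S(\Phi)B_x'\Phi'\,\mathrm d\xi$; $\mathcal S_R^{\rm std}=\max\{\sigma_{\max}(\mathbf F'(\mathbf a)),\sigma_{\max}(\mathbf F'(\mathbf b)),0\}$, $\mathcal S_L^{\rm std}=\min\{\sigma_{\min}(\mathbf F'(\mathbf a)),\sigma_{\min}(\mathbf F'(\mathbf b)),0\}$ (extreme eigenvalues); if $\mathbf a\ne\mathbf b$, with $\mathbf d=\mathbf b-\mathbf a$, $\mathbf e=\mathbf a-\mathbf b$, $$\mathcal S_R^{\rm ES}=\frac{\int_0^1\!\int_0^\xi\mathbf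 d^T\mathcal U''(\mathbf a+\zeta\mathbf d)\mathbf F'(\mathbf a+\xi\mathbf d)\mathbf d\,\mathrm d\zeta\mathrm d\xi+\int_0^1\mathcal U'(\mathbf a+\xi\mathbf d)\mathbf S(\mathbf a+\xi\mathbf d)B_x'\mathbf d\,\mathrm d\xi-\mathcal U'(\mathbf a)J(\Phi)}{\int_0^1\!\int_0^\xi\mathbf d^T\mathcal U''(\mathbf a+\zeta\mathbf d)\mathbf d\,\mathrm d\zeta\mathrm d\xi},$$ $$\mathcal S_L^{\rm ES}=\frac{\int_0^1\!\int_0^\xi\mathbf e^T\mathcal U''(\mathbf b+\zeta\mathbf e)\mathbf F'(\mathbf b+\xi\mathbf e)\mathbf e\,\mathrm d\zeta\mathrm d\xi+\int_0^1\mathcal U'(\mathbf b+\xi\mathbf e)\mathbf S(\mathbf b+\xi\mathbf e)B_x'\mathbf e\,\mathrm d\xi+\mathcal U'(\mathbf b)J(\Phi)}{\int_0^1\!\int_0^\xi\mathbf e^T\mathcal U''(\mathbf b+\zeta\mathbf e)\mathbf e\,\mathrm d\zeta\mathrm d\xi}.$$ Wave speeds: $\mathcal S_R=\max\{\mathcal S_R^{\rm std},\mathcal S_R^{\rm ES}\}$, $\mathcal S_L=\min\{\mathcal S_L^{\rm std},\mathcal S_L^{\rm ES}\}$ (std values if $\mathbf a=\mathbf b$), with $\mathcal S_R>\mathcal S_L$. HLL fluxes: $\hat{\mathbf F}=\frac{\mathcal S_R\mathbf F(\mathbf a)-\mathcal S_L\mathbf F(\mathbf b)+\mathcal S_R\mathcal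 S_L(\mathbf b-\mathbf a)}{\mathcal S_R-\mathcal S_L}$, $\hat{\mathcal F}=\frac{\mathcal S_R\mathcal F(\mathbf a)-\mathcal S_L\mathcal F(\mathbf b)+\mathcal S_R\mathcal S_L(\mathcal U(\mathbf b)-\mathcal U(\mathbf a))}{\mathcal S_R-\mathcal S_L}$; $\mathcal R^+=\frac{\mathcal S_R}{\mathcal S_R-\mathcal S_L}$, $\mathcal R^-=\frac{-\mathcal S_L}{\mathcal S_R-\mathcal S_L}$. **DG operator.** Uniform cells $I_i=[x_{i-1/2},x_{i+1/2}]$ of length $h=\Delta x$; $\mathbf V_h^k$ is the space of $\mathbb R^p$-valued piecewise polynomials of degree $\le k$. With one-sided limits $\mathbf U^\pm_{i+\frac12}$ and $\Psi_{i+\frac12}(\xi)=\Psi(\xi;\mathbf U^-_{i+\frac12},\mathbf U^+_{i+\frac12})$, let $\hat{\mathbf F}_{i+\frac12},\hat{\mathcal F}_{i+\frac12}$ and $\mathcal D^\pm_{i+\frac12}=\mathcal R^\pm J(\Psi_{i+\frac12})$ be the HLL flux $\hat{\mathbf F}$, the HLL entropy flux $\hat{\mathcal F}$ and the products $\mathcal R^\pm J(\Phi)$, respectively, all evaluated with $\mathbf a=\mathbf U^-_{i+\frac12}$, $\mathbf b=\mathbf U^+_{i+\frac12}$, $\Phi=\Psi_{i+\frac12}$ and the corresponding wave speeds $\mathcal S_R,\mathcal S_L$. $\mathcal L_h(\mathbf U_h)\in\mathbf V_h^k$ is defined by: for all $\mathbf W\in\mathbf V_h^k$, all $i$, $$\int_{I_i}\mathcal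 L_h(\mathbf U_h)\cdot\mathbf W\,\mathrm dx=\int_{I_i}\mathbf F(\mathbf U_h)\cdot\partial_x\mathbf W\,\mathrm dx-\hat{\mathbf F}_{i+\frac12}\cdot\mathbf W^-_{i+\frac12}+\hat{\mathbf F}_{i-\frac12}\cdot\mathbf W^+_{i-\frac12}-\mathcal D^-_{i+\frac12}\cdot\mathbf W^-_{i+\frac12}-\mathcal D^+_{i-\frac12}\cdot\mathbf W^+_{i-\frac12}-\int_{I_i}\mathbf S(\mathbf U_h)\cdot\mathbf W\,\partial_xB_{x,h}\,\mathrm dx .$$ **Multistep method.** $m$-step, $r$th-order accurate ($r\ge1$), $\alpha_l\ge0$, $\sum_l\alpha_l=1$; if $\beta_l<0$, $\mathcal L_h$ is replaced by the downwind operator $\tilde{\mathcal L}_h$, where $-\tilde{\mathcal L}_h$ is built by the same recipe for the system with $\mathbf F,\mathcal F,\mathbf S$ replaced by $-\mathbf F,-\mathcal F,-\mathbf S$, and then $\hat{\mathcal F}^{n+1-l}$ is minus the numerical entropy flux of that reversed system. Superscripts denote evaluation at the corresponding time level. Consistent starting values means that the starting values $\mathbf U_h^0,\dots,\mathbf U_h^{m-1}$ all converge to $\mathbf U_0$ in $L^1_{\rm loc}(\mathbb R)$. **Discrete entropy and limiter.** $\hat x_q$, $q=1,\dots,N$ ($N\ge k+1$), are Gauss--Lobatto points on $I_i$ with weights $\sum_q\omega_q=1$; $\tilde{\mathcal U}_i^n=\sum_q\omega_q\,\mathcal U(\mathbf U_h^n(\hat x_q))$. Let $\mathcal U^{\rm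 up}$ be the right-hand side of the discrete cell entropy inequality in the claim, $\bar{\mathbf U}_i^{n+1}$ the cell average of $\mathbf U_h^{n+1,(\rm pre)}$, $\mathcal U^{\rm high}=\tilde{\mathcal U}_i^{n+1,(\rm pre)}$, $\mathcal U^{\rm 1st}=\mathcal U(\bar{\mathbf U}_i^{n+1})$. The limiter sets $\mathbf U_h^{n+1}|_{I_i}=\bar{\mathbf U}_i^{n+1}+\theta_i(\mathbf U_h^{n+1,(\rm pre)}|_{I_i}-\bar{\mathbf U}_i^{n+1})$ with $\theta_i=\min\{\frac{\mathcal U^{\rm up}-\mathcal U^{\rm 1st}}{\mathcal U^{\rm high}-\mathcal U^{\rm 1st}},1\}$ ($\theta_i=1$ if $\mathcal U^{\rm high}=\mathcal U^{\rm 1st}$); under the scheme's CFL condition $\mathcal U^{\rm 1st}\le\mathcal U^{\rm up}$, so the discrete cell entropy inequality holds. **Conventions.** $\mathbb R^+=[0,\infty)$; $\mathbf U_h(x,t)=\mathbf U_h^n(x)$ for $t\in[t^n,t^{n+1})$, $t^n=n\Delta t$. *)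

(* Defs.v *)
From HB Require Import structures.
From mathcomp Require Export all_boot all_order all_algebra.
From mathcomp Require Export all_classical all_reals all_analysis.

Set Implicit Arguments.
Unset Strict Implicit.
Unset Printing Implicit Defensive.

Export Order.TTheory GRing.Theory Num.Theory numFieldNormedType.Exports.
Local Open Scope classical_set_scope.
Local Open Scope ring_scope.

(* A state (rho, rho u, E, B) is a row vector; the number of components of u
   and B is M = d.+1, so that the x-component is the entry of index ord0. *)
Notation state R d := 'rV[R]_(1 + (d.+1 + (1 + d.+1))).

(* An R^p-valued piecewise polynomial: one polynomial vector (in the physical
   variable x) per cell. One-sided limits at interfaces are the values of the
   polynomials of the adjacent cells. *)
Notation pwpoly R d := (int -> 'rV[{poly R}]_(1 + (d.+1 + (1 + d.+1)))).

Section Vectors.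
Context {R : realType}.

Definition dotv n (v w : 'rV[R]_n) : R := \sum_j v 0 j * w 0 j.

(* Euclidean norm; the library norm [`|v|] is the maximum norm. *)
Definition enorm n (v : 'rV[R]_n) : R := Num.sqrt (dotv v v).

Definition gradient n (f : 'rV[R]_n -> R) (u : 'rV[R]_n) : 'rV[R]_n :=
  \row_j 'D_(delta_mx 0 j) f u.

Definition hessian n (f : 'rV[R]_n -> R) (u : 'rV[R]_n) : 'M[R]_n :=
  \matrix_(i, j) 'D_(delta_mx 0 j) (fun v => 'D_(delta_mx 0 i) f v) u.

(* ['J f u] acts on row vectors from the right, i.e. it is the transpose of
   the usual Jacobian matrix f'(u). *)
Definition sigma_max n (f : 'rV[R]_n -> 'rV[R]_n) (u : 'rV[R]_n) : R :=
  sup [set s | eigenvalue ('J f u) s].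

Definition sigma_min n (f : 'rV[R]_n -> 'rV[R]_n) (u : 'rV[R]_n) : R :=
  inf [set s | eigenvalue ('J f u) s].

End Vectors.

Notation Rint := (Rintegral lebesgue_measure).

Section MHD.
Context {R : realType} {d : nat}.
Implicit Types U : state R d.

Definition mkstate (r : R) (m : 'rV[R]_d.+1) (e : R) (b : 'rV[R]_d.+1) :
  state R d := row_mx r%:M (row_mx m (row_mx e%:M b)).

Definition rho U : R := lsubmx U 0 0.
Definition mom U : 'rV[R]_d.+1 := lsubmx (rsubmx U).
Definition energy U : R := lsubmx (rsubmx (rsubmx U)) 0 0.
Definition mag U : 'rV[R]_d.+1 := rsubmx (rsubmx (rsubmx U)).
Definition vel U : 'rV[R]_d.+1 := (rho U)^-1 *: mom U.
Definition ux U : R := vel U 0 ord0.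
(* [Bx] is linear: it is also the action of the constant row vector B_x'. *)
Definition Bx U : R := mag U 0 ord0.

Definition gam : R := 5 / 3.
Definition pres U : R :=
  (gam - 1) * (energy U - 2^-1 * rho U * enorm (vel U) ^+ 2
               - 2^-1 * enorm (mag U) ^+ 2).
Definition pstar U : R := pres U + 2^-1 * enorm (mag U) ^+ 2.

Definition admissible : set (state R d) := [set U | 0 < rho U /\ 0 < pres U].

Definition mhd_flux U : state R d :=
  mkstate (rho U * ux U)
          ((rho U * ux U) *: vel U + pstar U *: delta_mx 0 ord0
           - Bx U *: mag U)
          (ux U * (energy U + pstar U) - Bx U * dotv (vel U) (mag U))
          (ux U *: mag U - Bx U *: vel U).

Definition spec_entropy U : R := ln (pres U * rho U `^ (- gam)).
Definition entropy U : R := - (rho U * spec_entropy U) / (gam - 1).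
Definition mhd_eflux U : R := - (rho U * spec_entropy U * ux U) / (gam - 1).

(* the gradient of phi_0 = 2 beta (u . B), beta = rho / (2 P), with respect to
   the entropy variables *)
Definition mhd_source U : state R d :=
  mkstate 0 (mag U) (dotv (vel U) (mag U)) (vel U).

End MHD.

Record system (R : realType) (d : nat) := System {
  flux : state R d -> state R d ;
  eflux : state R d -> R ;
  source : state R d -> state R d }.

Definition mhd (R : realType) (d : nat) : system R d :=
  System mhd_flux mhd_eflux mhd_source.

Definition opp_system (R : realType) (d : nat) (s : system R d) :=
  System (fun U => - flux s U) (fun U => - eflux s U) (fun U => - source s U).

Section Paths.
Context {R : realType} {d : nat}.

(* The straight path is only locally Lipschitz in (xi, U^-, U^+), so Lipschitz
   continuity is required on compact sets of end states. Positivity of rho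
   along the path makes the source term meaningful. *)
Record prescribed_path (Psi : R -> state R d -> state R d -> state R d)
    : Prop := PrescribedPath {
  path0 : forall a b, admissible a -> admissible b -> Psi 0 a b = a ;
  path1 : forall a b, admissible a -> admissible b -> Psi 1 a b = b ;
  path_diag : forall xi a, xi \in `[0, 1] -> admissible a -> Psi xi a a = a ;
  path_rho : forall xi a b, xi \in `[0, 1] -> admissible a -> admissible b ->
    0 < rho (Psi xi a b) ;
  path_lipschitz : forall K : set (state R d), compact K -> K `<=` admissible ->
    [lipschitz Psi x.1.1 x.1.2 x.2 | x in (`[0, 1] `*` K) `*` K] }.

End Paths.

Section HLL.
Context {R : realType} {d : nat} (s : system R d).
Implicit Types (a b e : state R d) (Phi : R -> state R d).

(* int_0^1 S(Phi) B_x' Phi' dxi *)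
Definition path_int Phi : state R d :=
  \row_j Rint `[0, 1] (fun xi => source s (Phi xi) 0 j * Bx (derive1 Phi xi)).

Definition SR_std a b : R :=
  Num.max (Num.max (sigma_max (flux s) a) (sigma_max (flux s) b)) 0.
Definition SL_std a b : R :=
  Num.min (Num.min (sigma_min (flux s) a) (sigma_min (flux s) b)) 0.

(* The common part of the numerators, and the denominator, of the entropy
   stable wave speeds, for the segment from [a] to [a + e]. *)
Definition ES_num a e : R :=
  Rint `[0, 1] (fun xi => Rint `[0, xi] (fun zeta =>
    dotv (e *m hessian entropy (a + zeta *: e))
         (e *m 'J (flux s) (a + xi *: e))))
  + Rint `[0, 1] (fun xi =>
      dotv (gradient entropy (a + xi *: e)) (source s (a + xi *: e)) * Bx e).
Definition ES_den a e : R :=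
  Rint `[0, 1] (fun xi => Rint `[0, xi] (fun zeta =>
    dotv (e *m hessian entropy (a + zeta *: e)) e)).

Definition SR_ES a b Phi : R :=
  (ES_num a (b - a) - dotv (gradient entropy a) (path_int Phi))
  / ES_den a (b - a).
Definition SL_ES a b Phi : R :=
  (ES_num b (a - b) + dotv (gradient entropy b) (path_int Phi))
  / ES_den b (a - b).

Definition SR a b Phi : R :=
  if a == b then SR_std a b else Num.max (SR_std a b) (SR_ES a b Phi).
Definition SL a b Phi : R :=
  if a == b then SL_std a b else Num.min (SL_std a b) (SL_ES a b Phi).

Definition hll_flux a b Phi : state R d :=
  let sR := SR a b Phi in let sL := SL a b Phi in
  (sR - sL)^-1 *: (sR *: flux s a - sL *: flux s b + (sR * sL) *: (b - a)).

Definition hll_eflux a b Phi : R :=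
  let sR := SR a b Phi in let sL := SL a b Phi in
  (sR * eflux s a - sL * eflux s b + sR * sL * (entropy b - entropy a))
  / (sR - sL).

Definition hll_Dp a b Phi : state R d :=
  let sR := SR a b Phi in let sL := SL a b Phi in
  (sR / (sR - sL)) *: path_int Phi.
Definition hll_Dm a b Phi : state R d :=
  let sR := SR a b Phi in let sL := SL a b Phi in
  (- sL / (sR - sL)) *: path_int Phi.

End HLL.

(* A uniform mesh with time step [dt]; the left end of the cell I_0 is
   [origin]. *)
Record mesh (R : realType) := Mesh { origin : R ; dx : R ; dt : R }.

Section DG.
Context {R : realType} {d : nat} (m : mesh R).
Implicit Types (i : int) (k : nat) (U W L : pwpoly R d).

(* x_{i-1/2}; hence x_{i+1/2} is [xhalf (i + 1)] *)
Definition xhalf i : R := origin m + i%:~R * dx m.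
Definition xcenter i : R := xhalf i + dx m / 2.
Definition cell i : set R := `[xhalf i, xhalf (i + 1)].
Definition cell_index (x : R) : int := Num.floor ((x - origin m) / dx m).

Definition in_Vhk k U : Prop := forall i j, (size (U i ord0 j) <= k.+1)%N.

Definition peval (v : 'rV[{poly R}]_(1 + (d.+1 + (1 + d.+1)))) (x : R) :
  state R d := map_mx (horner^~ x) v.
Definition pderiv (v : 'rV[{poly R}]_(1 + (d.+1 + (1 + d.+1)))) :=
  map_mx (@deriv R) v.

Definition at_point U (x : R) : state R d := peval (U (cell_index x)) x.

(* one-sided values at x_{i+1/2} *)
Definition Um U i : state R d := peval (U i) (xhalf (i + 1)).
Definition Up U i : state R d := peval (U (i + 1)) (xhalf (i + 1)).

Section Operator.
Variables (s : system R d) (Psi : R -> state R d -> state R d -> state R d).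

(* An interface quantity at x_{i+1/2}, for the path joining the traces *)
Definition at_interface T (f : state R d -> state R d -> (R -> state R d) -> T)
  U i : T := f (Um U i) (Up U i) (fun xi => Psi xi (Um U i) (Up U i)).

Definition Fhat := at_interface (hll_flux s).
Definition EFhat := at_interface (hll_eflux s).
Definition Dplus := at_interface (hll_Dp s).
Definition Dminus := at_interface (hll_Dm s).

Definition DG_operator k U L : Prop :=
  [/\ forall i, at_interface (SL s) U i < at_interface (SR s) U i,
      in_Vhk k L &
      forall W, in_Vhk k W -> forall i,
        Rint (cell i) (fun x => dotv (peval (L i) x) (peval (W i) x))
        = Rint (cell i) (fun x =>
            dotv (flux s (peval (U i) x)) (peval (pderiv (W i)) x))
          - dotv (Fhat U i) (Um W i)
          + dotv (Fhat U (i - 1)) (Up W (i - 1))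
          - dotv (Dminus U i) (Um W i)
          - dotv (Dplus U (i - 1)) (Up W (i - 1))
          - Rint (cell i) (fun x =>
              dotv (source s (peval (U i) x)) (peval (W i) x)
              * Bx (peval (pderiv (U i)) x))].

End Operator.

Variable Psi : R -> state R d -> state R d -> state R d.

(* L_h, or its downwind version if the coefficient [beta] is negative: minus
   the downwind operator is the DG operator of the reversed system. *)
Definition spatial_operator k (beta : R) U L : Prop :=
  if beta < 0 then DG_operator (opp_system (mhd R d)) Psi k U (fun i => - L i)
  else DG_operator (mhd R d) Psi k U L.

Definition entropy_flux (beta : R) U i : R :=
  if beta < 0 then - EFhat (opp_system (mhd R d)) Psi U i
  else EFhat (mhd R d) Psi U i.

Definition cell_average U i : state R d :=
  \row_j ((dx m)^-1 * Rint (cell i) (fun x => (U i 0 j).[x])).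

Section Quadrature.
Variables (N : nat) (node weight : 'I_N -> R).

(* The N-point Gauss-Lobatto rule on [-1, 1], with weights of sum 1 *)
Definition gauss_lobatto : Prop :=
  [/\ (2 <= N)%N,
      forall q q' : 'I_N, (q < q')%N -> node q < node q',
      forall q : 'I_N, val q = 0%N -> node q = -1,
      forall q : 'I_N, val q = N.-1 -> node q = 1 &
      forall p : {poly R}, (size p <= 2 * N - 2)%N ->
        \sum_q weight q * p.[node q] = 2^-1 * Rint `[-1, 1] (fun x => p.[x])].

Definition cell_entropy U i : R :=
  \sum_q weight q * entropy (peval (U i) (xcenter i + dx m / 2 * node q)).

Section Multistep.
Variables (ms : nat) (alpha beta : 'I_ms -> R).

(* The coefficients of the level n + 1 - l, l = 1, ..., ms, have index
   l.-1 : 'I_ms; below [n] is the new time level. *)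
Definition entropy_bound (U : nat -> pwpoly R d) (n : nat) i : R :=
  \sum_(l < ms)
    (alpha l * cell_entropy (U (n - l.+1)%N) i
     - beta l * (dt m / dx m) *
       (entropy_flux (beta l) (U (n - l.+1)%N) i
        - entropy_flux (beta l) (U (n - l.+1)%N) (i - 1))).

Definition limiter_coef (U : nat -> pwpoly R d) (pre : pwpoly R d)
    (n : nat) i : R :=
  let upper := entropy_bound U n i in
  let high := cell_entropy pre i in
  let first := entropy (cell_average pre i) in
  if high == first then 1 else Num.min ((upper - first) / (high - first)) 1.

Definition limited (theta : R) (pre : pwpoly R d) i :=
  map_mx polyC (cell_average pre i)
  + theta%:P *: (pre i - map_mx polyC (cell_average pre i)).

Definition scheme_step k (U : nat -> pwpoly R d) (n : nat) : Prop :=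
  exists (L : 'I_ms -> pwpoly R d) (pre : pwpoly R d),
  [/\ forall l, spatial_operator k (beta l) (U (n - l.+1)%N) (L l),
      forall i, pre i = \sum_(l < ms)
        ((alpha l)%:P *: U (n - l.+1)%N i + (beta l * dt m)%:P *: L l i) &
      forall i, U n i = limited (limiter_coef U pre n i) pre i].

(* [U n] is the numerical solution at time n dt. *)
Definition numerical_solution k (U : nat -> pwpoly R d) : Prop :=
  [/\ forall n, in_Vhk k (U n),
      forall n, (ms <= n)%N -> scheme_step k U n &
      forall n, (ms <= n)%N -> forall i,
        cell_entropy (U n) i <= entropy_bound U n i].

End Multistep.
End Quadrature.

(* max over x in B_i of the distance of U_h(x) to U_h(x_i); at the interfaces
   both one-sided values are taken into account. *)
Definition max_variation U i : R :=
  sup [set y | exists i' x, [/\ i' \in [:: i - 1; i; i + 1], cell i' x &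
                 y = enorm (peval (U i') x - peval (U i) (xcenter i))]].

Definition TVB_seminorm (U : nat -> pwpoly R d) : \bar R :=
  ereal_sup [set ((dx m)%:E * \esum_(i in setT) (max_variation (U n) i)%:E)%E
            | n in setT].

(* U_h(x, t) = U_h^n(x) for t in [n dt, (n + 1) dt[ *)
Definition in_time (U : nat -> pwpoly R d) (z : R * R) : state R d :=
  at_point (U (Num.truncn (z.2 / dt m))) z.1.

End DG.

Section Coefficients.
Context {R : realType}.

Definition forward_euler (ms : nat) (alpha beta : 'I_ms -> R) : Prop :=
  [/\ ms = 1%N, forall l, alpha l = 1 & forall l, beta l = 1].

(* Order r: exactness on polynomials of degree <= r (time step 1, new time
   level 0, old levels -1, ..., -ms). *)
Definition ssp_multistep (r ms : nat) (alpha beta : 'I_ms -> R) : Prop :=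
  [/\ forall l, 0 <= alpha l,
      \sum_l alpha l = 1 &
      forall p : {poly R}, (size p <= r.+1)%N ->
        p.[0] = \sum_(l < ms) (alpha l * p.[- (l.+1)%:R]
                               + beta l * p^`().[- (l.+1)%:R])].

End Coefficients.

Section Convergence.
Context {R : realType} {n : nat}.
Local Notation mu := (@lebesgue_measure R).

Definition cvg_L1loc_space (u : nat -> R -> 'rV[R]_n) (v : R -> 'rV[R]_n) :=
  (forall j, measurable_fun setT (fun x => v x 0 j)) /\
  forall a b : R,
    (\int[mu]_(x in `[a, b]) (enorm (u j x - v x))%:E)%E @[j --> \oo] --> 0%E.

Definition cvg_L1loc_spacetime (u : nat -> R * R -> 'rV[R]_n)
    (v : R * R -> 'rV[R]_n) :=
  (forall j, measurable_fun ([set: R] `*` `[(0 : R), +oo[) (fun z => v z 0 j)) /\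
  forall a b T : R,
    (\int[(mu \x mu)]_(z in `[a, b] `*` `[0%R, T]) (enorm (u j z - v z))%:E)%E
      @[j --> \oo] --> 0%E.

End Convergence.

Section TestFunctions.
Context {R : realType}.

Definition ddx (f : R * R -> R) : R * R -> R := 'D_(1, 0) f.
Definition ddt (f : R * R -> R) : R * R -> R := 'D_(0, 1) f.

Fixpoint Cn (n : nat) (f : R * R -> R) : Prop :=
  continuous f /\
  if n is n'.+1 then
    [/\ forall z, derivable f z (1, 0), forall z, derivable f z (0, 1),
        Cn n' (ddx f) & Cn n' (ddt f)]
  else True.

(* C_0^oo(R x R^+), R^+ = [0, +oo[: a smooth function on the closed half-plane
   is the restriction of a smooth function on the plane, whose values for
   t < 0 are irrelevant. The support may meet the line t = 0. *)
Definition test_function (phi : R * R -> R) : Prop :=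
  (forall n, Cn n phi) /\
  exists r : R, forall x t : R, 0 <= t -> r < `|x| \/ r < t -> phi (x, t) = 0.

End TestFunctions.

(* Main.v *)
From HB Require Import structures.
Require Import Defs.
From mathcomp Require Import measurable_realfun zify ring lra.
Set Implicit Arguments.
Unset Strict Implicit.
Unset Printing Implicit Defensive.
Local Open Scope classical_set_scope.
Local Open Scope ring_scope.

(* Lax-Wendroff argument. Summing the cell entropy inequality against the values
   of phi at the cell centers and summing by parts gives a weak inequality between
   integrals of functions constant on the space-time cells. There the discrete
   entropies and fluxes differ from U(Ustar) and F(Ustar) by at most a constant
   times the local variation plus |U_h - Ustar|, and both errors vanish in the
   limit. The initial levels n < m leave sum_l l alpha_l copies of the initial
   integral, and exactness on linear polynomials gives sum_l beta_l the same
   positive value, which cancels.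
   Consistency of the HLL entropy flux needs bounded wave speeds: the denominator
   is at least c |d|^2 (uniform convexity on compact sets), and the numerator is
   O(|d|^2) because V(a).S(x) = phi_0(a) up to second order, so that the two terms
   linear in d cancel. As paths are only Lipschitz, this uses the fundamental
   theorem of calculus for Lipschitz functions. *)

(** A path is only Lipschitz in its parameter, so [derive1] of it takes default values on a null
    set, and the integrand of [path_int] is not known to be measurable. It is replaced by a bounded
    measurable density off that null set, and the remaining comparisons of integrals rest on
    monotonicity alone. A path may also leave the admissible set, only its density staying positive;
    hence the source is evaluated along it, whereas the entropy variables are taken at the end
    state. In the HLL entropy flux the jump of the entropy has the coefficient S_R S_L / (S_R -
    S_L), of modulus at most S_R because S_L <= 0 <= S_R; an upper bound on S_R therefore controls
    the flux. Convergence in L^1 gives no pointwise limit along the sequence. The limits of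
    integrals come instead from pointwise errors bounded by functions whose integrals tend to 0, and
    the limit state lies in K almost everywhere because K is closed. The summation by parts in time
    leaves indicators that vanish only on the first m levels; they are counted as an error supported
    in a strip of width m dt. *)

Section RowVectors.
Context {R : realType}.

Lemma mx_norm_coord m (v : 'rV[R]_m) j : `|v 0 j| <= `|v|.
Proof.
by rewrite [leRHS]/Num.norm /= mx_normrE; apply: (le_bigmax _ (fun ij => `|v ij.1 ij.2|) (0, j)).
Qed.

Lemma mx_norm_le m (v : 'rV[R]_m) (M : R) : 0 <= M ->
  (forall j, `|v 0 j| <= M) -> `|v| <= M.
Proof.
move=> M0 vM; rewrite [leLHS]/Num.norm /= mx_normrE.
by apply: bigmax_le => // -[i j] _; rewrite (ord1 i).
Qed.

Lemma norm_dotv m (v w : 'rV[R]_m) : `|dotv v w| <= m%:R * (`|v| * `|w|).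
Proof.
apply: (le_trans (ler_norm_sum _ _ _)).
rewrite (_ : m%:R * _ = \sum_(j < m) (`|v| * `|w|)).
  by apply: ler_sum => j _; rewrite normrM ler_pM ?mx_norm_coord.
by rewrite sumr_const card_ord mulr_natl.
Qed.

End RowVectors.

(** * Continuous differentiability *)

Section ContinuouslyDifferentiable.
Context {R : realType} {n : nat}.
Local Notation V := 'rV[R]_n.
Implicit Types (G : set V) (f g : V -> R) (df dg : V -> V -> R).

(** The differential is an explicit function of base point and direction, so that formulas for it
    can be checked by [ring] and [field]. Continuity is asked in the base point only, since
    [is_diff] already makes [df w] linear in the direction. *)
Definition isC1 G f df := forall w, G w ->
  is_diff w f (df w) /\ forall v, {for w, continuous (fun x => df x v)}.

Lemma isC1_ext G f g df dg : (forall x, f x = g x) ->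
  (forall w v, df w v = dg w v) -> isC1 G f df -> isC1 G g dg.
Proof.
move=> /funext <- dE; suff -> : df = dg by [].
by apply/funext => w; apply/funext => v.
Qed.

Lemma isC1_continuous G f df w : isC1 G f df -> G w -> {for w, continuous f}.
Proof. by move=> fC Gw; apply: differentiable_continuous; have [[]] := fC w Gw. Qed.

Lemma isC1_derive G f df w v : isC1 G f df -> G w -> 'D_v f w = df w v.
Proof. by move=> fC Gw; have [[dfw <-] _] := fC w Gw; rewrite deriveE. Qed.

Lemma isC1_linear G f df w (a : R) x y : isC1 G f df -> G w ->
  df w (a *: x + y) = a * df w x + df w y.
Proof. by move=> fC Gw; have [[dfw <-] _] := fC w Gw; rewrite linearP. Qed.

Lemma isC1_sum G f df w v : isC1 G f df -> G w ->
  df w v = \sum_j v 0 j * df w (delta_mx 0 j).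
Proof.
move=> fC Gw; have [[dfw dfE] _] := fC w Gw; rewrite -dfE.
rewrite [v in LHS]row_sum_delta linear_sum.
by apply: eq_bigr => j _; rewrite linearZ.
Qed.

Lemma isC1_cst G (c : R) : isC1 G (fun=> c) (fun _ _ => 0).
Proof.
move=> w _; split=> [|v]; last exact: cst_continuous.
exact: (is_diff_cst c w).
Qed.

Lemma isC1_lin G (f : {linear V -> R}) : continuous f ->
  isC1 G f (fun=> f).
Proof.
move=> cf w _; split=> [|v]; last exact: cst_continuous.
by apply: DiffDef; [exact: linear_differentiable|rewrite diff_lin].
Qed.

Lemma isC1D G f g df dg : isC1 G f df -> isC1 G g dg ->
  isC1 G (fun x => f x + g x) (fun w v => df w v + dg w v).
Proof.
move=> fC gC w Gw; have [fw cf] := fC w Gw; have [gw cg] := gC w Gw.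
split=> [|v]; first exact: is_diffD.
exact: (@continuousD _ R^o _ (fun x => df x v) (fun x => dg x v) w (cf v) (cg v)).
Qed.

Lemma isC1M G f g df dg : isC1 G f df -> isC1 G g dg ->
  isC1 G (fun x => f x * g x) (fun w v => f w * dg w v + g w * df w v).
Proof.
move=> fC gC w Gw; have [fw cf] := fC w Gw; have [gw cg] := gC w Gw.
have cfw := isC1_continuous fC Gw; have cgw := isC1_continuous gC Gw.
split=> [|v]; first exact: is_diffM.
apply: (@continuousD _ R^o _ (fun x => f x * dg x v) (fun x => g x * df x v) w).
- exact: (@continuousM _ _ f (fun x => dg x v) w cfw (cg v)).
- exact: (@continuousM _ _ g (fun x => df x v) w cgw (cf v)).
Qed.

Lemma isC1Z G (c : R) f df : isC1 G f df ->
  isC1 G (fun x => c * f x) (fun w v => c * df w v).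
Proof.
move=> fC w Gw; have [fw cf] := fC w Gw.
split=> [|v]; first exact: is_diffZ.
apply: (@continuousM _ _ (cst c) (fun x => df x v) w _ (cf v)).
exact: cst_continuous.
Qed.

Lemma isC1N G f df : isC1 G f df ->
  isC1 G (fun x => - f x) (fun w v => - df w v).
Proof.
move=> fC w Gw; have [fw cf] := fC w Gw.
split=> [|v]; first exact: is_diffN.
exact: (@continuousN _ R^o _ (fun x => df x v) w (cf v)).
Qed.

Lemma isC1_comp G f df (h dh : R -> R) : isC1 G f df ->
  (forall w, G w -> is_derive (f w) 1 h (dh (f w)) /\ {for f w, continuous dh}) ->
  isC1 G (fun x => h (f x)) (fun w v => dh (f w) * df w v).
Proof.
move=> fC hC w Gw; have [fw cf] := fC w Gw; have [hw ch] := hC w Gw.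
have cfw := isC1_continuous fC Gw.
split=> [|v].
  have hd : is_diff (f w) h (fun y => dh (f w) * y).
    have [hw1 hw2] := hw; split; first exact/derivable1_diffP.
    apply/funext => y; rewrite deriv1E //= derive1E hw2.
    by rewrite mulrC.
  exact: (is_diff_comp fw hd).
apply: (@continuousM _ _ (fun x => dh (f x)) (fun x => df x v) w _ (cf v)).
exact: (@continuous_comp _ _ _ f dh w).
Qed.

Lemma isC1V G f df : isC1 G f df -> (forall w, G w -> f w != 0) ->
  isC1 G (fun x => (f x)^-1) (fun w v => - (f w) ^- 2 * df w v).
Proof.
move=> fC f0; apply: (@isC1_comp G f df GRing.inv (fun x => - x ^- 2)) => // w Gw.
split.
  have h := differentiable_Rinv (f0 w Gw).
  split; first exact/derivable1_diffP.
  by rewrite deriveE // diff_Rinv ?f0 //= [LHS]mulr1.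
have := f0 w Gw; move: (f w) => y y0.
apply: (@continuousN _ R^o); apply: (@continuousV _ _ (fun x : R => x ^+ 2)).
  by rewrite expf_neq0.
exact: exprn_continuous.
Qed.

Lemma isC1_ln G f df : isC1 G f df -> (forall w, G w -> 0 < f w) ->
  isC1 G (fun x => ln (f x)) (fun w v => (f w)^-1 * df w v).
Proof.
move=> fC f0; apply: (@isC1_comp G f df (@ln R) (fun y => y^-1)) => // w Gw.
split; first exact: is_derive1_ln (f0 w Gw).
apply: (@continuousV _ _ (@id R)); last exact: cvg_id.
by rewrite /= gt_eqF // f0.
Qed.

(** Differentiability is local: the first order expansion of [f] at [w] is also one of [g], and the
    differential is unique. *)
Lemma near_eq_is_diff f g (df : V -> R) w :
  (\forall x \near w, f x = g x) -> is_diff w f df -> is_diff w g df.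
Proof.
move=> fg [dw dE].
have [cd /eqaddoP od] := (diff_locallyP _ _).1 dw.
have og : g \o shift w = cst (g w) + 'd f w +o_ 0 id.
  apply/eqaddoP => e e0; have := od e e0.
  apply: filter_app; near=> x.
  rewrite !fctE /= -(nbhs_singleton fg) => h.
  have <- // : f (x + w) = g (x + w).
  near: x.
  by move: fg; rewrite (near_shift 0 w) /=; apply: filterS => y /=; rewrite subr0.
have dg := diff_unique cd og.
split; last by rewrite dg.
by apply/diff_locallyP; rewrite dg.
Unshelve. all: by end_near. Qed.

Lemma isC1_eq G f g df dg : open G -> isC1 G f df ->
  (forall w, G w -> f w = g w) -> (forall w v, G w -> df w v = dg w v) ->
  isC1 G g dg.
Proof.
move=> oG fC fg dfg w Gw; have [fw cf] := fC w Gw.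
have nG : \forall x \near w, G x by exact: open_nbhs_nbhs.
split=> [|v].
  have <- : df w = dg w by apply/funext => v; exact: dfg.
  apply: near_eq_is_diff fw; apply: filterS nG => x; exact: fg.
rewrite /prop_for /continuous_at -dfg //.
apply: cvg_trans (cf v); apply: (@near_eq_cvg _ _ (nbhs w)).
by apply: filterS nG => x Gx; rewrite dfg.
Qed.

Lemma bounded_on_compact (C : set V) f : compact C ->
  (forall w, C w -> {for w, continuous f}) ->
  exists2 M, 0 < M & forall w, C w -> `|f w| <= M.
Proof.
move=> cC cf.
have : compact (f @` C).
  apply: continuous_compact => //; apply: continuous_in_subspaceT => x.
  by rewrite inE => /cf.
move=> /compact_bounded [M [_ MC]].
exists (`|M| + 1) => [|w Cw]; first by rewrite ltr_wpDl.
by apply: MC; [rewrite (le_lt_trans (ler_norm M)) ?ltrDl|exists w].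
Qed.

Lemma isC1_bounded G (C : set V) f df : compact C -> C `<=` G -> isC1 G f df ->
  exists2 M, 0 < M & forall w v, C w -> `|df w v| <= M * `|v|.
Proof.
move=> cC CG fC.
have /choice [M MP] : forall j : 'I_n, exists M : R,
    0 < M /\ forall w, C w -> `|df w (delta_mx 0 j)| <= M.
  move=> j; have [] := @bounded_on_compact C (fun w => df w (delta_mx 0 j)) cC.
    by move=> w /CG Gw; exact: (fC w Gw).2.
  by move=> M M0 MC; exists M.
exists (1 + \sum_j M j).
  by rewrite ltr_pwDl // sumr_ge0 // => j _; exact: ltW (MP j).1.
move=> w v Cw; rewrite (isC1_sum v fC (CG w Cw)).
apply: (le_trans (ler_norm_sum _ _ _)).
apply: (@le_trans _ _ (\sum_j M j * `|v|)); last first.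
  by rewrite mulrDl mul1r mulr_suml lerDr.
apply: ler_sum => j _; rewrite normrM mulrC ler_pM ?(MP j).2 //.
exact: mx_norm_coord.
Qed.

(** Mean value theorem for t |-> f (a + t d); only the derivative in the direction of the segment
    has to be bounded. *)
Lemma isC1_segment_lipschitz G f df (M : R) a d : isC1 G f df ->
  (forall xi, 0 <= xi <= 1 -> G (a + xi *: d)) ->
  (forall xi, 0 <= xi <= 1 -> `|df (a + xi *: d) d| <= M * `|d|) ->
  `|f (a + d) - f a| <= M * `|d|.
Proof.
move=> fC sG sM.
pose h t := f (a + t *: d).
have hd (t : R) : 0 <= t <= 1 -> is_derive t 1 h (df (a + t *: d) d).
  move=> /sG Gt; have [fw _] := fC _ Gt.
  have ld : is_diff t (fun t : R => a + t *: d) (fun s => s *: d).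
    have := is_diffD (is_diff_cst a t) (is_diff_scalel t d).
    by rewrite add0r.
  have [dh hE] := is_diff_comp ld fw.
  split; first exact: diff_derivable.
  by rewrite deriveE // hE /= scale1r.
have [||t] := @MVT_segment R h (fun t => df (a + t *: d) d) 0 1 ler01.
- by move=> t /itvP t01; apply: hd; rewrite !t01.
- apply: derivable_within_continuous => t /itvP t01.
  by have [] := hd t; rewrite ?t01.
- move=> t01.
  rewrite /h scale1r scale0r addr0 subr0 mulr1 => ->.
  by apply: sM; move/itvP: t01 => t01; rewrite !t01.
Qed.


Lemma isC1_subset G (H : set V) f df : H `<=` G -> isC1 G f df -> isC1 H f df.
Proof. by move=> HG fC w /HG; exact: fC. Qed.

Lemma isC1_bigsum G (I : Type) (r : seq I) (F : I -> V -> R)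
    (dF : I -> V -> V -> R) : (forall i, isC1 G (F i) (dF i)) ->
  isC1 G (fun x => \sum_(i <- r) F i x) (fun w v => \sum_(i <- r) dF i w v).
Proof.
move=> FC; elim: r => [|i r IH].
  by apply: isC1_ext (isC1_cst 0) => [x|w v]; rewrite big_nil.
by apply: isC1_ext (isC1D (FC i) IH) => [x|w v]; rewrite big_cons.
Qed.

Lemma isC1_coord G j : isC1 G (fun x => x 0 j) (fun _ v => v 0 j).
Proof.
move=> w _; split=> [|v]; last exact: cst_continuous.
have @f : {linear V -> R}.
  by exists (fun N : V => N 0 j); do 2![eexists]; do ?[constructor];
     rewrite ?mxE// => ? *; rewrite ?mxE//; move=> ?; rewrite !mxE.
exact: ((@isC1_lin setT f (@coord_continuous _ 1 n 0 j)) w I).1.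
Qed.

Lemma isC1_gradient G f df w v : isC1 G f df -> G w ->
  dotv (gradient f w) v = df w v.
Proof.
move=> fC Gw; rewrite (isC1_sum v fC Gw); apply: eq_bigr => j _.
by rewrite !mxE (isC1_derive _ fC Gw) mulrC.
Qed.

(** The inner derivative in [hessian] is known on G only, so openness of G is used to replace it
    near [w]. Contracting with [v] before the outer differentiation makes the double sum the
    derivative of [df^~ v]. *)
Lemma isC1_hessian G f df ddf w v y : open G -> isC1 G f df ->
  (forall x, isC1 G (df^~ x) (fun w => ddf w x)) -> G w ->
  dotv (v *m hessian f w) y = ddf w v y.
Proof.
move=> oG fC dfC Gw.
have nG : \forall x \near w, G x by exact: open_nbhs_nbhs.
have HE i j : hessian f w i j = ddf w (delta_mx 0 i) (delta_mx 0 j).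
  rewrite mxE -(isC1_derive _ (dfC _) Gw); apply: near_eq_derive.
  by apply: filterS nG => x Gx; rewrite (isC1_derive _ fC Gx).
pose g x := \sum_i v 0 i * df x (delta_mx 0 i).
have gC : isC1 G g (fun w y => \sum_i v 0 i * ddf w (delta_mx 0 i) y).
  by apply: isC1_bigsum => i; apply: isC1Z; exact: dfC.
rewrite -(isC1_derive y (dfC v) Gw) -(near_eq_derive _ (f := g)); last first.
  by apply: filterS nG => x Gx; rewrite (isC1_sum v fC Gx).
rewrite (isC1_derive y gC Gw) /dotv.
under eq_bigr => j _ do rewrite mxE mulr_suml.
rewrite exchange_big /=; apply: eq_bigr => i _.
rewrite (isC1_sum y (dfC _) Gw) mulr_sumr; apply: eq_bigr => j _.
by rewrite HE; ring.
Qed.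

Definition isC1v m G (F : V -> 'rV[R]_m) (dF : V -> V -> 'rV[R]_m) :=
  forall i, isC1 G (fun x => F x 0 i) (fun w v => dF w v 0 i).

Lemma isC1v_differentiable m G (F : V -> 'rV[R]_m) dF w : isC1v G F dF -> G w ->
  differentiable F w.
Proof.
move=> FC Gw.
rewrite (_ : F = \sum_(i < m) (fun x => F x 0 i *: delta_mx 0 i)); last first.
  by apply/funext => x; rewrite fct_sumE -row_sum_delta.
apply: differentiable_sum => i; apply: differentiableZl.
by have [[]] := FC i w Gw.
Qed.

Lemma isC1v_jacobian m G (F : V -> 'rV[R]_m) dF w v : isC1v G F dF -> G w ->
  v *m 'J F w = dF w v.
Proof.
move=> FC Gw; have dfw := isC1v_differentiable FC Gw.
rewrite -deriveEjacobian // derive_mx; last exact: diff_derivable.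
by apply/rowP => i; rewrite mxE (isC1_derive _ (FC i) Gw).
Qed.

Lemma isC1v_dotv m G (F H : V -> 'rV[R]_m) dF dH : isC1v G F dF -> isC1v G H dH ->
  isC1 G (fun x => dotv (F x) (H x))
         (fun w v => dotv (F w) (dH w v) + dotv (H w) (dF w v)).
Proof.
move=> FC HC.
have S : isC1 G (fun x => \sum_i F x 0 i * H x 0 i)
    (fun w v => \sum_i (F w 0 i * dH w v 0 i + H w 0 i * dF w v 0 i)).
  by apply: isC1_bigsum => i; exact: isC1M.
by apply: isC1_ext S => // w v; rewrite big_split.
Qed.

Lemma isC1v_bounded m G (C : set V) (F : V -> 'rV[R]_m) dF : compact C ->
  C `<=` G -> isC1v G F dF ->
  exists2 M, 0 < M & forall w v, C w -> `|dF w v| <= M * `|v|.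
Proof.
move=> cC CG FC.
have /choice [M MP] : forall j : 'I_m, exists M : R,
    0 < M /\ forall w v, C w -> `|dF w v 0 j| <= M * `|v|.
  move=> j; have [M M0 MP] := isC1_bounded cC CG (FC j); by exists M.
exists (1 + \sum_j M j).
  by rewrite ltr_pwDl // sumr_ge0 // => j _; exact: ltW (MP j).1.
move=> w v Cw; have S0 : 0 <= \sum_j M j.
  by rewrite sumr_ge0 // => j _; exact: ltW (MP j).1.
apply: mx_norm_le => [|j]; first by rewrite mulr_ge0 // addr_ge0.
apply: (le_trans ((MP j).2 w v Cw)); rewrite ler_wpM2r //.
rewrite (bigD1 j) //= addrA (addrC 1) -addrA lerDl addr_ge0 // sumr_ge0 // => i _.
exact: ltW (MP i).1.
Qed.

End ContinuouslyDifferentiable.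

(** * Integrals of functions not known to be measurable *)

Section NonmeasurableIntegrands.
Context d {T : measurableType d} {R : realType}.
Variable mu : {measure set T -> \bar R}.
Implicit Types (D N : set T).
Import HBNNSimple.

(* The integral of a nonnegative function is a supremum over the simple
   functions below it, so monotonicity needs no measurability. *)
Lemma ge0_le_integral_nm D (f g : T -> \bar R) :
  (forall x, D x -> (0 <= f x)%E) -> (forall x, D x -> (f x <= g x)%E) ->
  (\int[mu]_(x in D) f x <= \int[mu]_(x in D) g x)%E.
Proof.
move=> f0 fg.
have g0 x : D x -> (0 <= g x)%E by move=> Dx; exact: le_trans (f0 x Dx) (fg x Dx).
rewrite !ge0_integralE //; apply: ereal_sup_le => _ [h hf <-].
exists h => // x.
apply: (le_trans (hf x)); rewrite !patchE; case: ifPn => // xD.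
by apply: fg; rewrite inE in xD.
Qed.

Lemma le_integral_nm D (f g : T -> \bar R) :
  (forall x, D x -> (f x <= g x)%E) ->
  (\int[mu]_(x in D) f x <= \int[mu]_(x in D) g x)%E.
Proof.
move=> fg; rewrite [leLHS]integralE [leRHS]integralE.
apply: leeB; apply: ge0_le_integral_nm => // x Dx.
- by rewrite !funeposE; apply: le_max2; rewrite ?fg.
- by rewrite !funenegE; apply: le_max2; rewrite ?leeN2 ?fg.
Qed.

(** The integral of a nonnegative function is a supremum over simple functions; these are
    measurable, so the null set can be removed from each of them. *)
Lemma negligible_integral_nm D N (f : T -> \bar R) :
  measurable N -> mu N = 0%E ->
  (\int[mu]_(x in D) f x = \int[mu]_(x in D `\` N) f x)%E.
Proof.
move=> mN N0.
suff H (g : T -> \bar R) : (forall x, (0 <= g x)%E) ->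
    (\int[mu]_(x in D) g x = \int[mu]_(x in D `\` N) g x)%E.
  by rewrite [LHS]integralE [RHS]integralE !H.
move=> g0; apply/eqP; rewrite eq_le; apply/andP; split; last first.
  rewrite integral_mkcond [leRHS]integral_mkcond; apply: ge0_le_integral_nm.
    by move=> x _; apply: erestrict_ge0 => *; exact: g0.
  move=> x _; rewrite !patchE; case: ifPn => [|_].
    by rewrite inE => -[Dx _]; rewrite mem_set.
  by case: ifPn.
rewrite {1}ge0_integralE //; apply: ge_ereal_sup => _ [h hg <-].
rewrite -integralT_nnsfun (@ge0_negligible_integral _ _ _ _ _ N) //; last first.
  by move=> x _; rewrite lee_fin.
  exact/measurable_EFinP.
rewrite setTD integral_mkcond [leRHS]integral_mkcond; apply: ge0_le_integral_nm.
  by move=> x _; apply: erestrict_ge0 => *; rewrite lee_fin.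
move=> x _; rewrite !patchE; case: ifPn => [xN|_]; last first.
  by case: ifPn.
have := hg x; rewrite patchE; case: ifPn => [xD|xD].
  by rewrite mem_set //; split; [rewrite inE in xD|rewrite inE in xN].
by rewrite memNset // => -[Dx _]; rewrite notin_setE in xD.
Qed.

Lemma ae_eq_integral_nm D N (f g : T -> \bar R) :
  measurable N -> mu N = 0%E -> (forall x, D x -> ~ N x -> f x = g x) ->
  (\int[mu]_(x in D) f x = \int[mu]_(x in D) g x)%E.
Proof.
move=> mN N0 fg.
rewrite (negligible_integral_nm D f mN N0) (negligible_integral_nm D g mN N0).
by apply: eq_integral => x; rewrite inE => -[Dx Nx]; exact: fg.
Qed.

Lemma bounded_integral_fin_num_nm D (f : T -> R) (M : R) :
  measurable D -> (mu D < +oo)%E -> (forall x, D x -> `|f x| <= M) ->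
  (\int[mu]_(x in D) (f x)%:E \is a fin_num)%E.
Proof.
move=> mD Doo fM.
have muD : mu D \is a fin_num by rewrite ge0_fin_numE.
rewrite fin_numElt; apply/andP; split.
  apply: (@lt_le_trans _ _ (\int[mu]_(x in D) (- M)%:E)%E).
    by rewrite integral_cst // -(fineK muD) -EFinM ltNyr.
  apply: le_integral_nm => x Dx; rewrite lee_fin lerNl.
  by rewrite (le_trans _ (fM x Dx)) // -normrN ler_norm.
apply: (@le_lt_trans _ _ (\int[mu]_(x in D) M%:E)%E).
  by apply: le_integral_nm => x Dx; rewrite lee_fin (le_trans _ (fM x Dx)) // ler_norm.
by rewrite integral_cst // -(fineK muD) -EFinM ltry.
Qed.

(** The common bound keeps both integrals finite: [fine] sends infinite values to 0 and is monotone
    only on finite ones. *)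
Lemma le_Rintegral_nm D (f g : T -> R) (M : R) :
  measurable D -> (mu D < +oo)%E ->
  (forall x, D x -> `|f x| <= M) -> (forall x, D x -> `|g x| <= M) ->
  (forall x, D x -> f x <= g x) ->
  Rintegral mu D f <= Rintegral mu D g.
Proof.
move=> mD Doo fM gM fg; apply: fine_le.
- exact: bounded_integral_fin_num_nm fM.
- exact: bounded_integral_fin_num_nm gM.
- by apply: le_integral_nm => x Dx; rewrite lee_fin fg.
Qed.

Lemma Rintegral_between_nm D (f : T -> R) (a b : R) :
  measurable D -> (mu D < +oo)%E ->
  (forall x, D x -> a <= f x <= b) ->
  a * fine (mu D) <= Rintegral mu D f <= b * fine (mu D).
Proof.
move=> mD Doo fab.
have M x : D x -> `|f x| <= `|a| + `|b|.
  move=> /fab /andP[af fb]; rewrite ler_norml; apply/andP; split.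
    apply: le_trans af; rewrite lerNl -normrN (le_trans (ler_norm _)) //.
    by rewrite lerDl.
  by apply: (le_trans fb); rewrite (le_trans (ler_norm b)) // lerDr.
rewrite -!Rintegral_cst //; apply/andP; split;
  apply: (@le_Rintegral_nm _ _ _ (`|a| + `|b|)) => // x Dx;
  rewrite /= ?lerDl ?lerDr // ?M //; by case/andP: (fab x Dx).
Qed.

Lemma bounded_integrable D (f : T -> R) (M : R) :
  measurable D -> (mu D < +oo)%E -> measurable_fun D f ->
  (forall x, D x -> `|f x| <= M) -> mu.-integrable D (EFin \o f).
Proof.
move=> mD Doo mf fM; apply: measurable_bounded_integrable => //.
exists M; split; first exact: num_real.
by move=> y My x Dx; apply: (le_trans (fM x Dx)); exact: ltW.
Qed.

End NonmeasurableIntegrands.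

(** * Fundamental theorem of calculus for Lipschitz functions *)

Section LipschitzPrimitive.
Context {R : realType}.
Local Notation mu := (@lebesgue_measure R).

(** The retraction onto [0, 1]. Composition with it extends a function from [0, 1] to the line with
    the same Lipschitz constant, as a distribution function must be defined everywhere. *)
Let clamp (x : R) : R := Num.max 0 (Num.min 1 x).

Let clamp01 x : 0 <= clamp x <= 1.
Proof. by rewrite /clamp le_max lexx /= ge_max ler01 ge_min lexx. Qed.

Let clamp_id x : 0 <= x <= 1 -> clamp x = x.
Proof. by move=> /andP[x0 x1]; rewrite /clamp min_r // max_r. Qed.

Let clamp_nd x y : x <= y -> clamp x <= clamp y.
Proof. by move=> xy; rewrite /clamp le_max2 // le_min2. Qed.

Let clamp_dist x y : x <= y -> clamp y - clamp x <= y - x.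
Proof.
move=> xy; rewrite /clamp /Num.max /Num.min.
by do ! case: ifPn; rewrite -?leNgt => *; lra.
Qed.

Let cumulative_of_lipschitz (H : R -> R) (L : R) (ndH : {homo H : x y / x <= y})
  (lipH : forall x y, x <= y -> H y - H x <= L * (y - x)) :
  exists c : cumulative R R, c = H :> (R -> R).
Proof.
have cH : continuous H.
  move=> x; apply/cvgrPdist_le => e e0.
  have L0 : 0 <= L.
    have := lipH 0 1 ler01; rewrite subr0 mulr1; apply: le_trans.
    by rewrite subr_ge0 ndH.
  have L1 : 0 < L + 1 by rewrite ltr_wpDl.
  near=> y.
  have H1 : `|H x - H y| <= L * `|x - y|.
    have [xy|/ltW yx] := lerP x y.
      rewrite distrC ger0_norm ?subr_ge0 ?ndH //; exact: lipH.
    rewrite ger0_norm ?subr_ge0 ?ndH //; exact: lipH.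
  apply: (le_trans H1); apply: (@le_trans _ _ ((L + 1) * `|x - y|)).
    by rewrite ler_wpM2r // lerDl.
  rewrite -ler_pdivlMl //; near: y.
  by apply: cvgr_dist_le; [exact: cvg_id|rewrite mulr_gt0 // invr_gt0].
have rcH := right_continuousW cH.
by exists (HB.pack_for (cumulative R R) H (isCumulative.Build R _ R H ndH rcH)).
Unshelve. all: by end_near. Qed.

Let stieltjes_oc (H : cumulative R R) (a b : R) : a <= b ->
  lebesgue_stieltjes_measure H (`]a, b]%classic : set R) = (H b - H a)%:E.
Proof.
move=> ab; rewrite /lebesgue_stieltjes_measure /measure_extension /=.
rewrite measurable_mu_extE /=; last exact: is_ocitv.
by rewrite wlength_itv_bnd.
Qed.

(* A Lipschitz function plus a linear one is the distribution function of a
   measure below a multiple of Lebesgue measure; its Radon-Nikodym density gives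
   the derivative almost everywhere. *)
Lemma lipschitz_primitive (h : R -> R) (L : R) : 0 <= L ->
  (forall x y, 0 <= x <= 1 -> 0 <= y <= 1 -> `|h x - h y| <= L * `|x - y|) ->
  exists g : R -> R, [/\ measurable_fun setT g,
    (forall x, `|g x| <= L),
    {ae mu, forall x, 0 < x < 1 -> derivable h x 1 /\ derive1 h x = g x} &
    Rintegral mu `[0, 1] g = h 1 - h 0].
Proof.
move=> L0 hL.
pose H x := h (clamp x) + L * clamp x.
have hcl x y : x <= y -> `|h (clamp y) - h (clamp x)| <= L * (clamp y - clamp x).
  move=> xy; apply: (le_trans (hL _ _ _ _)) => //.
  by rewrite ger0_norm // subr_ge0 clamp_nd.
have hcl1 x y : x <= y -> L * (clamp y - clamp x) <= L * (y - x).
  by move=> xy; rewrite ler_wpM2l // clamp_dist.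
have ndH : {homo H : x y / x <= y}.
  move=> x y xy; rewrite /H.
  have := hcl _ _ xy; rewrite ler_norml => /andP[]; lra.
have lipH x y : x <= y -> H y - H x <= (L *+ 2) * (y - x).
  move=> xy; rewrite /H; have := hcl1 _ _ xy.
  have := hcl _ _ xy; rewrite ler_norml => /andP[]; lra.
(* The complement of [H] to the slope 2L is nondecreasing too, so the measures of [H] and [K] add up
   to 2L times Lebesgue measure, which therefore dominates that of [H]. *)
pose K x := (L *+ 2) * x - H x.
have ndK : {homo K : x y / x <= y}.
  by move=> x y xy; rewrite /K; have := lipH _ _ xy; lra.
have lipK x y : x <= y -> K y - K x <= (L *+ 2) * (y - x).
  by move=> xy; rewrite /K; have := ndH _ _ xy; lra.
pose J x := (L *+ 2) * x.
have L20 : 0 <= L *+ 2 by rewrite mulrn_wge0.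
have ndJ : {homo J : x y / x <= y} by move=> x y xy; rewrite /J ler_wpM2l.
have lipJ x y : x <= y -> J y - J x <= (L *+ 2) * (y - x).
  by move=> xy; rewrite /J mulrBr.
have [cH cHE] := cumulative_of_lipschitz ndH lipH.
have [cK cKE] := cumulative_of_lipschitz ndK lipK.
have [cJ cJE] := cumulative_of_lipschitz ndJ lipJ.
pose nu : {measure set (measurableTypeR R) -> \bar R} := lebesgue_stieltjes_measure cH.
have nu_le (A : set R) : measurable A -> (nu A <= (L *+ 2)%:E * mu A)%E.
  move=> mA.
  have E1 : lebesgue_stieltjes_measure cJ A =
     measure_add (lebesgue_stieltjes_measure cH) (lebesgue_stieltjes_measure cK) A.
    apply: lebesgue_stieltjes_measure_unique => // X /ocitvP[->|[x x12 ->]].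
      by rewrite !measure0.
    apply/esym; apply: (eq_trans (measure_addE _ _ _)).
    have x12' := ltW x12.
    apply: (eq_trans (congr2 adde (stieltjes_oc cH x12') (stieltjes_oc cK x12'))).
    apply: (eq_trans _ (esym (stieltjes_oc cJ x12'))).
    rewrite -[LHS]/((_ + _)%:E) cHE cKE cJE.
    by congr (_%:E); rewrite /J /K; ring.
  have E2 : lebesgue_stieltjes_measure cJ A = mscale (NngNum L20) mu A.
    apply: lebesgue_stieltjes_measure_unique => // X /ocitvP[->|[x x12 ->]].
      by rewrite !measure0.
    apply: (eq_trans (stieltjes_oc cJ (ltW x12))).
    have mE : mu (`]x.1, x.2]%classic : set R) = (x.2 - x.1)%:E.
      by rewrite lebesgue_measure_itv /= lte_fin x12.
    apply: (eq_trans _ (congr1 (fun z => (L *+ 2)%:E * z)%E (esym mE))).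
    by rewrite -EFinM cJE; congr (_%:E); rewrite /J; ring.
  rewrite -[leRHS]/(mscale (NngNum L20) mu A) -E2 E1 measure_addE leeDl //.
(* Restriction to the unit interval gives a finite measure, of mass H 1 - H 0. *)
pose D01 : set (measurableTypeR R) := `](0 : R), 1]%classic.
have mD : measurable D01 by exact: measurable_itv.
have Doo : (nu D01 < +oo)%E.
  by have -> : nu D01 = _ := stieltjes_oc cH ler01; rewrite ltry.
pose nu1 : {finite_measure set (measurableTypeR R) -> \bar R} :=
  @mfrestr _ (measurableTypeR R) R D01 nu mD Doo.
have nu1mu : nu1 `<< mu.
  apply/null_content_dominatesP => A mA A0; apply/eqP; rewrite -measure_le0.
  apply: (@le_trans _ _ (nu A)).
    by apply: le_measure => //; rewrite inE //; exact: measurableI.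
  by apply: (le_trans (nu_le A mA)); rewrite A0 mule0.
have [f [f0 ffin fint fE]] := radon_nikodym_sigma_finite nu1mu.
pose ff x := fine (f x).
have ffE : EFin \o ff = f by apply/funext => x; rewrite /= fineK.
have fintff : mu.-integrable setT (EFin \o ff) by rewrite ffE.
have mff : measurable_fun setT ff by apply/measurable_EFinP; exact: measurable_int fintff.
have fintS (D : set R) : measurable D -> mu.-integrable D (EFin \o ff).
  by move=> mD'; apply: integrableS fintff.
have lff : locally_integrable setT ff.
  by apply: open_integrable_locally => //; exact: openT.
have mu01 : mu (`[(0 : R), 1]%classic) = 1%E.
  by rewrite lebesgue_measure_itv /= lte_fin ltr01 -EFinD subr0.
(* On [0, 1] this primitive equals H - H 0, that is [h] plus a linear function and a constant; its
   derivative, which exists almost everywhere, gives that of [h]. *)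
pose F x := Rintegral mu [set` Interval (BRight 0) (BRight x)] ff.
have FE x : 0 <= x <= 1 -> F x = H x - H 0.
  move=> /andP[x0 x1]; rewrite /F /Rintegral.
  transitivity (fine (nu1 (`](0 : R), x]%classic : set R))).
    by rewrite fE // -ffE.
  have DE : `](0 : R), x]%classic `&` D01 = `](0 : R), x]%classic.
    apply/seteqP; split => [y []//|y yx]; split => //; move: yx.
    rewrite /D01 /= !in_itv /= => /andP[-> yx]; exact: le_trans yx x1.
  rewrite -[nu1 _]/(nu (`](0 : R), x]%classic `&` D01)) DE.
  by apply: (eq_trans (congr1 fine (stieltjes_oc cH x0))); rewrite cHE.
have [N [mN N0 NP]] := FTC1 (a := BRight 0) (fun y => fintS _ (measurable_itv _)) lff.
have derF x : 0 < x < 1 -> ~ N x -> derivable F x 1 /\ derive1 F x = ff x.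
  move=> /andP[x0 x1] Nx.
  by apply: contrapT => C; apply/Nx/NP => /(_ x0).
have F1 : Rintegral mu `]0, 1] ff = H 1 - H 0 by apply: FE; rewrite ler01 lexx.
clearbody F.
have der x : 0 < x < 1 -> ~ N x -> is_derive x 1 h (ff x - L) /\ `|ff x - L| <= L.
  move=> /[dup] x01 /andP[x0 x1] Nx; have [dF FEx] := derF x x01 Nx.
  have dh : is_derive x 1 h (ff x - L).
    have : is_derive x 1 (fun y => (F y + H 0) - L * y) (ff x - L).
      have dF' : is_derive x 1 F (ff x) by split; [exact: dF|rewrite -derive1E].
      have dL := is_deriveZ L (is_derive_id x 1).
      have := is_deriveB (is_deriveD dF' (is_derive_cst (H 0) x 1)) dL.
      by rewrite addr0 [L *: _]mulr1.
    apply: near_eq_is_derive.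
    have : x \in `]0, 1[ by rewrite in_itv.
    move/near_in_itvoo; apply: filterS => y; rewrite in_itv /= => /andP[y0 y1].
    have y01 : 0 <= y <= 1 by rewrite !ltW.
    by rewrite FE // /H clamp_id //; lra.
  split => //.
  have [dh1 <-] := dh.
  (* The difference quotients of [h] are bounded by L as soon as x + k stays in [0, 1]; the bound
     passes to the limit. *)
  have Q : \forall k \near 0^', `|k^-1 *: ((h \o shift x) (k *: 1) - h x)| <= L.
    near=> k.
    have k0 : k != 0 by near: k; exact: nbhs_dnbhs_neq.
    rewrite normrZ normfV mulrC ler_pdivrMr ?normr_gt0 //= [k *: 1]mulr1.
    have kx : `|k| < x by near: k; exact: dnbhs0_lt.
    have k1x : `|k| < 1 - x by near: k; apply: dnbhs0_lt; rewrite subr_gt0.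
    move: kx k1x; rewrite !ltr_norml => /andP[? ?] /andP[? ?].
    apply: (le_trans (hL _ _ _ _)); rewrite ?addrK ?(ltW x0) ?(ltW x1) //.
    by apply/andP; split; lra.
  rewrite ler_norml; apply/andP; split.
    apply: limr_ge => //; apply: filterS Q => k; by rewrite ler_norml => /andP[].
  apply: limr_le => //; apply: filterS Q => k; by rewrite ler_norml => /andP[].
(* The density lies between -L and L almost everywhere only; truncation makes the bound hold at
   every point without changing the integral. *)
pose g x := Num.max (- L) (Num.min L (ff x - L)).
have gE x : 0 < x < 1 -> ~ N x -> g x = ff x - L.
  move=> x01 Nx; have [_] := der x x01 Nx; rewrite ler_norml => /andP[? ?].
  by rewrite /g min_r // max_r.
exists g; split.
- apply: measurable_maxr; first exact: measurable_cst.
  apply: measurable_minr; first exact: measurable_cst.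
  by apply: measurable_funB => //; exact: measurable_cst.
- move=> x; rewrite ler_norml /g le_max lexx /= ge_max ge_min lexx /= andbT.
  by rewrite -subr_ge0 opprK addr_ge0.
- exists N; split => // x /= xP; apply: contrapT => Nx; apply: xP => x01.
  have [[d1 d2] _] := der x x01 Nx; split => //.
  by rewrite derive1E d2 gE.
(* The end points join the null set, because the derivative is identified in the open interval. *)
- have -> : Rintegral mu `[0, 1] g = Rintegral mu `[0, 1] (fun x => ff x - L).
    congr fine; apply: (@ae_eq_integral_nm _ _ _ _ _ (N `|` ([set 0] `|` [set 1]))).
    + by apply: measurableU => //; exact: measurableU.
    + apply/eqP; rewrite -measure_le0 (le_trans (measureU2 _ _ _)) //.
        exact: measurableU.
      rewrite [X in (X + _)%E]N0 add0e (le_trans (measureU2 _ _ _)) //.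
      rewrite -[leRHS]adde0; apply: leeD; rewrite le_eqVlt; apply/orP; left; apply/eqP;
        exact: lebesgue_measure_set1.
    + move=> x /=; rewrite in_itv /= => /andP[x0 x1] /not_orP[Nx /not_orP[xn0 xn1]].
      rewrite gE // !lt_neqAle x0 x1 !andbT eq_sym; apply/andP; split; exact/eqP.
  rewrite RintegralB //; last 2 first.
  + exact: fintS.
  + apply: (@bounded_integrable _ _ _ _ _ _ `|L|) => //.
    by apply: (eq_ind_r (fun z => z < +oo)%E _ mu01); rewrite ltry.
  have -> : Rintegral mu `[0, 1] (fun=> L) = L.
    rewrite Rintegral_cst //; apply: (eq_trans (congr1 (fun z => L * fine z) mu01)).
    by rewrite /= mulr1.
  rewrite -Rintegral_itv_obnd_cbnd; last exact: fintS.
  rewrite F1 /H !clamp_id ?ler01 ?lexx //; lra.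
Unshelve. all: by end_near. Qed.
End LipschitzPrimitive.

(** * Calculus of the MHD entropy *)

Section DotProduct.
Context {R : realType} {n : nat}.
Implicit Types u v w : 'rV[R]_n.

Lemma dotvC u v : dotv u v = dotv v u.
Proof. by apply: eq_bigr => j _; rewrite mulrC. Qed.

Lemma dotvDl u v w : dotv (u + v) w = dotv u w + dotv v w.
Proof. by rewrite /dotv -big_split; apply: eq_bigr => j _; rewrite mxE mulrDl. Qed.

Lemma dotvZl (a : R) u w : dotv (a *: u) w = a * dotv u w.
Proof. by rewrite /dotv mulr_sumr; apply: eq_bigr => j _; rewrite mxE mulrA. Qed.

Lemma dotvNl u w : dotv (- u) w = - dotv u w.
Proof. by rewrite -scaleN1r dotvZl mulN1r. Qed.

Lemma dotvDr u v w : dotv w (u + v) = dotv w u + dotv w v.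
Proof. by rewrite dotvC dotvDl !(dotvC w). Qed.

Lemma dotvZr (a : R) u w : dotv w (a *: u) = a * dotv w u.
Proof. by rewrite dotvC dotvZl (dotvC w). Qed.

Lemma dotvNr u w : dotv w (- u) = - dotv w u.
Proof. by rewrite dotvC dotvNl (dotvC w). Qed.

Lemma dotvv_ge0 u : 0 <= dotv u u.
Proof. by apply: sumr_ge0 => j _; rewrite -expr2 sqr_ge0. Qed.

Lemma dotvv_eq0 u : dotv u u = 0 -> u = 0.
Proof.
move=> /eqP; rewrite psumr_eq0 => [/allP u0|j _]; last by rewrite -expr2 sqr_ge0.
apply/rowP => j; rewrite mxE; have := u0 j (mem_index_enum _).
by rewrite mulf_eq0 orbb => /eqP.
Qed.

Lemma enorm_sqr u : enorm u ^+ 2 = dotv u u.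
Proof. by rewrite sqr_sqrtr // dotvv_ge0. Qed.

Definition dotvE := (dotvDl, dotvZl, dotvNl, dotvDr, dotvZr, dotvNr).

End DotProduct.

Section MHDCalculus.
Context {R : realType} {d : nat}.
Local Notation V := (state R d).
Implicit Types (w v y : V) (G : set V).

Definition dense : set V := [set w | 0 < rho w].

Lemma isC1_rho {G} : isC1 G (@rho R d) (fun _ v => rho v).
Proof.
by apply: isC1_ext (@isC1_coord _ _ G (lshift _ 0)) => *; rewrite /rho !mxE.
Qed.

Lemma dense_open : open dense.
Proof.
rewrite openE => w r0.
have c1 : {for w, continuous (@rho R d)} by apply: isC1_continuous (isC1_rho (G := setT)) _.
exact: (cvgr_gt _ c1).
Qed.

Lemma isC1_energy {G} : isC1 G (@energy R d) (fun _ v => energy v).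
Proof.
by apply: isC1_ext (@isC1_coord _ _ G (rshift _ (rshift _ (lshift _ 0)))) => *;
  rewrite /energy !mxE.
Qed.

Lemma isC1v_mom {G} : isC1v G (@mom R d) (fun _ v => mom v).
Proof.
move=> i.
by apply: isC1_ext (@isC1_coord _ _ G (rshift _ (lshift _ i))) => *; rewrite /mom !mxE.
Qed.

Lemma isC1v_mag {G} : isC1v G (@mag R d) (fun _ v => mag v).
Proof.
move=> i.
by apply: isC1_ext (@isC1_coord _ _ G (rshift _ (rshift _ (rshift _ i)))) => *; rewrite /mag !mxE.
Qed.

Definition dvel w v : 'rV[R]_d.+1 := (rho w)^-1 *: (mom v - rho v *: vel w).

Lemma isC1v_vel : isC1v dense (@vel R d) dvel.
Proof.
move=> i.
have rV : isC1 dense (fun w => (rho w)^-1) (fun w v => - (rho w) ^- 2 * rho v).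
  by apply: isC1V; [exact: isC1_rho|move=> w /gt_eqF ->].
apply: isC1_ext (isC1M rV (isC1v_mom (G := dense) i)) => [w|w v].
  by rewrite /vel !mxE.
rewrite /dvel /vel !mxE -exprVn; ring.
Qed.

Definition dpres w v : R := (gam - 1) *
  (energy v - dotv (vel w) (mom v) + 2^-1 * dotv (vel w) (vel w) * rho v
   - dotv (mag w) (mag v)).

Lemma isC1_pres : isC1 dense (@pres R d) dpres.
Proof.
have uu := isC1v_dotv isC1v_vel isC1v_vel.
have bb := isC1v_dotv (isC1v_mag (G := dense)) (isC1v_mag (G := dense)).
have C := isC1Z (gam - 1) (isC1D (isC1D (isC1_energy (G := dense))
  (isC1N (isC1Z 2^-1 (isC1M (isC1_rho (G := dense)) uu)))) (isC1N (isC1Z 2^-1 bb))).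
apply: (@isC1_eq _ _ _ _ _ _ _ dense_open C) => [w _|w v w0].
  by rewrite /pres !enorm_sqr mulrA.
have r0 : rho w != 0 by rewrite gt_eqF.
by rewrite /dpres /dvel !dotvE; field.
Qed.

Lemma admissible_dense : admissible `<=` dense.
Proof. by move=> w []. Qed.

Lemma admissible_open : open (@admissible R d).
Proof.
rewrite openE => w [r0 p0].
have c1 : {for w, continuous (@rho R d)} by apply: isC1_continuous (isC1_rho (G := dense)) _.
have c2 : {for w, continuous (@pres R d)} by apply: isC1_continuous isC1_pres _.
near=> x; split; near: x.
- exact: (cvgr_gt _ c1).
- exact: (cvgr_gt _ c2).
Unshelve. all: by end_near. Qed.

(** The specific entropy with the logarithm of the product split, which agrees with [spec_entropy]
    where density and pressure are positive. *)
Definition lnrho_spec w : R := ln (pres w) - gam * ln (rho w).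

Lemma entropyE w : admissible w -> entropy w = - (rho w * lnrho_spec w) / (gam - 1).
Proof.
move=> [r0 p0]; rewrite /entropy /spec_entropy /lnrho_spec.
rewrite lnM ?posrE //; last exact: powR_gt0.
by rewrite ln_powR; ring.
Qed.

Definition dspec w v : R := (pres w)^-1 * dpres w v - gam * ((rho w)^-1 * rho v).

Definition dentropy w v : R :=
  - (rho v * lnrho_spec w + rho w * dspec w v) / (gam - 1).

Lemma isC1_spec : isC1 admissible lnrho_spec dspec.
Proof.
have pC := isC1_subset admissible_dense isC1_pres.
have C1 := isC1_ln pC (fun w => @proj2 _ _).
have C2 := isC1_ln (isC1_rho (G := admissible)) (fun w => @proj1 _ _).
by apply: isC1_ext (isC1D C1 (isC1N (isC1Z gam C2))).
Qed.

Lemma isC1_entropy : isC1 admissible (@entropy R d) dentropy.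
Proof.
have C := isC1Z (- (gam - 1)^-1) (isC1M (isC1_rho (G := admissible)) isC1_spec).
apply: (@isC1_eq _ _ _ _ _ _ _ admissible_open C) => [w Gw|w v _].
  by rewrite entropyE //; ring.
by rewrite /dentropy; ring.
Qed.

Definition ddpres w v y : R := (gam - 1) *
  (- dotv (dvel w y) (mom v) + dotv (vel w) (dvel w y) * rho v
   - dotv (mag y) (mag v)).

Lemma isC1_dpres v : isC1 dense (dpres^~ v) (fun w => ddpres w v).
Proof.
have uu := isC1v_dotv isC1v_vel isC1v_vel.
have cstm : isC1v dense (fun=> mom v) (fun _ _ => 0).
  by move=> i; apply: isC1_ext (@isC1_cst _ _ dense (mom v 0 i)) => // w x; rewrite mxE.
have cstb : isC1v dense (fun=> mag v) (fun _ _ => 0).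
  by move=> i; apply: isC1_ext (@isC1_cst _ _ dense (mag v 0 i)) => // w x; rewrite mxE.
have C := isC1Z (gam - 1) (isC1D (isC1D (isC1D (@isC1_cst _ _ dense (energy v))
   (isC1N (isC1v_dotv isC1v_vel cstm))) (isC1Z (2^-1 * rho v) uu))
   (isC1N (isC1v_dotv (isC1v_mag (G := dense)) cstb))).
have d0 m (u : 'rV[R]_m) : dotv u 0 = 0 by rewrite -(scale0r 0) dotvZr mul0r.
apply: isC1_ext C => [w|w y].
  by rewrite /dpres; ring.
by rewrite /ddpres !d0 (dotvC (mom v)) (dotvC (mag v)); field.
Qed.

Definition ddspec w v y : R :=
  (pres w)^-1 * ddpres w v y - (pres w) ^- 2 * dpres w y * dpres w v
  + gam * (rho w) ^- 2 * rho y * rho v.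

Definition ddentropy w v y : R :=
  - (rho v * dspec w y + rho y * dspec w v + rho w * ddspec w v y) / (gam - 1).

Lemma isC1_dentropy v : isC1 admissible (dentropy^~ v) (fun w => ddentropy w v).
Proof.
have pC := isC1_subset admissible_dense isC1_pres.
have dpC := isC1_subset admissible_dense (isC1_dpres v).
have rC := isC1_rho (G := admissible).
have pV : isC1 admissible (fun w => (pres w)^-1) (fun w y => - (pres w) ^- 2 * dpres w y).
  by apply: isC1V => // w [_ /gt_eqF ->].
have rV : isC1 admissible (fun w => (rho w)^-1) (fun w y => - (rho w) ^- 2 * rho y).
  by apply: isC1V => // w [/gt_eqF -> _].
have sC := isC1D (isC1M pV dpC) (isC1N (isC1Z gam (isC1M rV (@isC1_cst _ _ admissible (rho v))))).
have C := isC1Z (- (gam - 1)^-1) (isC1D (isC1Z (rho v) isC1_spec) (isC1M rC sC)).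
apply: isC1_ext C => [w|w y].
  by rewrite /dentropy /dspec; ring.
by rewrite /ddentropy /ddspec /dspec; ring.
Qed.

Lemma gam1 : gam - 1 = 2 / 3 :> R.
Proof. by rewrite /gam; field. Qed.

(** With the variation of m written as rho du + u drho, the cross terms cancel and the second
    variation of the pressure is -(gam - 1) (rho |du|^2 + |dB|^2). In the variables dp/p, drho/rho,
    du, dB the Hessian form is then a sum of squares. *)
Lemma ddentropy_quadratic w v : admissible w ->
  ddentropy w v v =
  (rho w * ((pres w)^-1 * dpres w v - (rho w)^-1 * rho v) ^+ 2) / (gam - 1)
  + (rho w)^-1 * rho v ^+ 2
  + (pres w)^-1 * (rho w ^+ 2 * dotv (dvel w v) (dvel w v)
     + rho w * dotv (mag v) (mag v)).
Proof.
move=> [r0 p0].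
have r1 : rho w != 0 by rewrite gt_eqF.
have p1 : pres w != 0 by rewrite gt_eqF.
have E : ddpres w v v = (gam - 1) * - (rho w * dotv (dvel w v) (dvel w v) + dotv (mag v) (mag v)).
  have mE : mom v = rho w *: dvel w v + rho v *: vel w.
    by rewrite /dvel scalerA divff // scale1r subrK.
  rewrite /ddpres; move: mE; move: (dvel w v) (vel w) => x u ->.
  by rewrite !dotvE (dotvC x u); ring.
have g1 : gam = 5 / 3 :> R by [].
rewrite /ddentropy /ddspec /dspec E gam1 g1; field.
by rewrite r1 p1.
Qed.

(** If all squares vanish, so do drho, then dp, du and dB, and hence the variations of the conserved
    momentum and energy. *)
Lemma ddentropy_gt0 w v : admissible w -> v != 0 -> 0 < ddentropy w v v.
Proof.
move=> Gw v0; have [r0 p0] := Gw.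
rewrite ddentropy_quadratic //.
set A := _ / (gam - 1); set B := _^-1 * _ ^+ 2; set C := _^-1 * (_ + _).
have A0 : 0 <= A by rewrite /A gam1 divr_ge0 // mulr_ge0 ?sqr_ge0 // ltW.
have B0 : 0 <= B by rewrite /B mulr_ge0 ?sqr_ge0 ?invr_ge0 ?(ltW r0).
have C0 : 0 <= C.
  rewrite /C mulr_ge0 ?invr_ge0 ?(ltW p0) // addr_ge0 // mulr_ge0 ?dotvv_ge0 ?sqr_ge0 //.
  exact: ltW.
rewrite lt_neqAle !addr_ge0 // andbT eq_sym; apply: contra v0.
rewrite !paddr_eq0 ?addr_ge0 // => /andP[/andP[hA hB] hC].
have rv : rho v = 0.
  by move: hB; rewrite /B mulf_eq0 invr_eq0 gt_eqF //= sqrf_eq0 => /eqP.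
have pv : dpres w v = 0.
  apply/eqP; move: hA; rewrite /A rv mulr0 subr0 gam1; apply: contraLR => pv0.
  apply: mulf_neq0; last by rewrite invr_neq0 // mulf_neq0 ?invr_neq0 ?pnatr_eq0.
  apply: mulf_neq0; first by rewrite gt_eqF.
  rewrite expf_neq0 //; apply: mulf_neq0 => //.
  by rewrite invr_neq0 // gt_eqF.
move: hC; rewrite /C mulf_eq0 invr_eq0 (gt_eqF p0) /= paddr_eq0; last 2 first.
- by rewrite mulr_ge0 ?sqr_ge0 ?dotvv_ge0.
- by rewrite mulr_ge0 ?dotvv_ge0 // ltW.
rewrite !mulf_eq0 (gt_eqF r0) /= => /andP[/eqP/dotvv_eq0 uv /eqP/dotvv_eq0 bv].
have mv : mom v = 0.
  move: uv; rewrite /dvel rv scale0r subr0 => /eqP.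
  by rewrite scaler_eq0 invr_eq0 (gt_eqF r0) /= => /eqP.
have d0 m (u : 'rV[R]_m) : dotv u 0 = 0 by rewrite -(scale0r 0) dotvZr mul0r.
have ev : energy v = 0.
  move: pv; rewrite /dpres mv bv rv !d0 mulr0 !subr0 addr0 => /eqP.
  by rewrite gam1 mulf_eq0 mulf_eq0 invr_eq0 !pnatr_eq0 /= => /eqP.
apply/eqP; rewrite -(hsubmxK v) -(hsubmxK (rsubmx v)) -(hsubmxK (rsubmx (rsubmx v))).
move: mv bv; rewrite /mom /mag => -> ->.
have -> : lsubmx v = 0 by apply/rowP => j; rewrite (ord1 j) [RHS]mxE; exact: rv.
have -> : lsubmx (rsubmx (rsubmx v)) = 0.
  by apply/rowP => j; rewrite (ord1 j) [RHS]mxE; exact: ev.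
by rewrite !row_mx0.
Qed.

End MHDCalculus.

(** * Convexity of the admissible set and coercivity of the entropy Hessian *)

Section Geometry.
Context {R : realType} {d : nat}.
Local Notation V := (state R d).
Implicit Types (a b e w v : V) (K : set V).

Lemma rho_affine a e (t : R) : rho (a + t *: e) = rho a + t * rho e.
Proof. by rewrite /rho linearD linearZ !mxE. Qed.

Lemma mom_affine a e (t : R) : mom (a + t *: e) = mom a + t *: mom e.
Proof. by rewrite /mom !linearD !linearZ. Qed.

Lemma energy_affine a e (t : R) : energy (a + t *: e) = energy a + t * energy e.
Proof. by rewrite /energy !linearD !linearZ !mxE. Qed.

Lemma mag_affine a e (t : R) : mag (a + t *: e) = mag a + t *: mag e.
Proof. by rewrite /mag !linearD !linearZ. Qed.

Lemma Bx_affine a e (t : R) : Bx (a + t *: e) = Bx a + t * Bx e.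
Proof. by rewrite /Bx mag_affine !mxE. Qed.

Lemma rhoB a b : rho (a - b) = rho a - rho b.
Proof. by rewrite -scaleN1r rho_affine mulN1r. Qed.
Lemma momB a b : mom (a - b) = mom a - mom b.
Proof. by rewrite -scaleN1r mom_affine scaleN1r. Qed.
Lemma energyB a b : energy (a - b) = energy a - energy b.
Proof. by rewrite -scaleN1r energy_affine mulN1r. Qed.
Lemma magB a b : mag (a - b) = mag a - mag b.
Proof. by rewrite -scaleN1r mag_affine scaleN1r. Qed.
Lemma BxB a b : Bx (a - b) = Bx a - Bx b.
Proof. by rewrite -scaleN1r Bx_affine mulN1r. Qed.

Lemma presE w : pres w = (gam - 1) * (energy w
  - 2^-1 * rho w * dotv (vel w) (vel w) - 2^-1 * dotv (mag w) (mag w)).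
Proof. by rewrite /pres !enorm_sqr. Qed.

Lemma momE w : rho w != 0 -> mom w = rho w *: vel w.
Proof. by move=> r0; rewrite /vel scalerA divff // scale1r. Qed.

(** The last term is the Jensen defect of the convex functions |m|^2 / (2 rho) and |B|^2 / 2, which
    enter the pressure with a minus sign. It is nonnegative, so the pressure is concave and the
    admissible set convex. *)
Lemma pres_segment a b (t : R) : let x := a + t *: (b - a) in
  rho a != 0 -> rho b != 0 -> rho x != 0 ->
  pres x = (1 - t) * pres a + t * pres b + (gam - 1) / 2 * (1 - t) * t *
    (rho a * rho b / rho x * dotv (vel a - vel b) (vel a - vel b)
     + dotv (mag a - mag b) (mag a - mag b)).
Proof.
move=> x ra rb rx.
have rxE : rho x = (1 - t) * rho a + t * rho b by rewrite /x rho_affine rhoB; ring.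
have ux : vel x = (rho x)^-1 *: (((1 - t) * rho a) *: vel a + (t * rho b) *: vel b).
  have mx : mom x = (1 - t) *: mom a + t *: mom b.
    by rewrite /x mom_affine momB; apply/rowP => i; rewrite !mxE; ring.
  by rewrite {1}/vel mx (momE ra) (momE rb) !scalerA.
rewrite !presE ux.
have -> : mag x = (1 - t) *: mag a + t *: mag b.
  by rewrite /x mag_affine magB; apply/rowP => i; rewrite !mxE; ring.
have -> : energy x = (1 - t) * energy a + t * energy b.
  by rewrite /x energy_affine energyB; ring.
move: rx; rewrite rxE => rx.
move: (vel a) (vel b) (mag a) (mag b) => ua ub ba bb.
rewrite !dotvE (dotvC ub ua) (dotvC bb ba); field.
by rewrite rx.
Qed.

Lemma admissible_segment a b (t : R) : admissible a -> admissible b ->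
  0 <= t <= 1 -> admissible (a + t *: (b - a)).
Proof.
move=> [ra pa] [rb pb] /andP[t0 t1].
have t1' : 0 <= 1 - t by rewrite subr_ge0.
have conv (x y : R) : 0 < x -> 0 < y -> 0 < (1 - t) * x + t * y.
  move=> x0 y0; have [t05|t05] := lerP t (1/2).
    by rewrite ltr_pwDl ?mulr_gt0 ?mulr_ge0 ?(ltW y0) //; lra.
  by rewrite ltr_wpDl ?mulr_gt0 ?mulr_ge0 ?(ltW x0) //; lra.
have rx : 0 < rho (a + t *: (b - a)).
  by rewrite rho_affine rhoB; have := conv _ _ ra rb; lra.
split => //; rewrite pres_segment ?gt_eqF //.
rewrite ltr_wpDr ?conv // gam1 !mulr_ge0 // addr_ge0 ?dotvv_ge0 //.
by rewrite mulr_ge0 ?dotvv_ge0 // divr_ge0 ?mulr_ge0 ?ltW.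
Qed.

(** The entropy stable speeds integrate along straight segments between points of K, and K itself
    need not be convex. This larger set is again compact and admissible. *)
Definition segments K : set V :=
  [set z | exists a b (t : R), [/\ K a, K b, 0 <= t <= 1 & z = a + t *: (b - a)]].

Lemma segments_admissible K : K `<=` admissible -> segments K `<=` admissible.
Proof. by move=> KG _ [a [b [t [Ka Kb t01 ->]]]]; apply: admissible_segment => //; exact: KG. Qed.

Lemma compact_segments K : compact K -> compact (segments K).
Proof.
move=> cK.
pose f (z : (V * V) * R) := z.1.1 + z.2 *: (z.1.2 - z.1.1).
have -> : segments K = f @` ((K `*` K) `*` `[0, 1]).
  apply/seteqP; split => z.
    by move=> [a [b [t [Ka Kb t01 ->]]]]; exists ((a, b), t) => //=; rewrite in_itv.
  move=> [[[a b] t] [[/= Ka Kb]]]; rewrite /= in_itv /= => t01 <-.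
  by exists a, b, t.
apply: continuous_compact; last first.
  by apply: compact_setX; [exact: compact_setX|exact: segment_compact].
apply: continuous_subspaceT => z.
have c11 : {for z, continuous (fun z : V * V * R => z.1.1)}.
  by apply: continuous_comp; [exact: cvg_fst|exact: cvg_fst].
have c12 : {for z, continuous (fun z : V * V * R => z.1.2)}.
  by apply: continuous_comp; [exact: cvg_fst|exact: cvg_snd].
apply: (@continuousD _ V _ (fun z : V * V * R => z.1.1) (fun z => z.2 *: (z.1.2 - z.1.1)) z c11).
apply: (@cvgZ _ V _ _ _ (fun z : V * V * R => z.2) (fun z => z.1.2 - z.1.1)).
  exact: cvg_snd.
exact: (@continuousB _ V _ (fun z : V * V * R => z.1.2) (fun z => z.1.1) z c12 c11).
Qed.

Lemma compact_sphere n : compact [set v : 'rV[R]_n | `|v| = 1].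
Proof.
apply: bounded_closed_compact.
  exists 1; split => // M M1 v /= ->; exact: ltW.
apply: (@closed_comp _ _ (fun v : 'rV[R]_n => `|v|) [set 1]).
  by move=> v _; exact: norm_continuous.
exact: closed_eq.
Qed.

Lemma continuous_at_bigsum (T : topologicalType) (I : Type) (r : seq I)
    (f : I -> T -> R) (x : T) : (forall i, {for x, continuous (f i)}) ->
  {for x, continuous (fun y => \sum_(i <- r) f i y)}.
Proof.
move=> cf; elim: r => [|i r IH].
  have -> : (fun y => \sum_(i <- [::]) f i y) = cst 0 by apply/funext => y; rewrite big_nil.
  exact: cst_continuous.
have -> : (fun y => \sum_(j <- i :: r) f j y) = (fun y => f i y + \sum_(j <- r) f j y).
  by apply/funext => y; rewrite big_cons.
exact: (@continuousD _ R^o _ (f i) (fun y => \sum_(j <- r) f j y) x (cf i) IH).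
Qed.

Lemma hessian_entropy w v y : admissible w ->
  dotv (v *m hessian entropy w) y = ddentropy w v y.
Proof.
move=> Gw; apply: isC1_hessian Gw; first exact: admissible_open.
  exact: isC1_entropy.
exact: isC1_dentropy.
Qed.

(** From the expansion in the canonical basis one reads off the homogeneity in the directions and
    the joint continuity in base point and directions. *)
Lemma ddentropy_bigsum w v y : admissible w -> ddentropy w v y =
  \sum_i \sum_j v 0 i * y 0 j * ddentropy w (delta_mx 0 i) (delta_mx 0 j).
Proof.
move=> Gw; have HE i j : hessian entropy w i j = ddentropy w (delta_mx 0 i) (delta_mx 0 j).
  rewrite -hessian_entropy // /dotv (bigD1 j) //= big1 ?addr0 => [|l lj].
    by rewrite -rowE [row _ _ _ _]mxE [delta_mx _ _ _ _]mxE !eqxx mulr1.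
  by rewrite [delta_mx _ _ _ l]mxE (negPf lj) andbF mulr0.
rewrite -hessian_entropy // /dotv exchange_big /=; apply: eq_bigr => j _.
by rewrite mxE mulr_suml; apply: eq_bigr => i _; rewrite HE; ring.
Qed.

(** The constant is the minimum of the form over the product of K and the unit sphere, positive by
    [ddentropy_gt0]; homogeneity extends the bound to all directions. *)
Lemma ddentropy_coercive K : compact K -> K `<=` admissible ->
  exists2 c : R, 0 < c & forall w v, K w -> c * `|v| ^+ 2 <= ddentropy w v v.
Proof.
move=> cK KG.
pose A := K `*` [set v : V | `|v| = 1].
pose f (z : V * V) := ddentropy z.1 z.2 z.2.
have Z w v (s : R) : admissible w -> ddentropy w (s *: v) (s *: v) = s ^+ 2 * ddentropy w v v.
  move=> Gw; rewrite !(ddentropy_bigsum _ _ Gw) mulr_sumr; apply: eq_bigr => i _.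
  by rewrite mulr_sumr; apply: eq_bigr => j _; rewrite !mxE; ring.
have scal w v : K w -> v != 0 -> A (w, `|v|^-1 *: v).
  move=> Kw v0; split => //=; rewrite normrZ normfV normr_id mulVf //.
  by rewrite normr_eq0.
have [A0|A0] := pselect (A !=set0); last first.
  exists 1 => // w v Kw; have [->|v0] := eqVneq v 0.
    have := Z w 0 0 (KG w Kw); rewrite scale0r expr0n mul0r => ->.
    by rewrite normr0 expr0n mulr0.
  by case: A0; exists (w, `|v|^-1 *: v); exact: scal.
have cA : compact A by apply: compact_setX => //; exact: compact_sphere.
have cf : {within A, continuous f}.
  apply: continuous_in_subspaceT => -[w v]; rewrite inE => -[/= Kw _].
  have Gw := KG _ Kw.
  have nG : \forall z \near (w, v), admissible z.1.
    apply: (@cvg_fst _ _ (nbhs w) (nbhs v)); apply: open_nbhs_nbhs; split => //.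
    exact: admissible_open.
  (* [isC1_dentropy] gives continuity in the base point for fixed directions; the finite expansion
     turns it into joint continuity. *)
  pose g (z : V * V) := \sum_i \sum_j z.2 0 i * z.2 0 j *
    ddentropy z.1 (delta_mx 0 i) (delta_mx 0 j).
  have cg : {for (w, v), continuous g}.
    apply: continuous_at_bigsum => i; apply: continuous_at_bigsum => j.
    have cc k : {for (w, v), continuous (fun z : V * V => z.2 0 k)}.
      apply: (@continuous_comp _ _ _ snd (fun x : V => x 0 k)); first exact: cvg_snd.
      exact: coord_continuous.
    apply: (@continuousM _ _ (fun z : V * V => z.2 0 i * z.2 0 j)).
      exact: (@continuousM _ _ (fun z : V * V => z.2 0 i) _ _ (cc i) (cc j)).
    apply: (@continuous_comp _ _ _ fst (fun x : V => ddentropy x (delta_mx 0 i) (delta_mx 0 j))).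
      exact: cvg_fst.
    by have [_ /(_ (delta_mx 0 j))] := isC1_dentropy (delta_mx 0 i) Gw.
  rewrite /continuous_at [f _]ddentropy_bigsum //.
  apply: cvg_trans cg; apply: (@near_eq_cvg _ _ (nbhs (w, v))).
  by apply: filterS nG => z Gz; rewrite /f ddentropy_bigsum.
have [[w0 v0]] := compact_EVT_min A0 cA cf; rewrite inE => -[/= Kw0 v01] fmin.
have v00 : v0 != 0 by rewrite -normr_eq0 v01 oner_eq0.
exists (f (w0, v0)); first by apply: ddentropy_gt0 => //; exact: KG.
move=> w v Kw; have Gw := KG _ Kw; have [->|vn0] := eqVneq v 0.
  have := Z w 0 0 Gw; rewrite scale0r expr0n mul0r => ->.
  by rewrite normr0 expr0n mulr0.
have : f (w0, v0) <= (`|v|^-1) ^+ 2 * ddentropy w v v.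
  by rewrite -Z //; apply: (fmin (w, `|v|^-1 *: v)); rewrite inE; exact: scal.
move: (f _) => m; rewrite exprVn mulrC -ler_pdivlMr ?invr_gt0 ?exprn_gt0 ?normr_gt0 // invrK.
Qed.

End Geometry.

Section VectorC1.
Context {R : realType} {n : nat}.
Local Notation V := 'rV[R]_n.
Implicit Types (G : set V).

Lemma isC1vD m G (F H : V -> 'rV[R]_m) dF dH : isC1v G F dF -> isC1v G H dH ->
  isC1v G (fun x => F x + H x) (fun w v => dF w v + dH w v).
Proof. by move=> FC HC i; apply: isC1_ext (isC1D (FC i) (HC i)) => *; rewrite mxE. Qed.

Lemma isC1vN m G (F : V -> 'rV[R]_m) dF : isC1v G F dF ->
  isC1v G (fun x => - F x) (fun w v => - dF w v).
Proof. by move=> FC i; apply: isC1_ext (isC1N (FC i)) => *; rewrite mxE. Qed.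

Lemma isC1vZ m G f df (F : V -> 'rV[R]_m) dF : isC1 G f df -> isC1v G F dF ->
  isC1v G (fun x => f x *: F x) (fun w v => f w *: dF w v + df w v *: F w).
Proof.
move=> fC FC i; apply: isC1_ext (isC1M fC (FC i)) => *; rewrite !mxE //.
by congr (_ + _); rewrite mulrC.
Qed.

Lemma isC1v_cst m G (c : 'rV[R]_m) : isC1v G (fun=> c) (fun _ _ => 0).
Proof. by move=> i; apply: isC1_ext (isC1_cst (c 0 i)) => *; rewrite ?mxE. Qed.

Lemma isC1v_row_mx m1 m2 G (F : V -> 'rV[R]_m1) (H : V -> 'rV[R]_m2) dF dH :
  isC1v G F dF -> isC1v G H dH ->
  isC1v G (fun x => row_mx (F x) (H x)) (fun w v => row_mx (dF w v) (dH w v)).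
Proof.
move=> FC HC i; case: (split_ordP i) => j ->.
  by apply: isC1_ext (FC j) => *; rewrite row_mxEl.
by apply: isC1_ext (HC j) => *; rewrite row_mxEr.
Qed.

Lemma isC1v_scalar G f df : isC1 G f df ->
  isC1v G (fun x => (f x)%:M : 'rV[R]_1) (fun w v => (df w v)%:M).
Proof. by move=> fC i; apply: isC1_ext fC => *; rewrite (ord1 i) mxE eqxx mulr1n. Qed.

End VectorC1.

Section Generalities.
Context {R : realType}.
Local Notation mu := (@lebesgue_measure R).

(** A bound on the differential bounds every real eigenvalue. The assumption 0 <= M covers the
    absence of real eigenvalues, where the supremum takes its default value 0. *)
Lemma sigma_max_le n (G : set 'rV[R]_n) (F : 'rV[R]_n -> 'rV[R]_n) dF z (M : R) :
  0 <= M -> isC1v G F dF -> G z -> (forall v, `|dF z v| <= M * `|v|) ->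
  sigma_max F z <= M.
Proof.
move=> M0 FC Gz HM; rewrite /sigma_max.
set E := [set s | _]; have [E0|E0] := pselect (E !=set0); last first.
  have -> : E = set0 by apply/seteqP; split => // y Ey; case: E0; exists y.
  by rewrite sup0.
apply: ge_sup => // s /= /eigenvalueP [v].
rewrite (isC1v_jacobian v FC Gz) => vE v0.
have := HM v; rewrite vE normrZ ler_pM2r ?normr_gt0 //.
by apply: le_trans; exact: ler_norm.
Qed.

Lemma lipschitz_within_continuous (T W : normedModType R) (A : set T) (f : T -> W)
    (L : R) : (forall x y, A x -> A y -> `|f x - f y| <= L * `|x - y|) ->
  {within A, continuous f}.
Proof.
move=> hL; apply/subspace_continuousP => x Ax; apply/cvgrPdist_lt => e e0.
have L1 : 0 < `|L| + 1 by rewrite ltr_wpDl.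
rewrite near_withinE; near=> y => Ay.
apply: (le_lt_trans (hL _ _ Ax Ay)).
apply: (@le_lt_trans _ _ ((`|L| + 1) * `|x - y|)).
  by rewrite ler_wpM2r // (le_trans (ler_norm L)) // lerDl.
rewrite -ltr_pdivlMl //; near: y.
by apply: cvgr_dist_lt; [exact: cvg_id|rewrite mulr_gt0 // invr_gt0].
Unshelve. all: by end_near. Qed.

Lemma bounded_within_compact (T : topologicalType) (A : set T) (f : T -> R) :
  compact A -> {within A, continuous f} ->
  exists2 M : R, 0 < M & forall x, A x -> `|f x| <= M.
Proof.
move=> cA cf; have : compact (f @` A) by exact: continuous_compact.
move=> /compact_bounded [M [_ MA]].
exists (`|M| + 1) => [|x Ax]; first by rewrite ltr_wpDl.
by apply: MA; [rewrite (le_lt_trans (ler_norm M)) ?ltrDl|exists x].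
Qed.

Lemma Rintegral_bigsum d (T : measurableType d) (m : {measure set T -> \bar R})
    (I : Type) (s : seq I) (D : set T) (c : I -> R) (f : I -> T -> R) :
  measurable D -> (forall i, m.-integrable D (EFin \o f i)) ->
  m.-integrable D (EFin \o (fun x => \sum_(i <- s) c i * f i x)) /\
  Rintegral m D (fun x => \sum_(i <- s) c i * f i x) =
    \sum_(i <- s) c i * Rintegral m D (f i).
Proof.
move=> mD fI.
have intZ i : m.-integrable D (EFin \o (fun x => c i * f i x)).
  by have := integrableZl mD (c i) (fI i).
elim: s => [|i s [IH1 IH2]].
  have -> : (fun x => \sum_(i <- [::]) c i * f i x) = cst 0.
    by apply/funext => x; rewrite big_nil.
  by split; [exact: integrable0|rewrite big_nil Rintegral_cst ?mul0r].
have -> : (fun x => \sum_(j <- i :: s) c j * f j x) =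
    (fun x => c i * f i x + \sum_(j <- s) c j * f j x).
  by apply/funext => x; rewrite big_cons.
split; first by have := integrableD mD (intZ i) IH1.
by rewrite big_cons -IH2 RintegralD // RintegralZl.
Qed.

Lemma lebesgue_measure01 : mu (`[(0 : R), 1]%classic) = 1%E.
Proof. by rewrite lebesgue_measure_itv /= lte_fin ltr01 -EFinD subr0. Qed.

Lemma lebesgue_measure01_lty : (mu (`[0%R, 1%R]%classic) < +oo)%E.
Proof. by apply: (eq_ind_r (fun z => z < +oo)%E _ lebesgue_measure01); rewrite ltry. Qed.

Lemma Rint01_cst (c : R) : Rint `[0, 1] (fun=> c) = c.
Proof.
rewrite Rintegral_cst //; apply: (eq_trans (congr1 (fun z => c * fine z) lebesgue_measure01)).
by rewrite /= mulr1.
Qed.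

End Generalities.

(** * Consistency of the HLL entropy flux *)

Section WaveSpeeds.
Context {R : realType} {d : nat}.
Local Notation V := (state R d).
Local Notation mu := (@lebesgue_measure R).
Implicit Types (a b e w v x : V) (K : set V).

Lemma mhd_flux_C1 : exists dF, isC1v (@admissible R d) mhd_flux dF.
Proof.
have velC : isC1v (@admissible R d) vel dvel.
  by move=> i; apply: isC1_subset (@isC1v_vel R d i); exact: admissible_dense.
have uxC := velC ord0.
have magC := @isC1v_mag R d admissible.
have BxC := magC ord0.
have rC := @isC1_rho R d admissible.
have eC := @isC1_energy R d admissible.
have pC := isC1_subset (@admissible_dense R d) (@isC1_pres R d).
have [dps psC] : exists df, isC1 (@admissible R d) pstar df.
  eexists; apply: isC1_ext (isC1D pC (isC1Z 2^-1 (isC1v_dotv magC magC))) => // w.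
  by rewrite /pstar enorm_sqr.
have rE := isC1M rC uxC.
have mE := isC1vD (isC1vD (isC1vZ rE velC) (isC1vZ psC (isC1v_cst (delta_mx 0 ord0))))
  (isC1vN (isC1vZ BxC magC)).
have eE := isC1D (isC1M uxC (isC1D eC psC)) (isC1N (isC1M BxC (isC1v_dotv velC magC))).
have bE := isC1vD (isC1vZ uxC magC) (isC1vN (isC1vZ BxC velC)).
have C := isC1v_row_mx (isC1v_scalar rE) (isC1v_row_mx mE (isC1v_row_mx (isC1v_scalar eE) bE)).
by eexists; exact: C.
Qed.

Lemma mhd_eflux_C1 : exists df, isC1 (@admissible R d) mhd_eflux df.
Proof.
have uxC : isC1 (@admissible R d) ux (fun w v => dvel w v 0 ord0).
  by apply: isC1_subset (@isC1v_vel R d ord0); exact: admissible_dense.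
eexists; apply: isC1_ext (isC1M (@isC1_entropy R d) uxC) => [w|//].
by rewrite /entropy /mhd_eflux; ring.
Qed.

Lemma rho_mkstate (r e : R) (m b : 'rV[R]_d.+1) : rho (mkstate r m e b) = r.
Proof. by rewrite /rho row_mxKl mxE eqxx mulr1n. Qed.
Lemma mom_mkstate (r e : R) (m b : 'rV[R]_d.+1) : mom (mkstate r m e b) = m.
Proof. by rewrite /mom row_mxKr row_mxKl. Qed.
Lemma energy_mkstate (r e : R) (m b : 'rV[R]_d.+1) : energy (mkstate r m e b) = e.
Proof. by rewrite /energy !row_mxKr row_mxKl mxE eqxx mulr1n. Qed.
Lemma mag_mkstate (r e : R) (m b : 'rV[R]_d.+1) : mag (mkstate r m e b) = b.
Proof. by rewrite /mag !row_mxKr. Qed.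

(** This is 2 beta (u . B) for beta = rho / (2 P), as a function of the conserved variables. *)
Definition phi0 w : R := rho w / pres w * dotv (vel w) (mag w).

(* The pairing of the entropy variables at [w] with the source at [x] agrees
   with [phi0 w] up to a second order term. *)
Lemma dentropy_source w x : admissible w ->
  dentropy w (mhd_source x) = phi0 w
    - rho w / pres w * dotv (vel x - vel w) (mag x - mag w).
Proof.
move=> [r0 p0].
rewrite /dentropy /dspec /dpres /mhd_source rho_mkstate mom_mkstate energy_mkstate mag_mkstate.
rewrite /phi0; move: (vel w) (vel x) (mag w) (mag x) => uw uxx bw bx.
have r1 : rho w != 0 by rewrite gt_eqF.
have p1 : pres w != 0 by rewrite gt_eqF.
rewrite gam1 !dotvE (dotvC bw uxx); field.
by rewrite p1.
Qed.

Lemma phi0_C1 : exists df, isC1 (@admissible R d) phi0 df.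
Proof.
have velC : isC1v (@admissible R d) vel dvel.
  by move=> i; apply: isC1_subset (@isC1v_vel R d i); exact: admissible_dense.
have magC := @isC1v_mag R d admissible.
have pC := isC1_subset (@admissible_dense R d) (@isC1_pres R d).
have pV := isC1V pC (fun w Gw => lt0r_neq0 (proj2 Gw)).
have C := isC1M (isC1M (@isC1_rho R d admissible) pV) (isC1v_dotv velC magC).
by eexists; exact: C.
Qed.

(** The segment from [a] to [a + t (b - a)] stays in [segments K], a compact set on which the
    differential is bounded. *)
Lemma C1_lipschitz K f df : compact K -> K `<=` admissible ->
  isC1 (@admissible R d) f df ->
  exists2 C : R, 0 < C & forall a b (t : R), K a -> K b -> 0 <= t <= 1 ->
    `|f (a + t *: (b - a)) - f a| <= C * `|b - a|.
Proof.
move=> cK KG fC.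
have [M M0 HM] := isC1_bounded (compact_segments cK) (segments_admissible KG) fC.
exists M => // a b t Ka Kb /andP[t0 t1].
have seg (s : R) : 0 <= s <= 1 -> segments K (a + s *: (t *: (b - a))).
  move=> /andP[s0 s1]; exists a, b, (s * t); split => //; last by rewrite scalerA.
  by rewrite mulr_ge0 //= mulr_ile1.
apply: (@le_trans _ _ (M * `|t *: (b - a)|)).
  apply: (@isC1_segment_lipschitz _ _ _ _ _ _ _ _ fC) => s /seg; last exact: HM.
  exact: segments_admissible.
by rewrite ler_wpM2l ?(ltW M0) // normrZ (ger0_norm t0) ler_piMl.
Qed.

Lemma C1_lipschitz1 K f df : compact K -> K `<=` admissible ->
  isC1 (@admissible R d) f df ->
  exists2 C : R, 0 < C & forall a b, K a -> K b -> `|f b - f a| <= C * `|b - a|.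
Proof.
move=> cK KG fC; have [C C0 HC] := C1_lipschitz cK KG fC.
exists C => // a b Ka Kb; have := HC a b 1 Ka Kb.
by rewrite ler01 lexx scale1r subrKC; apply.
Qed.


(** For k = 1 this is the MHD system and for k = -1 the reversed one, so that a single estimate
    under |k| = 1 serves the usual and the downwind operators. *)
Definition scaled_mhd (k : R) : system R d :=
  System (fun U => k *: mhd_flux U) (fun U => k * mhd_eflux U)
    (fun U => k *: mhd_source U).

Lemma mhd_scaled : mhd R d = scaled_mhd 1.
Proof.
by congr System; apply/funext => U; rewrite ?scale1r ?mul1r.
Qed.

Lemma opp_mhd_scaled : opp_system (mhd R d) = scaled_mhd (-1).
Proof.
by congr System; apply/funext => U; rewrite ?scaleN1r ?mulN1r.
Qed.

Definition jBx : 'I_(1 + (d.+1 + (1 + d.+1))) := rshift _ (rshift _ (rshift _ ord0)).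
Lemma BxE w : Bx w = w 0 jBx.
Proof. by rewrite /Bx /mag !mxE. Qed.

(** The domain is [dense] because the source is evaluated along the path, where only the density is
    known to be positive. *)
Lemma mhd_source_C1 : exists dF, isC1v (@dense R d) mhd_source dF.
Proof.
have magC := @isC1v_mag R d dense.
have C := isC1v_row_mx (isC1v_cst (n := 1 + (d.+1 + (1 + d.+1))) (G := @dense R d) (0 : R)%:M)
  (isC1v_row_mx magC (isC1v_row_mx
   (isC1v_scalar (isC1v_dotv (@isC1v_vel R d) magC)) (@isC1v_vel R d))).
by eexists; exact: C.
Qed.

(* [e] is small when the path stays close to [a]; only its Lipschitz constant in
   the parameter bounds the derivative. *)
Lemma path_int_estimate (k : R) a (Phi : R -> V) (L e : R) : 0 <= L -> admissible a ->
  (forall t s : R, 0 <= t <= 1 -> 0 <= s <= 1 -> `|Phi t - Phi s| <= L * `|t - s|) ->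
  (forall t : R, 0 <= t <= 1 -> 0 < rho (Phi t)) ->
  (forall t : R, 0 <= t <= 1 ->
    `|rho a / pres a * dotv (vel (Phi t) - vel a) (mag (Phi t) - mag a)| <= e) ->
  `|dotv (gradient entropy a) (path_int (scaled_mhd k) Phi)
    - k * (phi0 a * Bx (Phi 1 - Phi 0))| <= `|k| * (e * L).
Proof.
move=> L0 Ga lipP rP eP.
have /choice [g gP] : forall j, exists g : R -> R, [/\ measurable_fun setT g,
    (forall t, `|g t| <= L),
    {ae mu, forall t, 0 < t < 1 -> derivable (fun t => Phi t 0 j) t 1 /\
       derive1 (fun t => Phi t 0 j) t = g t} &
    Rint `[0, 1] g = Phi 1 0 j - Phi 0 0 j].
  move=> j; apply: lipschitz_primitive => // x y x01 y01.
  by have := mx_norm_coord (Phi x - Phi y) j; rewrite !mxE => /le_trans; apply; exact: lipP.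
have [N [mN N0 NP]] : exists N : set R, [/\ measurable N, mu N = 0%E &
    forall t, 0 <= t <= 1 -> ~ N t -> Bx (derive1 Phi t) = g jBx t].
  (* [derive1 Phi] is the derivative of a vector-valued map, so all coordinates have to be
     differentiable at the same point: a finite intersection of sets of full measure. *)
  have : {ae mu, forall t, forall j, 0 < t < 1 -> derivable (fun t => Phi t 0 j) t 1 /\
       derive1 (fun t => Phi t 0 j) t = g j t}.
    apply: filter_forall => j; have [_ _ + _] := gP j.
    by [].
  move=> [N [mN N0 NP]]; exists (N `|` ([set 0] `|` [set 1])); split.
  - by apply: measurableU => //; exact: measurableU.
  - apply/eqP; rewrite -measure_le0 (le_trans (measureU2 _ _ _)) //.
      exact: measurableU.
    rewrite [X in (X + _)%E]N0 add0e (le_trans (measureU2 _ _ _)) //.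
    by rewrite -[leRHS]adde0; apply: leeD; rewrite le_eqVlt; apply/orP; left; apply/eqP;
      exact: lebesgue_measure_set1.
  - move=> t /andP[t0 t1] /not_orP[Nt /not_orP[tn0 tn1]].
    have t01 : 0 < t < 1.
      by rewrite !lt_neqAle t0 t1 !andbT eq_sym; apply/andP; split; exact/eqP.
    have H j : derivable (fun t => Phi t 0 j) t 1 /\ derive1 (fun t => Phi t 0 j) t = g j t.
      by apply: contrapT => C; apply/Nt/NP => /(_ j t01).
    have dP : derivable Phi t 1 by apply/derivable_mxP => i j; rewrite (ord1 i); exact: (H j).1.
    by rewrite BxE derive1E (derive_mx dP) mxE -derive1E (H jBx).2.
have D01 : measurable (`[0, 1] : set R) by exact: measurable_itv.
have [mg gL _ gI] := gP jBx.
pose S j t := mhd_source (Phi t) 0 j.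
have [dS SC] := mhd_source_C1.
have Sint j : mu.-integrable `[0, 1] (EFin \o (fun t => S j t * g jBx t)).
  have cP : {within `[0, 1], continuous Phi}.
    apply: (lipschitz_within_continuous (L := L)) => x y.
    by rewrite /= !in_itv; exact: lipP.
  have cS : {within `[0, 1], continuous (S j)}.
    apply/subspace_continuousP => t t01.
    have Gt : dense (Phi t) by apply: rP; rewrite /= in_itv in t01.
    apply: (cvg_comp Phi (fun x : V => mhd_source x 0 j)); last exact: isC1_continuous (SC j) Gt.
    exact: (subspace_continuousP _ _).1.
  have [M _ SM] := bounded_within_compact (@segment_compact R 0 1) cS.
  apply: (@bounded_integrable _ _ _ _ _ _ (M * L)) => //.
    exact: lebesgue_measure01_lty.
    apply: measurable_funM; first exact: subspace_continuous_measurable_fun.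
    exact: measurable_funTS.
  by move=> t t01; rewrite normrM ler_pM // SM.
(* Off the null set the derivative in the integrand is the measurable density, which makes the
   integral linear from here on. *)
have SE j : path_int (scaled_mhd k) Phi 0 j = k * Rint `[0, 1] (fun t => S j t * g jBx t).
  rewrite -RintegralZl // mxE /Rintegral; apply: (congr1 fine).
  apply: ae_eq_integral_nm; [exact: mN|exact: N0|move=> t /=].
  by rewrite in_itv /= => t01 Nt; rewrite NP // mxE mulrA.
have -> : dotv (gradient entropy a) (path_int (scaled_mhd k) Phi) = k *
    \sum_j gradient entropy a 0 j * Rint `[0, 1] (fun t => S j t * g jBx t).
  by rewrite mulr_sumr; apply: eq_bigr => j _; rewrite SE mulrCA.
rewrite -mulrBr normrM; apply: ler_wpM2l => //.
rewrite -(Rintegral_bigsum _ _ _ Sint).2 //.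
(* The first term integrates to phi0(a) Bx(Phi 1 - Phi 0) by the fundamental theorem of calculus;
   the second is the remainder of [dentropy_source]. *)
have E t : \sum_j gradient entropy a 0 j * (S j t * g jBx t) =
    phi0 a * g jBx t - rho a / pres a * dotv (vel (Phi t) - vel a) (mag (Phi t) - mag a) * g jBx t.
  have /= := isC1_gradient (mhd_source (Phi t)) (@isC1_entropy R d) Ga.
  rewrite dentropy_source // -mulrBl => <-; rewrite /dotv mulr_suml.
  by apply: eq_bigr => j _; rewrite mulrA.
under [X in Rintegral _ _ X]funext => t do rewrite E.
rewrite BxB !BxE -gI.
have eL t : 0 <= t <= 1 ->
    `|rho a / pres a * dotv (vel (Phi t) - vel a) (mag (Phi t) - mag a) * g jBx t| <= e * L.
  by move=> t01; rewrite normrM ler_pM ?eP.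
have intg : mu.-integrable `[0, 1] (EFin \o g jBx).
  apply: (@bounded_integrable _ _ _ _ _ _ L) => //; first exact: lebesgue_measure01_lty.
  exact: measurable_funTS.
have intcg : mu.-integrable `[0, 1] (EFin \o (fun t => phi0 a * g jBx t)).
  by apply: (integrableZl _ (phi0 a) intg).
have intc (c : R) : mu.-integrable `[0, 1] (EFin \o (fun _ : R => c)).
  apply: (@bounded_integrable _ _ _ _ _ _ `|c|) => //; first exact: lebesgue_measure01_lty.
have RE (c : R) : Rint `[0, 1] (fun t => phi0 a * g jBx t + c) =
    phi0 a * Rint `[0, 1] (g jBx) + c.
  by rewrite RintegralD // RintegralZl // Rint01_cst.
have pL t : `|phi0 a * g jBx t| <= `|phi0 a| * L by rewrite normrM ler_wpM2l.
have eL0 : 0 <= e * L.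
  by apply: le_trans (normr_ge0 _) (eL 0 _); rewrite lexx ler01.
have eLL : `|e * L| <= e * L by rewrite ger0_norm.
(* The remainder is at most e L in modulus, so the integrand lies between phi0 a * g - e L and phi0
   a * g + e L, and monotonicity of the integral gives both bounds. *)
rewrite ler_distl -!RE; apply/andP; split.
  apply: (@le_Rintegral_nm _ _ _ _ _ _ _ (`|phi0 a| * L + e * L)) => //.
  - exact: lebesgue_measure01_lty.
  - by move=> t _; apply: (le_trans (ler_normB _ _)); rewrite lerD.
  - move=> t; rewrite /= in_itv /= => t01.
    by apply: (le_trans (ler_normB _ _)); rewrite lerD ?eL.
  - move=> t; rewrite /= in_itv /= => /eL; rewrite ler_norml => /andP[_ ?].
    by rewrite lerB.
apply: (@le_Rintegral_nm _ _ _ _ _ _ _ (`|phi0 a| * L + e * L)) => //.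
- exact: lebesgue_measure01_lty.
- move=> t; rewrite /= in_itv /= => t01.
  by apply: (le_trans (ler_normB _ _)); rewrite lerD ?eL.
- by move=> t _; apply: (le_trans (ler_normD _ _)); rewrite lerD.
- move=> t; rewrite /= in_itv /= => /eL; rewrite ler_norml => /andP[? _].
  by rewrite lerD2l lerNl.
Qed.

End WaveSpeeds.

Section Consistency.
Context {R : realType} {d : nat}.
Local Notation V := (state R d).
Local Notation mu := (@lebesgue_measure R).
Implicit Types (a b e w v : V) (K : set V).

Lemma Rint01_id : Rint `[(0 : R), 1] id = 1 / 2.
Proof.
pose p : {poly R} := 2^-1 *: 'X^2.
have pE : p^`() = 'X.
  by rewrite /p derivZ derivXn expr1 -['X *+ _]scaler_nat scalerA mulVf ?scale1r // pnatr_eq0.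
have -> : Rint `[(0 : R), 1] id = Rint `[0, 1] (horner p^`()).
  by rewrite pE; congr (Rintegral _ _ _); apply/funext => x; rewrite hornerX.
rewrite /Rintegral (continuous_FTC2 (F := horner p)) ?ltr01 //.
- by rewrite -EFinB /= !hornerZ !hornerXn; field.
- by apply: continuous_subspaceT; exact: continuous_horner.
- split=> [x _||]; first exact: derivable_horner.
    by apply: cvg_at_right_filter; exact: continuous_horner.
  by apply: cvg_at_left_filter; exact: continuous_horner.
- by move=> x _; rewrite -derivE.
Qed.

Lemma lebesgue_measure0x (x : R) : 0 <= x -> mu (`[0%R, x]%classic) = x%:E.
Proof.
move=> x0; rewrite lebesgue_measure_itv /= lte_fin; case: ltP => [|x1].
  by rewrite -EFinD subr0.
by congr (_%:E); apply/eqP; rewrite eq_le x0 x1.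
Qed.

Lemma Rint0x_between (f : R -> R) (x l u : R) : 0 <= x ->
  (forall t, 0 <= t <= x -> l <= f t <= u) -> l * x <= Rint `[0, x] f <= u * x.
Proof.
move=> x0 lu.
have muE : fine (mu (`[0%R, x]%classic)) = x by rewrite lebesgue_measure0x.
have muoo : (mu (`[0%R, x]%classic) < +oo)%E.
  by apply: (eq_ind_r (fun z => z < +oo)%E _ (lebesgue_measure0x x0)); rewrite ltry.
have := @Rintegral_between_nm _ _ _ mu (`[0%R, x]%classic) f l u (measurable_itv _) muoo.
rewrite /= muE; apply => t; rewrite /= in_itv /=; exact: lu.
Qed.

Lemma Rint0x_bound (f : R -> R) (x M : R) : 0 <= x ->
  (forall t, 0 <= t <= x -> `|f t| <= M) -> `|Rint `[0, x] f| <= M * x.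
Proof.
move=> x0 fM; rewrite ler_norml -mulNr; apply: Rint0x_between => // t /fM.
by rewrite ler_norml.
Qed.

Lemma Rint01_between (f : R -> R) (l u : R) :
  (forall t, 0 <= t <= 1 -> l <= f t <= u) -> l <= Rint `[0, 1] f <= u.
Proof. by move=> lu; have := Rint0x_between ler01 lu; rewrite !mulr1. Qed.

Lemma le_Rint01 (f g : R -> R) (M : R) :
  (forall t, 0 <= t <= 1 -> `|f t| <= M) -> (forall t, 0 <= t <= 1 -> `|g t| <= M) ->
  (forall t, 0 <= t <= 1 -> f t <= g t) -> Rint `[0, 1] f <= Rint `[0, 1] g.
Proof.
move=> fM gM fg; apply: (@le_Rintegral_nm _ _ _ _ _ _ _ M).
- exact: measurable_itv.
- exact: lebesgue_measure01_lty.
- by move=> t; rewrite /= in_itv; exact: fM.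
- by move=> t; rewrite /= in_itv; exact: gM.
- by move=> t; rewrite /= in_itv; exact: fg.
Qed.

Lemma ddentropy_bound K : compact K -> K `<=` admissible ->
  exists2 C : R, 0 < C & forall w v y, K w -> `|ddentropy w v y| <= C * (`|v| * `|y|).
Proof.
move=> cK KG.
have /choice [M MP] : forall ij : 'I_(1 + (d.+1 + (1 + d.+1))) * 'I_(1 + (d.+1 + (1 + d.+1))),
    exists M : R, 0 < M /\ forall w, K w ->
     `|ddentropy w (delta_mx 0 ij.1) (delta_mx 0 ij.2)| <= M.
  move=> [i j] /=.
  have [] := @bounded_on_compact _ _ K (fun w => ddentropy w (delta_mx 0 i) (delta_mx 0 j)) cK.
    by move=> w /KG Gw; exact: (isC1_dentropy (delta_mx 0 i) Gw).2.
  by move=> M M0 MC; exists M.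
exists (1 + \sum_i \sum_j M (i, j)).
  rewrite ltr_pwDl // sumr_ge0 // => i _; rewrite sumr_ge0 // => j _; exact: ltW (MP _).1.
move=> w v y Kw; rewrite ddentropy_bigsum; last exact: KG.
rewrite mulrDl mul1r mulr_suml; apply: ler_wpDl; first by rewrite mulr_ge0.
apply: (le_trans (ler_norm_sum _ _ _)); apply: ler_sum => i _.
rewrite mulr_suml.
apply: (le_trans (ler_norm_sum _ _ _)); apply: ler_sum => j _.
rewrite normrM mulrC ler_pM ?(MP (i, j)).2 //.
by rewrite normrM ler_pM ?mx_norm_coord.
Qed.

Lemma mom_norm_le (x : V) : `|mom x| <= `|x|.
Proof.
apply: mx_norm_le => // j.
have -> : mom x 0 j = x 0 (rshift _ (lshift _ j)) by rewrite /mom !mxE.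
exact: mx_norm_coord.
Qed.

Lemma mag_norm_le (x : V) : `|mag x| <= `|x|.
Proof.
apply: mx_norm_le => // j.
have -> : mag x 0 j = x 0 (rshift _ (rshift _ (rshift _ j))) by rewrite /mag !mxE.
exact: mx_norm_coord.
Qed.

Lemma rho_norm_le (x : V) : `|rho x| <= `|x|.
Proof.
have -> : rho x = x 0 (lshift _ 0) by rewrite /rho !mxE.
exact: mx_norm_coord.
Qed.

Lemma Bx_norm_le (x : V) : `|Bx x| <= `|x|.
Proof. by rewrite BxE; exact: mx_norm_coord. Qed.

Lemma scaled_flux_C1 (k : R) dF : isC1v (@admissible R d) mhd_flux dF ->
  isC1v (@admissible R d) (flux (scaled_mhd k)) (fun w v => k *: dF w v).
Proof.
move=> FC i; apply: isC1_ext (isC1Z k (FC i)) => [x|w v].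
  by rewrite [RHS]mxE.
by rewrite [RHS]mxE.
Qed.

Section Path.
Variable Psi : R -> V -> V -> V.
Hypothesis hPsi : prescribed_path Psi.
Variable K : set V.
Hypotheses (cK : compact K) (KG : K `<=` admissible).

(** The second bound compares the end states (a, b) with (a, a), for which the path is constant. *)
Lemma path_lipschitz_bounds : exists2 L : R, 0 < L &
  (forall a b (t s : R), K a -> K b -> 0 <= t <= 1 -> 0 <= s <= 1 ->
     `|Psi t a b - Psi s a b| <= L * `|t - s|) /\
  (forall a b (t : R), K a -> K b -> 0 <= t <= 1 -> `|Psi t a b - a| <= L * `|b - a|).
Proof.
have [M [_ HM]] := path_lipschitz hPsi cK KG.
exists (`|M| + 1); first by rewrite ltr_wpDl.
have {}HM (x y : R * V * V) : ((`[0, 1] `*` K) `*` K) x -> ((`[0, 1] `*` K) `*` K) y ->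
    `|Psi x.1.1 x.1.2 x.2 - Psi y.1.1 y.1.2 y.2| <= (`|M| + 1) * `|x - y|.
  move=> Ax Ay.
  exact: (HM (`|M| + 1) (le_lt_trans (ler_norm M) (ltr_pwDr ltr01 (lexx _))) (x, y)).
have nE (z : R * V * V) : `|z| = Num.max (Num.max `|z.1.1| `|z.1.2|) `|z.2| by [].
split=> [a b t s Ka Kb t01 s01|a b t Ka Kb t01].
  apply: (le_trans (HM ((t, a), b) ((s, a), b) _ _)); do ? by do ! split; rewrite //= in_itv.
  rewrite ler_wpM2l ?addr_ge0 // nE /= !subrr !normr0.
  by rewrite !ge_max lexx !normr_ge0.
have := HM ((t, a), b) ((t, a), a).
rewrite /= (path_diag hPsi _ (KG Ka)); last by rewrite in_itv.
move=> H; apply: (le_trans (H _ _)); do ? by do ! split; rewrite //= in_itv.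
rewrite ler_wpM2l ?addr_ge0 // nE /= !subrr !normr0.
by rewrite !ge_max lexx !normr_ge0.
Qed.

(** The path may leave K and even the admissible set. Its density is positive and continuous on a
    compact set of parameters and end states, hence bounded below, which controls the velocity along
    the path. *)
Lemma path_rho_bound : exists2 r : R, 0 < r &
  forall a b (t : R), K a -> K b -> 0 <= t <= 1 -> r <= rho (Psi t a b).
Proof.
pose A := (`[(0 : R), 1] `*` K) `*` K.
have [A0|A0] := pselect (A !=set0); last first.
  exists 1 => // a b t Ka Kb t01; case: A0; exists ((t, a), b).
  by do ! split; rewrite //= in_itv.
have cA : compact A.
  by apply: compact_setX => //; apply: compact_setX => //; exact: segment_compact.
have cP : {within A, continuous (fun x : R * V * V => rho (Psi x.1.1 x.1.2 x.2))}.
  have [M [_ HM]] := path_lipschitz hPsi cK KG.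
  have cP0 : {within A, continuous (fun x : R * V * V => Psi x.1.1 x.1.2 x.2)}.
    apply: (lipschitz_within_continuous (L := `|M| + 1)) => x y Ax Ay.
    exact: (HM (`|M| + 1) (le_lt_trans (ler_norm M) (ltr_pwDr ltr01 (lexx _))) (x, y)).
  move=> x; apply: continuous_comp; first exact: cP0.
  by apply: isC1_continuous (isC1_rho (G := setT)) _.
have [[[t a] b]] := compact_EVT_min A0 cA cP; rewrite inE => -[[/= + Ka] Kb].
rewrite in_itv => t01 mP.
exists (rho (Psi t a b)); first by apply: (path_rho hPsi); rewrite ?in_itv //; exact: KG.
move=> a' b' t' Ka' Kb' t01'; apply: (mP ((t', a'), b')); rewrite inE.
by do ! split; rewrite //= in_itv.
Qed.

Lemma vel_bound : exists2 C : R, 0 < C & forall w, K w -> `|vel w| <= C.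
Proof.
have /choice [M MP] : forall j : 'I_d.+1, exists M : R,
    0 < M /\ forall w, K w -> `|vel w 0 j| <= M.
  move=> j; have [] := @bounded_on_compact _ _ K (fun w => vel w 0 j) cK.
    by move=> w /KG /admissible_dense; exact: isC1_continuous (@isC1v_vel R d j).
  by move=> M M0 MC; exists M.
have S0 : 0 <= \sum_j M j by rewrite sumr_ge0 // => j _; exact: ltW (MP j).1.
exists (1 + \sum_j M j) => [|w Kw]; first by rewrite ltr_pwDl.
apply: mx_norm_le => [|j]; first by rewrite addr_ge0.
apply: (le_trans ((MP j).2 w Kw)).
rewrite (bigD1 j) //= addrCA lerDl addr_ge0 // sumr_ge0 // => i _.
exact: ltW (MP i).1.
Qed.

Lemma SR_ES_bounded : exists2 C : R, 0 <= C & forall (k : R) a b, `|k| = 1 ->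
  K a -> K b -> a != b ->
  SR_ES (scaled_mhd k) a b (fun t => Psi t a b) <= C.
Proof.
have [L L0 [lip1 lip2]] := path_lipschitz_bounds.
have [r r0 rP] := path_rho_bound.
have [Cu Cu0 uP] := vel_bound.
have cH := compact_segments cK; have HG := segments_admissible KG.
have [H H0 HP] := ddentropy_bound cH HG.
have [c c0 cP] := ddentropy_coercive cH HG.
have [dF FC] := @mhd_flux_C1 R d.
have [M M0 MP] := isC1v_bounded cH HG FC.
have [dphi phiC] := @phi0_C1 R d.
have [Cp Cp0 phiP] := C1_lipschitz cK KG phiC.
have [B B0 BP] : exists2 B : R, 0 < B & forall w, K w -> `|rho w / pres w| <= B.
  apply: (bounded_on_compact cK) => w /KG Gw.
  have pC := isC1_subset (@admissible_dense R d) (@isC1_pres R d).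
  have pV := isC1V pC (fun w Gw => lt0r_neq0 (proj2 Gw)).
  exact: isC1_continuous (isC1M (@isC1_rho R d admissible) pV) Gw.
have [H0w M0w Cp0w L0w] := And4 (ltW H0) (ltW M0) (ltW Cp0) (ltW L0).
have [B0w Cu0w r0w c0w] := And4 (ltW B0) (ltW Cu0) (ltW r0) (ltW c0).
(* Q |e|^2 bounds the remainder of [dentropy_source] along the path: B bounds rho / p, d + 1 comes
   from the scalar product, r^-1 (1 + Cu) L from the change of velocity and the last L from that of
   the magnetic field. T collects the three parts of the numerator. *)
pose Q := B * (d.+1%:R * (r^-1 * (1 + Cu) * L * L)).
pose T := H * M + Cp + Q * L.
have Q0 : 0 <= Q.
  by rewrite /Q !mulr_ge0 ?addr_ge0 ?invr_ge0.
have T0 : 0 <= T by apply: addr_ge0; [apply: addr_ge0 => //|]; exact: mulr_ge0.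
exists (T / (c / 2)); first by rewrite divr_ge0 // divr_ge0 // ltW.
move=> k a b k1 Ka Kb ab.
pose e := b - a; pose Phi t := Psi t a b.
have e0 : e != 0 by rewrite subr_eq0 eq_sym.
have en : 0 < `|e| by rewrite normr_gt0.
have en2 : 0 < `|e| ^+ 2 by rewrite exprn_gt0.
have Ga := KG Ka.
have seg t : 0 <= t <= 1 -> segments K (a + t *: e) by exists a, b, t.
have tx1 (x t : R) : 0 <= x <= 1 -> 0 <= t <= x -> 0 <= t <= 1.
  by move=> /andP[_ x1] /andP[-> tx]; exact: le_trans tx x1.
have hE t y : 0 <= t <= 1 ->
    dotv (e *m hessian entropy (a + t *: e)) y = ddentropy (a + t *: e) e y.
  by move=> t01; rewrite hessian_entropy //; exact/HG/seg.
have kFC : isC1v (@admissible R d) (flux (scaled_mhd k)) (fun w v => k *: dF w v).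
  exact: scaled_flux_C1.
have N1 : `|Rint `[0, 1] (fun xi => Rint `[0, xi] (fun zeta =>
    dotv (e *m hessian entropy (a + zeta *: e))
         (e *m 'J (flux (scaled_mhd k)) (a + xi *: e))))| <= H * M * `|e| ^+ 2.
  rewrite -[leRHS]mulr1; apply: Rint0x_bound => // x /[dup] x01 /andP[x0 x1].
  apply: (@le_trans _ _ (H * M * `|e| ^+ 2 * x)); last first.
    by rewrite ler_piMr // !mulr_ge0 // ltW.
  apply: Rint0x_bound => // t tx; have t01 := tx1 _ _ x01 tx.
  rewrite hE // (isC1v_jacobian _ kFC (HG _ (seg _ x01))).
  apply: (le_trans (HP _ _ _ (seg _ t01))).
  rewrite normrZ k1 mul1r -mulrA; apply: ler_wpM2l; first exact: ltW.
  rewrite expr2 mulrCA; apply: ler_wpM2l => //; exact/MP/seg.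
have N2 : `|Rint `[0, 1] (fun xi =>
      dotv (gradient entropy (a + xi *: e)) (source (scaled_mhd k) (a + xi *: e)) * Bx e)
    - k * (phi0 a * Bx e)| <= Cp * `|e| ^+ 2.
  rewrite ler_distl; apply: Rint01_between => t t01.
  rewrite -ler_distl.
  rewrite /= (isC1_gradient _ (@isC1_entropy R d) (HG _ (seg _ t01))).
  have -> : dentropy (a + t *: e) (k *: mhd_source (a + t *: e)) = k * phi0 (a + t *: e).
    have Gt := HG _ (seg _ t01).
    have := isC1_linear k (mhd_source (a + t *: e)) 0 (@isC1_entropy R d) Gt.
    have := isC1_linear 0 0 0 (@isC1_entropy R d) Gt.
    rewrite scale0r mul0r add0r => _.
    have d00 : dentropy (a + t *: e) 0 = 0.
      rewrite (isC1_sum _ (@isC1_entropy R d) Gt) big1 // => j _.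
      by rewrite mxE mul0r.
    rewrite d00 !addr0 => ->; congr (_ * _).
    (* On the straight segment both arguments of [dentropy_source] coincide, so the pairing is
       exactly phi0 and only its variation along the segment remains. *)
    rewrite dentropy_source // subrr.
    by rewrite -[X in dotv X](scale0r 0) dotvZl mul0r mulr0 subr0.
  rewrite -mulrA -mulrBr normrM k1 mul1r -mulrBl normrM expr2 mulrA.
  by apply: ler_pM => //; [exact: phiP|exact: Bx_norm_le].
have N3 : `|dotv (gradient entropy a) (path_int (scaled_mhd k) Phi)
    - k * (phi0 a * Bx e)| <= Q * L * `|e| ^+ 2.
  have P0 : Phi 0 = a by apply: (path0 hPsi); exact: KG.
  have P1 : Phi 1 = b by apply: (path1 hPsi); exact: KG.
  have := @path_int_estimate R d k a Phi L (Q * `|e| ^+ 2) (ltW L0) Ga.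
  rewrite P0 P1 k1 mul1r [Q * L * _]mulrAC; apply.
  - by move=> t s t01 s01; exact: lip1.
  - by move=> t t01; apply: lt_le_trans r0 (rP _ _ _ Ka Kb t01).
  move=> t t01.
  have Pe : `|Phi t - a| <= L * `|e| by exact: lip2.
  have rt : r <= rho (Phi t) by exact: rP.
  have rt0 : 0 < rho (Phi t) by exact: lt_le_trans rt.
  have ue : `|vel (Phi t) - vel a| <= r^-1 * (1 + Cu) * (L * `|e|).
    (* In this form the density of the path appears in the denominator alone, and the velocity is
       needed at [a] only. *)
    have -> : vel (Phi t) - vel a =
        (rho (Phi t))^-1 *: (mom (Phi t - a) - rho (Phi t - a) *: vel a).
      have ra : rho a != 0 by rewrite gt_eqF // (proj1 Ga).
      have rt1 : rho (Phi t) != 0 by rewrite gt_eqF.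
      rewrite momB rhoB (momE ra) (momE rt1); move: (vel (Phi t)) (vel a) => u1 u2.
      by apply/rowP => i; rewrite !mxE; field.
    rewrite normrZ -mulrA; apply: ler_pM => //.
      by rewrite normfV ger0_norm ?ler_pV2 ?inE ?unitfE ?gt_eqF // ltW.
    apply: (le_trans (ler_normB _ _)); rewrite mulrDl mul1r lerD //.
      exact: (le_trans (mom_norm_le _)).
    rewrite normrZ mulrC ler_pM ?uP //.
    exact: (le_trans (rho_norm_le _)).
  have be : `|mag (Phi t) - mag a| <= L * `|e|.
    by rewrite -magB; apply: (le_trans (mag_norm_le _)).
  rewrite normrM /Q -mulrA; apply: ler_pM => //; first exact: BP.
  apply: (le_trans (norm_dotv _ _)).
  have -> : d.+1%:R * (r^-1 * (1 + Cu) * L * L) * `|e| ^+ 2 =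
      d.+1%:R * ((r^-1 * (1 + Cu) * (L * `|e|)) * (L * `|e|)) by ring.
  by apply: ler_wpM2l => //; exact: ler_pM.
have numP : `|ES_num (scaled_mhd k) a e
    - dotv (gradient entropy a) (path_int (scaled_mhd k) Phi)| <= T * `|e| ^+ 2.
  rewrite /ES_num.
  (* [Z] is the common first order part of the two source terms; adding and subtracting it leaves
     three terms of second order. *)
  set I1 := Rint _ _; set I2 := Rint _ _; set J := dotv _ _; set Z := k * (phi0 a * Bx e).
  have -> : I1 + I2 - J = I1 + (I2 - Z) + (Z - J) by ring.
  apply: (le_trans (ler_normD _ _)); rewrite /T mulrDl lerD //; last by rewrite distrC.
  by apply: (le_trans (ler_normD _ _)); rewrite mulrDl lerD.
(* The factor 1/2 is the area of the triangle zeta <= xi over which the coercive form is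
   integrated. *)
have denP : c / 2 * `|e| ^+ 2 <= ES_den a e.
  rewrite /ES_den.
  have inner x : 0 <= x <= 1 -> c * `|e| ^+ 2 * x <= Rint `[0, x] (fun zeta =>
      dotv (e *m hessian entropy (a + zeta *: e)) e) <= H * `|e| ^+ 2 * x.
    move=> /[dup] x01 /andP[x0 x1].
    apply: Rint0x_between => // t tx; have t01 := tx1 _ _ x01 tx.
    rewrite hE // (cP _ _ (seg _ t01)) /= expr2.
    by apply: le_trans (HP _ _ _ (seg _ t01)); exact: ler_norm.
  have -> : c / 2 * `|e| ^+ 2 = Rint `[0, 1] (fun x => c * `|e| ^+ 2 * x).
    rewrite RintegralZl //; last first.
      apply: (@bounded_integrable _ _ _ _ _ _ 1) => //; first exact: lebesgue_measure01_lty.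
      by move=> x; rewrite /= in_itv /= => /andP[x0 x1]; rewrite ger0_norm.
    by rewrite Rint01_id; field.
  have ce0 : 0 <= c * `|e| ^+ 2 by rewrite mulr_ge0 ?ltW.
  have He0 : 0 <= H * `|e| ^+ 2 by rewrite mulr_ge0 ?ltW.
  apply: (@le_Rint01 _ _ (c * `|e| ^+ 2 + H * `|e| ^+ 2)) => x /[dup] x01 /andP[x0 x1].
  - rewrite ger0_norm ?mulr_ge0 //.
    by apply: (@le_trans _ _ (c * `|e| ^+ 2)); rewrite ?lerDl // ler_piMr.
  - have /andP[i1 i2] := inner x x01.
    rewrite ger0_norm; last by apply: le_trans i1; rewrite mulr_ge0.
    apply: (le_trans i2); apply: (@le_trans _ _ (H * `|e| ^+ 2)); rewrite ?lerDr //.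
    by rewrite ler_piMr.
  - by have /andP[] := inner x x01.
rewrite /SR_ES -/e -/Phi.
have den0 : 0 < ES_den a e by apply: lt_le_trans denP; rewrite mulr_gt0 // divr_gt0.
rewrite ler_pdivrMr //; apply: (le_trans (ler_norm _)); apply: (le_trans numP).
apply: (@le_trans _ _ (T / (c / 2) * (c / 2 * `|e| ^+ 2))).
  by rewrite mulrA divfK // gt_eqF // divr_gt0.
by apply: ler_wpM2l denP; rewrite divr_ge0 // divr_ge0 // ltW.
Qed.

Lemma SR_bounded : exists2 C : R, 0 <= C & forall (k : R) a b, `|k| = 1 ->
  K a -> K b -> SR (scaled_mhd k) a b (fun t => Psi t a b) <= C.
Proof.
have [C C0 CP] := SR_ES_bounded.
have [dF FC] := @mhd_flux_C1 R d.
have [M M0 MP] := isC1v_bounded cK KG FC.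
exists (C + M) => [|k a b k1 Ka Kb]; first by rewrite addr_ge0 // ltW.
have sM w : K w -> sigma_max (flux (scaled_mhd k)) w <= M.
  move=> Kw; apply: sigma_max_le (ltW M0) (scaled_flux_C1 k FC) (KG Kw) _ => v.
  by rewrite normrZ k1 mul1r; exact: MP.
have std : SR_std (scaled_mhd k) a b <= C + M.
  by rewrite /SR_std !ge_max addr_ge0 ?(ltW M0) // andbT; apply/andP; split;
    apply: (le_trans (sM _ _)); rewrite // lerDr.
rewrite /SR; case: eqVneq => // ab; rewrite ge_max std /=.
by apply: (le_trans (CP k a b k1 Ka Kb ab)); rewrite lerDl ltW.
Qed.

Lemma SR_ge0 (s : system R d) a b Phi : 0 <= SR s a b Phi.
Proof.
have H : 0 <= SR_std s a b by rewrite /SR_std le_max lexx orbT.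
by rewrite /SR; case: ifP => // _; rewrite le_max H.
Qed.

Lemma SL_le0 (s : system R d) a b Phi : SL s a b Phi <= 0.
Proof.
have H : SL_std s a b <= 0 by rewrite /SL_std ge_min lexx orbT.
by rewrite /SL; case: ifP => // _; rewrite ge_min H.
Qed.

(** The flux is a convex combination of the fluxes at [a] and [b], plus the entropy jump with a
    coefficient of modulus sR q. As q lies in [0, 1], the bound on [SR] suffices. The outer factor
    [k] undoes the reversal of the system. *)
Lemma hll_eflux_consistent : exists2 C : R, 0 <= C & forall (k : R) a b c,
  `|k| = 1 -> K a -> K b -> K c ->
  SL (scaled_mhd k) a b (fun t => Psi t a b) < SR (scaled_mhd k) a b (fun t => Psi t a b) ->
  `|k * hll_eflux (scaled_mhd k) a b (fun t => Psi t a b) - mhd_eflux c|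
    <= C * (`|a - c| + `|b - c|).
Proof.
have [S S0 SP] := SR_bounded.
have [df fC] := @mhd_eflux_C1 R d.
have [Cf Cf0 fP] := C1_lipschitz1 cK KG fC.
have [Ce Ce0 eP] := C1_lipschitz1 cK KG (@isC1_entropy R d).
exists (Cf + S * Ce) => [|k a b c k1 Ka Kb Kc]; first by rewrite addr_ge0 ?mulr_ge0 // ltW.
rewrite /hll_eflux /=.
have sR0 := SR_ge0 (scaled_mhd k) a b (fun t => Psi t a b).
have sL0 := SL_le0 (scaled_mhd k) a b (fun t => Psi t a b).
have sRS := SP k a b k1 Ka Kb.
move: (SR _ _ _ _) (SL _ _ _ _) sR0 sL0 sRS => sR sL sR0 sL0 sRS LR.
have D0 : 0 < sR - sL by rewrite subr_gt0.
have D1 : sR - sL != 0 by rewrite gt_eqF.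
have k2 : k * k = 1.
  by rewrite -expr2 -[LHS]ger0_norm ?sqr_ge0 // normrX k1 expr1n.
(* The weights add up to 1, so the flux at [c] can be subtracted from each of the two others. *)
pose p := sR / (sR - sL); pose q := - sL / (sR - sL).
have p01 : 0 <= p <= 1.
  by rewrite divr_ge0 ?(ltW D0) //= ler_pdivrMr // mul1r lerDl oppr_ge0.
have q01 : 0 <= q <= 1.
  by rewrite divr_ge0 ?oppr_ge0 ?(ltW D0) //= ler_pdivrMr // mul1r addrC lerDl.
have -> : k * ((sR * (k * mhd_eflux a) - sL * (k * mhd_eflux b)
    + sR * sL * (entropy b - entropy a)) / (sR - sL)) - mhd_eflux c =
    p * (mhd_eflux a - mhd_eflux c) + q * (mhd_eflux b - mhd_eflux c)
    - k * (sR * q) * (entropy b - entropy a).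
  move: (mhd_eflux a) (mhd_eflux b) (mhd_eflux c) (entropy a) (entropy b) => Fa Fb Fc Ua Ub.
  transitivity ((k * k * (sR * Fa - sL * Fb) + k * (sR * sL * (Ub - Ua))) / (sR - sL) - Fc).
    by field.
  by rewrite k2 /p /q; field.
clearbody p q.
have fa : `|p * (mhd_eflux a - mhd_eflux c)| <= Cf * `|a - c|.
  move: p01 => /andP[p0 p1]; rewrite normrM (ger0_norm p0).
  by apply: (@le_trans _ _ `|mhd_eflux a - mhd_eflux c|); [rewrite ler_piMl|exact: fP].
have fb : `|q * (mhd_eflux b - mhd_eflux c)| <= Cf * `|b - c|.
  move: q01 => /andP[p0 p1]; rewrite normrM (ger0_norm p0).
  by apply: (@le_trans _ _ `|mhd_eflux b - mhd_eflux c|); [rewrite ler_piMl|exact: fP].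
have fe : `|k * (sR * q) * (entropy b - entropy a)| <= S * (Ce * (`|a - c| + `|b - c|)).
  move: q01 => /andP[q0 q1]; rewrite !normrM k1 mul1r (ger0_norm q0) (ger0_norm sR0).
  apply: ler_pM => //; first by rewrite mulr_ge0.
    by apply: (le_trans _ sRS); rewrite ler_piMr.
  apply: (le_trans (eP _ _ Ka Kb)); rewrite ler_wpM2l ?(ltW Ce0) //.
  rewrite -[b - a](subrKA c) addrC (distrC a); exact: ler_normD.
apply: (le_trans (ler_normB _ _)).
have := lerD (le_trans (ler_normD _ _) (lerD fa fb)) fe.
by move=> /le_trans; apply; rewrite -mulrDr mulrDl mulrA.
Qed.

End Path.
End Consistency.

(** Meant for functions given by one formula per mesh cell: [kap] selects the cell, and a preimage
    is a countable union over the cells. *)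
Lemma measurable_countable_fibres d d' (T : measurableType d) (Y : measurableType d')
    (C : countType) (kap : T -> C) (g : C -> T -> Y) :
  (forall c, measurable (kap @^-1` [set c])) ->
  (forall c, measurable_fun setT (g c)) ->
  measurable_fun setT (fun x => g (kap x) x).
Proof.
move=> mk mg _ B mB; rewrite setTI.
have -> : (fun x => g (kap x) x) @^-1` B =
    \bigcup_c (kap @^-1` [set c] `&` (g c @^-1` B)).
  apply/seteqP; split => x /=; first by move=> Bx; exists (kap x).
  by move=> [c _ [/= -> ]].
apply: countable_bigcupT_measurable; first exact: countableP.
move=> c; apply: measurableI => //; rewrite -[_ @^-1` _]setTI; exact: mg.
Qed.

Section Enorm.
Context {R : realType} {n : nat}.
Implicit Types v w : 'rV[R]_n.

Lemma norm_le_enorm v : `|v| <= enorm v.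
Proof.
apply: mx_norm_le => [|j]; first exact: sqrtr_ge0.
rewrite -sqrtr_sqr ler_wsqrtr // /dotv (bigD1 j) //= -expr2 lerDl.
by apply: sumr_ge0 => i _; rewrite -expr2 sqr_ge0.
Qed.

Lemma enorm_le v : enorm v <= n%:R * `|v|.
Proof.
have n0 : 0 <= n%:R * `|v| by rewrite mulr_ge0.
rewrite -[leRHS](ger0_norm n0) -sqrtr_sqr ler_wsqrtr //.
apply: (le_trans (ler_norm _)); apply: (le_trans (norm_dotv _ _)).
rewrite exprMn -expr2; apply: ler_wpM2r; first exact: sqr_ge0.
by case: n => [|m]; rewrite ?expr0n // expr2 -natrM ler_nat mulnS leq_addr.
Qed.

Lemma measurable_enorm d (T : measurableType d) (D : set T) (u : T -> 'rV[R]_n) :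
  (forall j, measurable_fun D (fun x => u x 0 j)) ->
  measurable_fun D (fun x => enorm (u x)).
Proof.
move=> mu.
have ms : measurable_fun setT (@Num.sqrt R).
  by apply: continuous_measurable_fun; exact: sqrt_continuous.
have md : measurable_fun D (fun x => dotv (u x) (u x)).
  by apply: measurable_sum => j; exact: measurable_funM.
exact: (measurableT_comp ms md).
Qed.

End Enorm.

Lemma cvge0_le {R : realType} (f : nat -> \bar R) (e : R) : 0 < e ->
  f j @[j --> \oo] --> 0%E -> \forall j \near \oo, (f j <= e%:E)%E.
Proof.
move=> e0 /fine_cvgP [ff fc].
have fe : \forall j \near \oo, fine (f j) <= e by exact: (cvgr_le _ fc).
near=> j.
have fj : f j \is a fin_num by near: j.
by rewrite -(fineK fj) lee_fin; near: j.
Unshelve. all: by end_near. Qed.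

(** * Limits of integrals from errors small in mean *)

Section Errors.
Context d {T : measurableType d} {R : realType}.
Variable mu : {measure set T -> \bar R}.
Implicit Types (D : set T).

(** This takes the place of dominated convergence: the integrands need not converge at any point,
    but their error is bounded by a small constant plus a multiple of a function small in mean. The
    multiple may depend on [eps], not on the index. In the choice of constants, the added 1 avoids a
    division by 0. *)
Lemma cvg_Rintegral_error D (g_ : nat -> T -> R) (g : T -> R) (e : nat -> T -> R) :
  measurable D -> (mu D < +oo)%E ->
  (forall j, mu.-integrable D (EFin \o g_ j)) -> mu.-integrable D (EFin \o g) ->
  (forall j, measurable_fun D (e j)) -> (forall j x, D x -> 0 <= e j x) ->
  (\int[mu]_(x in D) (e j x)%:E)%E @[j --> \oo] --> 0%E ->
  (forall eps : R, 0 < eps -> exists2 C, 0 <= C & \forall j \near \oo,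
     {ae mu, forall x, D x -> `|g_ j x - g x| <= eps + C * e j x}) ->
  Rintegral mu D (g_ j) @[j --> \oo] --> Rintegral mu D g.
Proof.
move=> mD Doo ig_ ig me e0 ce ge.
have muD : mu D \is a fin_num by rewrite ge0_fin_numE.
apply/cvgrPdist_le => eps eps0.
have D0 : 0 <= fine (mu D) by rewrite fine_ge0.
have e1 : 0 < eps / (2 * (fine (mu D) + 1)) by rewrite divr_gt0 // mulr_gt0 // ltr_wpDl.
have [C C0 HC] := ge _ e1.
have e2 : 0 < eps / (2 * (C + 1)) by rewrite divr_gt0 // mulr_gt0 // ltr_wpDl.
have ce2 : \forall j \near \oo, (\int[mu]_(x in D) (e j x)%:E <= (eps / (2 * (C + 1)))%:E)%E.
  exact: cvge0_le.
near=> j.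
have ie : (\int[mu]_(x in D) (e j x)%:E <= (eps / (2 * (C + 1)))%:E)%E by near: j.
have aej : {ae mu, forall x, D x -> `|g_ j x - g x| <= eps / (2 * (fine (mu D) + 1)) + C * e j x}.
  by near: j.
rewrite distrC -RintegralB //.
have igB : mu.-integrable D (EFin \o (fun x => g_ j x - g x)).
  by have := integrableB mD (ig_ j) ig.
rewrite -lee_fin EFin_normr_Rintegral //.
apply: (le_trans (le_abse_integral _ _ _)) => //; first exact: measurable_int igB.
apply: (@le_trans _ _
  (\int[mu]_(x in D) ((eps / (2 * (fine (mu D) + 1)))%:E + C%:E * (e j x)%:E))%E).
  apply: ae_ge0_le_integral => //.
  - by apply: measurableT_comp => //; exact: measurable_int igB.
  - by move=> x Dx; rewrite adde_ge0 ?mule_ge0 ?lee_fin ?e0 // ltW.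
  - apply/measurable_EFinP; apply: measurable_funD => //; apply: measurable_funM => //.
have P1 x : D x -> (0 <= (eps / (2 * (fine (mu D) + 1)))%:E)%E by rewrite lee_fin ltW.
have P2 x : D x -> (0 <= (e j x)%:E)%E by move=> Dx; rewrite lee_fin e0.
have P3 x : D x -> (0 <= C%:E * (e j x)%:E)%E by move=> Dx; rewrite mule_ge0 ?P2.
have P4 : measurable_fun D (fun x => (e j x)%:E) by exact/measurable_EFinP.
have P5 : measurable_fun D (fun x => C%:E * (e j x)%:E)%E.
  by apply/measurable_EFinP; exact: measurable_funM.
rewrite ge0_integralD // ge0_integralZl_EFin //.
rewrite integral_cst // -[X in (_ * X)%E](fineK muD) -EFinM.
apply: (@le_trans _ _ ((eps / 2)%:E + (eps / 2)%:E)%E); last first.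
  by rewrite -EFinD -splitr.
have H m : 0 <= m -> m * (eps / (2 * (m + 1))) <= eps / 2.
  move=> m0; have m1 : 0 < m + 1 by rewrite ltr_wpDl.
  rewrite mulrA ler_pdivrMr ?mulr_gt0 //.
  have -> : eps / 2 * (2 * (m + 1)) = m * eps + eps by field.
  by rewrite lerDl ltW.
apply: leeD; first by rewrite lee_fin mulrC H.
have C0' : (0 <= C%:E)%E by rewrite lee_fin.
by apply: (le_trans (lee_wpmul2l C0' ie)); rewrite -EFinM lee_fin H.
Unshelve. all: by end_near. Qed.

(** A point outside the closed set K has some distance 1/(k+1) from it, hence at least that distance
    from every approximation. By Markov's inequality, the points where this happens form a null set
    for each k. *)
Lemma ae_limit_in_closed n D (u_ : nat -> T -> 'rV[R]_n) (u : T -> 'rV[R]_n)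
    (K : set 'rV[R]_n) : measurable D -> closed K ->
  (forall j x, D x -> K (u_ j x)) ->
  (forall j, measurable_fun D (fun x => enorm (u_ j x - u x))) ->
  (\int[mu]_(x in D) (enorm (u_ j x - u x))%:E)%E @[j --> \oo] --> 0%E ->
  {ae mu, forall x, D x -> K (u x)}.
Proof.
move=> mD cK uK mu_ cu.
pose E k := \bigcap_j (D `&` [set x | k.+1%:R^-1 <= enorm (u_ j x - u x)]).
have mEj k j : measurable (D `&` [set x | k.+1%:R^-1 <= enorm (u_ j x - u x)]).
  have -> : [set x | k.+1%:R^-1 <= enorm (u_ j x - u x)] =
      (fun x => enorm (u_ j x - u x)) @^-1` `[k.+1%:R^-1, +oo[.
    by apply/seteqP; split => x /=; rewrite in_itv /= andbT.
  exact: mu_.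
have mE k : measurable (E k) by apply: bigcap_measurable => // ; exists 0%N.
have E0 k : mu (E k) = 0%E.
  have Ej j : (k.+1%:R^-1%:E * mu (E k) <= \int[mu]_(x in D) (enorm (u_ j x - u x))%:E)%E.
    have ED : E k `<=` D by move=> x /(_ 0%N I) [].
    rewrite -integral_cst //.
    apply: (@le_trans _ _ (\int[mu]_(x in E k) (enorm (u_ j x - u x))%:E)%E).
      apply: ge0_le_integral_nm => x Ex; rewrite lee_fin //.
      by have [] := Ex j I.
    apply: ge0_subset_integral => //; first exact/measurable_EFinP.
    by move=> x _; rewrite lee_fin sqrtr_ge0.
  have : (k.+1%:R^-1%:E * mu (E k) <= 0)%E.
    apply/lee_addgt0Pr => e e0; rewrite add0e.
    have [j _ /(_ j (leqnn j))] := cvge0_le e0 cu.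
    by apply: le_trans; exact: Ej.
  rewrite pmule_rle0 ?lte_fin ?invr_gt0 // => H.
  by apply/eqP; rewrite -measure_le0.
have : mu.-negligible (\bigcup_k E k).
  by apply: negligible_bigcup => k; exists (E k); split.
apply: negligibleS => x /= /not_implyP [Dx nK].
have [e e0 He] : exists2 e : R, 0 < e & forall v, `|u x - v| < e -> ~ K v.
  have : nbhs (u x) (~` K) by apply: open_nbhs_nbhs; split => //; exact: closed_openC.
  move=> /nbhs_ballP [e /= e0 He]; exists e => // v uv; apply: He.
  by rewrite -ball_normE.
have [k ke] : exists k, k.+1%:R^-1 < e.
  have := near_infty_natSinv_lt (PosNum e0); case=> k _ /(_ k (leqnn k)) H; by exists k.
exists k => // j _; split => //=.
apply: (le_trans (ltW ke)); apply: le_trans (norm_le_enorm _); rewrite leNgt.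
by apply/negP; rewrite distrC => /He; apply; exact: uK.
Qed.

End Errors.

Section Steps.
Context d {T : measurableType d} {R : realType}.
Variable mu : {measure set T -> \bar R}.
Variables (D : set T) (mD : measurable D) (Doo : (mu D < +oo)%E).
Variables (I : finType) (C : eqType) (kap : T -> C) (idx : I -> C).
Hypothesis idxI : injective idx.
Hypothesis cov : forall x, D x -> exists k, kap x = idx k.
Let piece k := D `&` kap @^-1` [set idx k].
Hypothesis mpiece : forall k, measurable (piece k).

Lemma step_sum (G : C -> R) x : D x ->
  G (kap x) = \sum_k G (idx k) * \1_(piece k) x.
Proof.
move=> Dx; have [k kx] := cov Dx.
rewrite (bigD1 k) //= big1 ?addr0 => [|i ik]; rewrite indicE.
  by rewrite mem_set ?mulr1 ?kx //; split.
rewrite memNset ?mulr0 // => -[_] /=; rewrite kx => /idxI ki.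
by rewrite ki eqxx in ik.
Qed.

Lemma integrable_piece k c : mu.-integrable D (EFin \o (fun x => c * \1_(piece k) x)).
Proof.
apply: (@bounded_integrable _ _ _ _ _ _ `|c|) => //.
  by apply: measurable_funM => //; exact: measurable_indic.
by move=> x _; rewrite normrM ler_piMr // indicE; case: (_ \in _); rewrite ?normr1 ?normr0.
Qed.

Lemma integrable_step (G : C -> R) : mu.-integrable D (EFin \o (fun x => G (kap x))).
Proof.
apply: (eq_integrable mD (fun x => \sum_(k <- index_enum I) (G (idx k) * \1_(piece k) x)%:E)%E).
  by move=> x /set_mem Dx; rewrite /= (step_sum G Dx) -sumEFin.
by apply: integrable_sum => // k _; exact: integrable_piece.
Qed.

Lemma Rintegral_step (G : C -> R) :
  Rintegral mu D (fun x => G (kap x)) = \sum_k G (idx k) * fine (mu (piece k)).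
Proof.
rewrite (@eq_Rintegral _ _ _ mu D
  (fun x => \sum_(k <- index_enum I) (G (idx k) * \1_(piece k) x))); last first.
  by move=> x /set_mem Dx; rewrite (step_sum G Dx).
have iP k : mu.-integrable D (EFin \o \1_(piece k)).
  by have := integrable_piece k 1; apply: eq_integrable => // x _ /=; rewrite mul1r.
have [_ ->] := Rintegral_bigsum (index_enum I) (fun k => G (idx k)) mD iP.
apply: eq_bigr => k _.
by rewrite /Rintegral integral_indic // setIidl // => x [].
Qed.

End Steps.

Section Products.
Context d {T : measurableType d} {R : realType}.
Variable mu : {measure set T -> \bar R}.

Lemma ae_bounded_integrable D (f : T -> R) (c : R) :
  measurable D -> (mu D < +oo)%E -> measurable_fun D f ->
  {ae mu, forall x, D x -> `|f x| <= c} -> mu.-integrable D (EFin \o f).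
Proof.
move=> mD Doo mf fc; apply/integrableP; split; first exact/measurable_EFinP.
apply: (@le_lt_trans _ _ (\int[mu]_(x in D) (`|c|)%:E)%E).
  apply: ae_ge0_le_integral => //.
  - by apply: measurableT_comp => //; exact/measurable_EFinP.
  - by apply: filterS fc => x H Dx /=; rewrite lee_fin (le_trans (H Dx)) ?ler_norm.
rewrite integral_cst //; apply: lte_mul_pinfty => //; by rewrite lee_fin.
Qed.

(** The error of the product is (A - a) B + a (B - b). The factor [B] may deviate from its limit by
    a uniformly small amount and by a multiple of [e], which leads to the constant CA CB + Ca Ce. *)
Lemma cvg_Rintegral_mul D (A B : nat -> T -> R) (a b : T -> R) (e : nat -> T -> R)
    (Ca Cb CA CB Ce : R) :
  measurable D -> (mu D < +oo)%E ->
  (forall j, mu.-integrable D (EFin \o (fun x => A j x * B j x))) ->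
  measurable_fun D a -> measurable_fun D b ->
  (forall j, measurable_fun D (e j)) -> (forall j x, D x -> 0 <= e j x) ->
  (\int[mu]_(x in D) (e j x)%:E)%E @[j --> \oo] --> 0%E ->
  [/\ 0 <= Ca, 0 <= CA, 0 <= CB & 0 <= Ce] ->
  {ae mu, forall x, D x -> `|a x| <= Ca} ->
  (forall x, D x -> `|b x| <= Cb) ->
  (forall j, {ae mu, forall x, D x -> `|A j x - a x| <= CA * e j x}) ->
  (\forall j \near \oo, forall x, D x -> `|B j x| <= CB) ->
  (forall eps : R, 0 < eps -> \forall j \near \oo, forall x, D x ->
     `|B j x - b x| <= eps + Ce * e j x) ->
  Rintegral mu D (fun x => A j x * B j x) @[j --> \oo] --> Rintegral mu D (fun x => a x * b x).
Proof.
move=> mD Doo iAB ma mb me e0 ce [Ca0 CA0 CB0 Ce0] aC bC HA HB HBb.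
apply: (@cvg_Rintegral_error _ _ _ mu D _ _ e) => //.
  apply: (@ae_bounded_integrable _ _ (Ca * Cb)) => //; first exact: measurable_funM.
  by apply: filterS aC => x H Dx; rewrite normrM ler_pM ?H ?bC.
move=> eps eps0; have C1 : 0 < Ca + 1 by rewrite ltr_wpDl.
have := HBb _ (divr_gt0 eps0 C1) => HBe.
exists (CA * CB + Ca * Ce); first by rewrite addr_ge0 // mulr_ge0.
near=> j.
have HBj : forall x, D x -> `|B j x| <= CB by near: j.
have HBbj : forall x, D x -> `|B j x - b x| <= eps / (Ca + 1) + Ce * e j x by near: j.
move: (HA j) aC; apply: filterS2 => x H1 H2 Dx.
have -> : A j x * B j x - a x * b x = (A j x - a x) * B j x + a x * (B j x - b x) by ring.
apply: (le_trans (ler_normD _ _)); rewrite !normrM.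
apply: (@le_trans _ _ (CA * e j x * CB + Ca * (eps / (Ca + 1) + Ce * e j x))).
  by apply: lerD; apply: ler_pM => //; [exact: H1|exact: HBj|exact: H2|exact: HBbj].
have : Ca * (eps / (Ca + 1)) <= eps.
  rewrite mulrA ler_pdivrMr // mulrDr mulr1 mulrC lerDl; exact: ltW.
set q := Ca * _ => qe.
have -> : CA * e j x * CB + Ca * (eps / (Ca + 1) + Ce * e j x) = q + (CA * CB + Ca * Ce) * e j x.
  by rewrite /q; ring.
by rewrite lerD2r.
Unshelve. all: by end_near. Qed.

End Products.

(** The inverse is written as x (x^2)^(-1) with a real power, which is measurable; at 0 both sides
    vanish. *)
Lemma measurable_fun_inv {R : realType} d (T : measurableType d) (D : set T) (f : T -> R) :
  measurable_fun D f -> measurable_fun D (fun x => (f x)^-1).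
Proof.
move=> mf.
have -> : (fun x => (f x)^-1) = (fun x => f x * (f x ^+ 2) `^ (-1)).
  apply/funext => x; rewrite powR_inv1 ?sqr_ge0 //.
  have [->|f0] := eqVneq (f x) 0; first by rewrite invr0 mul0r.
  by field.
apply: measurable_funM => //.
have := @measurableT_comp _ _ _ _ _ _ _ D _ (@measurable_powR R (-1)) (measurable_funX 2 mf).
exact.
Qed.

(** * Meshes, cells and time levels *)

Section Mesh.
Context {R : realType} (m : mesh R).
Hypotheses (h0 : 0 < dx m) (t0 : 0 < dt m).

Lemma xhalfD1 i : xhalf m (i + 1) = xhalf m i + dx m.
Proof. by rewrite /xhalf intrD; ring. Qed.

Lemma cell_index_eq x i : (cell_index m x == i) = (xhalf m i <= x < xhalf m (i + 1)).
Proof.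
rewrite /cell_index floor_eq ler_pdivlMr // ltr_pdivrMr // /xhalf.
by rewrite lerBrDl ltrBlDl.
Qed.

Lemma cell_index_itv x : xhalf m (cell_index m x) <= x < xhalf m (cell_index m x + 1).
Proof. by rewrite -cell_index_eq. Qed.

Lemma cell_index_cell x : cell m (cell_index m x) x.
Proof. by rewrite /cell /= in_itv /=; have /andP[-> /ltW ->] := cell_index_itv x. Qed.

Lemma cell_index_le x y : x <= y -> cell_index m x <= cell_index m y.
Proof.
by move=> xy; apply: le_floor; rewrite ler_pM2r ?invr_gt0 // lerB.
Qed.

Lemma xcenter_cell i : cell m i (xcenter m i).
Proof.
by rewrite /cell /= in_itv /= xhalfD1 /xcenter; have := h0; move: (dx m) => h; lra.
Qed.

Lemma xcenterD1 i : xcenter m (i + 1) = xcenter m i + dx m.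
Proof. by rewrite /xcenter xhalfD1; ring. Qed.

Definition time_index (t : R) : nat := Num.truncn (t / dt m).

Lemma time_index_eq t n : 0 <= t ->
  (time_index t == n) = (n%:R * dt m <= t < n.+1%:R * dt m).
Proof.
move=> t1; have td : 0 <= t / dt m by rewrite divr_ge0 // ltW.
rewrite -ler_pdivlMr // -ltr_pdivrMr //; apply/eqP/idP => [<-|].
  exact: truncn_itv.
exact: truncn_def.
Qed.

Lemma time_index_itv t : 0 <= t ->
  (time_index t)%:R * dt m <= t < (time_index t).+1%:R * dt m.
Proof. by move=> t1; rewrite -time_index_eq. Qed.

Lemma cell_index_fibre i : cell_index m @^-1` [set i] = `[xhalf m i, xhalf m (i + 1)[%classic.
Proof.
apply/seteqP; split => x /=; rewrite in_itv /= -cell_index_eq; first by move=> ->.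
by move/eqP.
Qed.

Lemma measurable_cell_index i : measurable (cell_index m @^-1` [set i]).
Proof. by rewrite cell_index_fibre. Qed.

(** The fibre of 0 contains all negative times, where [Num.truncn] is 0; hence its description as a
    difference of half-lines. *)
Lemma measurable_time_index n : measurable (time_index @^-1` [set n]).
Proof.
have -> : time_index @^-1` [set n] =
    `]-oo, n.+1%:R * dt m[%classic `\` (if n is n'.+1 then `]-oo, n%:R * dt m[ else set0)%classic.
  apply/seteqP; split => t /=; rewrite in_itv /=.
    move=> <-; split; first by rewrite -ltr_pdivrMr // truncnS_gt.
    have : forall n, time_index t = n ->
        ~ (match n with 0%N => set0 | n'.+1 => `]-oo, n%:R * dt m[%classic end) t.
      case=> [_ []|n' E] /=; rewrite in_itv /=; apply/negP.
      by rewrite -leNgt -ler_pdivlMr // -truncn_gt_nat -/(time_index t) E.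
    exact.
  rewrite -ltr_pdivrMr // -truncn_le_nat -/(time_index t) => -[le_tn].
  move=> H; apply/eqP; rewrite eqn_leq le_tn /=.
  case: n H {le_tn} => [//|n] /=; rewrite in_itv /= => /negP.
  by rewrite -leNgt -ler_pdivlMr // -truncn_gt_nat.
by case: n => [|n]; apply: measurableD.
Qed.

Lemma measurable_at_point d (u : pwpoly R d) j : measurable_fun setT (fun x => at_point m u x 0 j).
Proof.
apply: (@measurable_countable_fibres _ _ _ _ _ (cell_index m) (fun i x => peval (u i) x 0 j)).
  exact: measurable_cell_index.
move=> i; rewrite (_ : (fun x => _) = horner (u i 0 j)); last by apply/funext => x; rewrite mxE.
by apply: continuous_measurable_fun; exact: continuous_horner.
Qed.

Definition mesh_index (z : R * R) : int * nat := (cell_index m z.1, time_index z.2).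

Lemma mesh_index_fibre k :
  mesh_index @^-1` [set k] = (cell_index m @^-1` [set k.1]) `*` (time_index @^-1` [set k.2]).
Proof.
case: k => i n; apply/seteqP; split => -[x t] /=; first by case=> <- <-.
by rewrite /mesh_index /= => -[-> ->].
Qed.

Lemma measurable_mesh_index k : measurable (mesh_index @^-1` [set k]).
Proof.
rewrite mesh_index_fibre; apply: measurableX.
  exact: measurable_cell_index.
exact: measurable_time_index.
Qed.

Lemma measurable_in_time d (u : nat -> pwpoly R d) j :
  measurable_fun setT (fun z => in_time m u z 0 j).
Proof.
apply: (@measurable_countable_fibres _ _ _ _ _ mesh_index
  (fun k z => peval (u k.2 k.1) z.1 0 j)).
  exact: measurable_mesh_index.
move=> i; rewrite (_ : (fun x => _) = horner (u i.2 i.1 0 j) \o fst); last first.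
  by apply/funext => x; rewrite mxE.
apply: measurableT_comp => //; by apply: continuous_measurable_fun; exact: continuous_horner.
Qed.

End Mesh.

(** The function is the pointwise limit of functions constant on the squares of a grid of side
    1/(n+1), and these are measurable for the product structure. *)
Lemma continuous_measurable_fun2 {R : realType} (f : R * R -> R) :
  continuous f -> measurable_fun setT f.
Proof.
move=> cf; pose M n := @Mesh R 0 n.+1%:R^-1 1.
have M0 n : 0 < dx (M n) by rewrite invr_gt0.
pose x_ n x := xhalf (M n) (cell_index (M n) x).
have cx x : x_ n x @[n --> \oo] --> x.
  apply/cvgrPdist_le => e e0; near=> n.
  have /andP[H1 H2] := cell_index_itv (M0 n) x; rewrite xhalfD1 in H2.
  rewrite ger0_norm ?subr_ge0 // lerBlDl (le_trans (ltW H2)) // lerD2l ltW //.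
  near: n; exact: (near_infty_natSinv_lt (PosNum e0)).
apply: (@measurable_fun_cvg _ _ _ _ (fun n z => f (x_ n z.1, x_ n z.2))); last first.
  move=> [x t] _ /=; apply: continuous_cvg; first exact: cf.
  exact: (cvg_pair (cx x) (cx t)).
move=> n.
apply: (@measurable_countable_fibres _ _ _ _ _
  (fun z : R * R => (cell_index (M n) z.1, cell_index (M n) z.2))
  (fun k _ => f (xhalf (M n) k.1, xhalf (M n) k.2))) => // -[i k].
rewrite (_ : _ @^-1` _ = (cell_index (M n) @^-1` [set i]) `*` (cell_index (M n) @^-1` [set k])).
  apply: measurableX; exact: measurable_cell_index.
by apply/seteqP; split => -[x t] /= []; [move=> -> ->|move=> -> ->].
Unshelve. all: by end_near. Qed.

(** * Difference quotients of functions on the plane *)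

Section PlaneFunctions.
Context {R : realType}.
Implicit Types (f : R * R -> R) (x y s t r : R).

Lemma is_derive_ddt f x t : derivable f (x, t) (0, 1) ->
  is_derive t 1 (fun s => f (x, s)) (ddt f (x, t)).
Proof.
have E : (fun h => h^-1 *: ((f \o shift (x, t)) (h *: (0, 1)) - f (x, t))) =
    (fun h => h^-1 *: (((fun s => f (x, s)) \o shift t) (h *: (1 : R)) - f (x, t))).
  apply/funext => h /=; congr (_ *: (f _ - _)).
  by congr pair => /=; rewrite scaler0 add0r.
by rewrite /ddt /derive /derivable E => H; split => //; rewrite /derive E.
Qed.

Lemma is_derive_ddx f x t : derivable f (x, t) (1, 0) ->
  is_derive x 1 (fun y => f (y, t)) (ddx f (x, t)).
Proof.
have E : (fun h => h^-1 *: ((f \o shift (x, t)) (h *: (1, 0)) - f (x, t))) =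
    (fun h => h^-1 *: (((fun y => f (y, t)) \o shift x) (h *: (1 : R)) - f (x, t))).
  apply/funext => h /=; congr (_ *: (f _ - _)).
  by congr pair => /=; rewrite scaler0 add0r.
by rewrite /ddx /derive /derivable E => H; split => //; rewrite /derive E.
Qed.

Lemma mean_value (g dg : R -> R) a b : (forall x, is_derive x 1 g (dg x)) ->
  exists2 c, Num.min a b <= c <= Num.max a b & g b - g a = dg c * (b - a).
Proof.
move=> dG.
have cg x : {for x, continuous g}.
  by apply: differentiable_continuous; apply/derivable1_diffP; have [] := dG x.
have mvt u v : u <= v -> exists2 c, u <= c <= v & g v - g u = dg c * (v - u).
  move=> uv.
  have cuv : {within `[u, v], continuous g} by apply: continuous_subspaceT => x; exact: cg.
  have [c] := @MVT_segment _ g dg u v uv (fun x _ => dG x) cuv.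
  by rewrite in_itv /= => uc H; exists c.
have [ab|/ltW ab] := leP a b; first exact: mvt.
have [c cab H] := mvt _ _ ab; exists c => //.
by rewrite -opprB H -mulrN opprB.
Qed.

Lemma bounded_on_box f r : continuous f ->
  exists2 M, 0 <= M & forall x t, `|x| <= r -> `|t| <= r -> `|f (x, t)| <= M.
Proof.
move=> cf.
have cK : compact (`[- r, r] `*` `[- r, r] : set (R * R)).
  by apply: compact_setX; exact: segment_compact.
have [M M0 HM] := bounded_within_compact cK (continuous_subspaceT cf).
exists M => [|x t]; first exact: ltW.
move=> xr tr; apply: (HM (x, t)).
by split; rewrite /= in_itv /= -ler_norml.
Qed.

Lemma le_norm_between (a b c r : R) : Num.min a b <= c <= Num.max a b ->
  `|a| <= r -> `|b| <= r -> `|c| <= r.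
Proof.
rewrite !ler_norml ge_min le_max => /andP[/orP[] h1 /orP[] h2] /andP[h3 h4] /andP[h5 h6];
  by apply/andP; split; lra.
Qed.

Lemma dist_between (a b c : R) : Num.min a b <= c <= Num.max a b -> `|c - a| <= `|b - a|.
Proof.
have [ab|/ltW ab] := leP a b => /andP[ac cb].
  by rewrite !ger0_norm ?subr_ge0 // ?lerD2r //; lra.
by rewrite !ler0_norm ?subr_le0 //; lra.
Qed.

Lemma Cn_lipschitz f r : Cn 1 f -> exists2 L, 0 <= L &
  forall x y s t, `|x| <= r -> `|y| <= r -> `|s| <= r -> `|t| <= r ->
    `|f (x, s) - f (y, t)| <= L * (`|x - y| + `|s - t|).
Proof.
move=> [_ [dfx dft [cx _] [ct _]]].
have [L L0 HL] := bounded_on_box r cx; have [M M0 HM] := bounded_on_box r ct.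
exists (L + M); first exact: addr_ge0.
move=> x y s t xr yr sr tr.
have [c c1 ce] := mean_value y x (fun x => is_derive_ddx (dfx (x, s))).
have [e e1 ee] := mean_value t s (fun t => is_derive_ddt (dft (y, t))).
have -> : f (x, s) - f (y, t) = (f (x, s) - f (y, s)) + (f (y, s) - f (y, t)) by ring.
rewrite ce ee (le_trans (ler_normD _ _)) // !normrM.
have H1 : `|ddx f (c, s)| <= L by apply: HL => //; exact: le_norm_between c1 _ _.
have H2 : `|ddt f (y, e)| <= M by apply: HM => //; exact: le_norm_between e1 _ _.
move: H1 H2 (normr_ge0 (x - y)) (normr_ge0 (s - t)); set p := `|x - y|; set q := `|s - t|.
move=> H1 H2 p0 q0.
have := ler_wpM2r p0 H1; have := ler_wpM2r q0 H2.
have := mulr_ge0 L0 q0; have := mulr_ge0 M0 p0; lra.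
Qed.

(** By the mean value theorem the quotient is a value of [ddt f] at an intermediate time, and
    [ddt f] is Lipschitz on the box because f is C^2. *)
Lemma difference_quotient_t f r : Cn 2 f -> exists2 L, 0 <= L &
  forall x y s t de, `|x| <= r -> `|y| <= r -> `|s| <= r -> `|t| <= r -> `|t + de| <= r ->
    0 < de ->
    `|(f (x, t + de) - f (x, t)) / de - ddt f (y, s)| <= L * (`|x - y| + `|t - s| + de).
Proof.
move=> [_ [_ dft _ Ct]]; have [L L0 HL] := Cn_lipschitz r Ct.
exists L => // x y s t de xr yr sr tr tdr de0.
have [c c1 ce] := mean_value t (t + de) (fun t => is_derive_ddt (dft (x, t))).
rewrite ce addrAC subrr add0r mulfK ?gt_eqF //.
apply: (le_trans (HL _ _ _ _ _ _ _ _)) => //; first exact: le_norm_between c1 _ _.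
apply: ler_wpM2l => //; rewrite -addrA lerD2l.
have := dist_between c1; rewrite addrAC subrr add0r (gtr0_norm de0) => H.
have -> : c - s = (c - t) + (t - s) by ring.
by rewrite addrC (le_trans (ler_normD _ _)) // lerD2r.
Qed.

Lemma difference_quotient_x f r : Cn 2 f -> exists2 L, 0 <= L &
  forall x y s t de, `|x| <= r -> `|y| <= r -> `|s| <= r -> `|t| <= r -> `|x + de| <= r ->
    0 < de ->
    `|(f (x + de, t) - f (x, t)) / de - ddx f (y, s)| <= L * (`|x - y| + `|t - s| + de).
Proof.
move=> [_ [dfx _ Cx _]]; have [L L0 HL] := Cn_lipschitz r Cx.
exists L => // x y s t de xr yr sr tr tdr de0.
have [c c1 ce] := mean_value x (x + de) (fun x => is_derive_ddx (dfx (x, t))).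
rewrite ce addrAC subrr add0r mulfK ?gt_eqF //.
apply: (le_trans (HL _ _ _ _ _ _ _ _)) => //; first exact: le_norm_between c1 _ _.
apply: ler_wpM2l => //; rewrite addrAC lerD2r.
have := dist_between c1; rewrite addrAC subrr add0r (gtr0_norm de0) => H.
have -> : c - y = (c - x) + (x - y) by ring.
by rewrite (le_trans (ler_normD _ _)) // [leRHS]addrC lerD2r.
Qed.

Lemma ddx_supp f r x t : (forall x t, 0 <= t -> r < `|x| \/ r < t -> f (x, t) = 0) ->
  derivable f (x, t) (1, 0) -> 0 <= t -> r < `|x| \/ r < t -> ddx f (x, t) = 0.
Proof.
move=> supp df t0 rxt; have := is_derive_ddx df => /@derive_val <-.
rewrite -(derive_cst (0 : R) x 1); apply: near_eq_derive.
case: rxt => [rx|rt]; last by near=> y; apply: supp => //; right.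
near=> y; apply: supp => //; left; near: y.
exact: (cvgr_gt _ (@norm_continuous _ _ x)).
Unshelve. all: by end_near. Qed.

(** Positivity of [t] makes all neighbouring times nonnegative, where the support condition
    applies. *)
Lemma ddt_supp f r x t : (forall x t, 0 <= t -> r < `|x| \/ r < t -> f (x, t) = 0) ->
  derivable f (x, t) (0, 1) -> 0 < t -> r < `|x| \/ r < t -> ddt f (x, t) = 0.
Proof.
move=> supp df t0 rxt; have := is_derive_ddt df => /@derive_val <-.
rewrite -(derive_cst (0 : R) t 1); apply: near_eq_derive.
case: rxt => [rx|rt]; near=> s.
  by apply: supp; [apply: ltW; near: s; exact: lt_nbhsr|left].
by apply: supp; [apply: ltW|right]; near: s; exact: lt_nbhsr.
Unshelve. all: by end_near. Qed.

End PlaneFunctions.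

(** * Summation by parts *)

Section SummationByParts.
Context {R : realType}.
Implicit Types (b a g F phi : nat -> R) (P N k : nat).

Lemma sum_by_parts phi F P : phi 0%N = 0 -> phi P = 0 ->
  \sum_(p < P) phi p * (F p.+1 - F p) = - \sum_(p < P) (phi p.+1 - phi p) * F p.+1.
Proof.
move=> phi0 phiP; apply/eqP; rewrite -subr_eq0 opprK -big_split /=.
rewrite (eq_bigr (fun p : 'I_P => phi p.+1 * F p.+1 - phi p * F p)); last by move=> p _; ring.
by rewrite -(big_mkord xpredT (fun p => phi p.+1 * F p.+1 - phi p * F p))
  telescope_sumr // phi0 phiP !mul0r subrr.
Qed.

(** The subtraction n - k is truncated at 0 for n < k; those terms are killed by [g], as are the
    terms that the shift moves beyond N. *)
Lemma sum_shift g a k N : (forall n, (n < k)%N || (N <= n)%N -> g n = 0) ->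
  \sum_(n < N) g n * a (n - k)%N = \sum_(n < N) g (n + k)%N * a n.
Proof.
move=> g0; rewrite -!(big_mkord xpredT (fun n => g n * a (n - k)%N)).
have E : \sum_(0 <= n < N) g n * a (n - k)%N = \sum_(0 <= n < N + k) g n * a (n - k)%N.
  rewrite [RHS](@big_cat_nat _ _ _ N) ?leq_addr //= -[LHS]addr0; congr (_ + _).
  by rewrite big_nat_cond big1 // => n /andP[/andP[Nn _] _]; rewrite g0 ?Nn ?orbT ?mul0r.
rewrite E (@big_cat_nat _ _ _ k) ?leq_addl //= big_nat_cond big1 ?add0r; last first.
  by move=> n /andP[/andP[_ nk] _]; rewrite g0 ?nk ?mul0r.
rewrite -{1}[k]add0n big_addn addnK big_mkord; apply: eq_bigr => n _.
by rewrite addnK.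
Qed.

(** The boundary term collects the starting levels n < ms whose shift n + k is a level at which the
    inequality holds. *)
Lemma sum_parts_time phi a k ms N : (k <= ms)%N -> (ms <= N)%N ->
  (forall n, (N <= n)%N -> phi n = 0) ->
  \sum_(n < N) (ms <= n)%N%:R * phi n * (a (n - k)%N - a n) =
  \sum_(n < N) a n * ((ms <= n)%N%:R * (phi (n + k)%N - phi n))
  + \sum_(n < ms) (ms <= n + k)%N%:R * (a n * phi (n + k)%N).
Proof.
move=> kms msN phi0.
have s1 := @sum_shift (fun n => (ms <= n)%N%:R * phi n) a k N.
under eq_bigr do rewrite mulrBr.
rewrite sumrB s1 => [|n /orP[nk|Nn]]; last first.
- by rewrite phi0 ?mulr0.
- by rewrite leqNgt (leq_trans nk kms) mul0r.
rewrite (big_ord_widen_cond N xpredT (fun n => (ms <= n + k)%N%:R * (a n * phi (n + k)%N))) //=.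
rewrite [X in _ = _ + X]big_mkcond /= -big_split /= -sumrB; apply: eq_bigr => n _.
have [mn|mn] := leqP ms n; last by rewrite !mul0r; ring.
by rewrite (leq_trans mn (leq_addr _ _)); ring.
Qed.

Section DiscreteInequality.
Variables (ms P N : nat) (alpha beta : 'I_ms -> R) (h tau : R).
Variables (phi eta : nat -> nat -> R) (F : 'I_ms -> nat -> nat -> R).
Hypotheses (h0 : 0 < h) (tau0 : 0 < tau) (sum_alpha : \sum_l alpha l = 1).
Hypotheses (msN : (ms <= N)%N) (phi_ge0 : forall p n, 0 <= phi p n).
Hypotheses (phi_left : forall n, phi 0%N n = 0) (phi_right : forall n, phi P n = 0).
Hypothesis phi_late : forall p n, (N <= n)%N -> phi p n = 0.
Hypothesis cell_ineq : forall p n, (ms <= n)%N ->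
  eta p n <= \sum_l (alpha l * eta p (n - l.+1)%N
    - beta l * (tau / h) * (F l p.+1 (n - l.+1)%N - F l p (n - l.+1)%N)).

Lemma sum_parts_space l :
  \sum_(p < P) \sum_(n < N) (ms <= n)%N%:R * phi p n * (F l p.+1 (n - l.+1)%N - F l p (n - l.+1)%N)
  = - \sum_(p < P) \sum_(n < N)
      ((ms <= n + l.+1)%N%:R * F l p.+1 n) * (phi p.+1 (n + l.+1)%N - phi p (n + l.+1)%N).
Proof.
rewrite (eq_bigr (fun p : 'I_P => \sum_(n < N)
    (ms <= n + l.+1)%N%:R * phi p (n + l.+1)%N * (F l p.+1 n - F l p n))); last first.
  move=> p _.
  rewrite (sum_shift (g := fun n => (ms <= n)%N%:R * phi p n) (fun n => F l p.+1 n - F l p n)) //.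
  move=> n /orP[nl|Nn]; last by rewrite phi_late // mulr0.
  by rewrite leqNgt (leq_trans nl (ltn_ord l)) mul0r.
rewrite exchange_big [in RHS]exchange_big /= -sumrN; apply: eq_bigr => n _.
have := @sum_by_parts (fun p => (ms <= n + l.+1)%N%:R * phi p (n + l.+1)%N) (fun p => F l p n) P.
rewrite phi_left phi_right mulr0 => -> //; congr (- _); apply: eq_bigr => p _; ring.
Qed.

(** The cell inequality is multiplied by h phi >= 0 and summed over cells and levels n >= ms. As the
    [alpha l] sum to 1, [eta p n] can be distributed over [l], which produces time differences for
    each [l] separately. *)
Lemma discrete_weak_inequality :
  0 <= \sum_l
    (alpha l * (\sum_(p < P) \sum_(n < N) h * tau *
         (eta p n * ((ms <= n)%N%:R * ((phi p (n + l.+1)%N - phi p n) / tau)))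
       + \sum_(n < ms) (ms <= n + l.+1)%N%:R * \sum_(p < P) h * (eta p n * phi p (n + l.+1)%N))
     + beta l * \sum_(p < P) \sum_(n < N) h * tau *
         (((ms <= n + l.+1)%N%:R * F l p.+1 n)
          * ((phi p.+1 (n + l.+1)%N - phi p (n + l.+1)%N) / h))).
Proof.
have hn0 : h != 0 by rewrite gt_eqF.
have tn0 : tau != 0 by rewrite gt_eqF.
have H : 0 <= \sum_(p < P) \sum_(n < N) h * ((ms <= n)%N%:R * phi p n *
   (\sum_l (alpha l * eta p (n - l.+1)%N
    - beta l * (tau / h) * (F l p.+1 (n - l.+1)%N - F l p (n - l.+1)%N)) - eta p n)).
  apply: sumr_ge0 => p _; apply: sumr_ge0 => n _; apply: mulr_ge0; first exact: ltW.
  have [mn|mn] := leqP ms n; last by rewrite !mul0r.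
  by rewrite mul1r mulr_ge0 // subr_ge0 cell_ineq.
apply: (le_trans H); rewrite le_eqVlt; apply/orP; left; apply/eqP.
rewrite (eq_bigr (fun p : 'I_P => \sum_l \sum_(n < N) (h * alpha l *
     ((ms <= n)%N%:R * phi p n * (eta p (n - l.+1)%N - eta p n))
     - beta l * tau * ((ms <= n)%N%:R * phi p n *
         (F l p.+1 (n - l.+1)%N - F l p (n - l.+1)%N))))); last first.
  move=> p _; rewrite exchange_big /=; apply: eq_bigr => n _.
  rewrite -[X in _ - X]mul1r -sum_alpha mulr_suml -sumrB !mulr_sumr; apply: eq_bigr => l _.
  by field.
rewrite exchange_big /=; apply: eq_bigr => l _.
under eq_bigr do rewrite sumrB.
rewrite sumrB; congr (_ + _).
  rewrite (eq_bigr (fun p : 'I_P => h * alpha l *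
      \sum_(n < N) (ms <= n)%N%:R * phi p n * (eta p (n - l.+1)%N - eta p n))); last first.
    by move=> p _; rewrite mulr_sumr.
  rewrite -mulr_sumr (eq_bigr _ (fun (p : 'I_P) _ =>
    sum_parts_time (eta p) (ltn_ord l) msN (@phi_late p))).
  rewrite big_split /= mulrDr [in RHS]mulrDr; congr (_ + _).
    rewrite !mulr_sumr; apply: eq_bigr => p _; rewrite !mulr_sumr; apply: eq_bigr => n _.
    by field.
  rewrite exchange_big !mulr_sumr; apply: eq_bigr => n _; rewrite !mulr_sumr; apply: eq_bigr => p _.
  by ring.
rewrite (eq_bigr (fun p : 'I_P => beta l * tau *
    \sum_(n < N) (ms <= n)%N%:R * phi p n *
      (F l p.+1 (n - l.+1)%N - F l p (n - l.+1)%N))); last first.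
  by move=> p _; rewrite mulr_sumr.
rewrite -mulr_sumr sum_parts_space.
rewrite mulrN opprK !mulr_sumr; apply: eq_bigr => p _; rewrite !mulr_sumr; apply: eq_bigr => n _.
by field.
Qed.

End DiscreteInequality.
End SummationByParts.

Section Coefficients.
Context {R : realType} (ms : nat) (alpha beta : 'I_ms -> R).

(** The indices counted are the last l + 1 starting levels. *)
Lemma sum_ord_geq (l : 'I_ms) : \sum_(n < ms) ((ms <= n + l.+1)%N%:R : R) = l.+1%:R.
Proof.
rewrite -natr_sum; congr (_%:R).
rewrite (reindex_inj rev_ord_inj) /=.
rewrite (eq_bigr (fun n : 'I_ms => (n < l.+1)%N : nat)); last first.
  by move=> n _; congr nat_of_bool; have := ltn_ord n; lia.
rewrite -big_mkcond /= -(big_ord_widen ms (fun=> 1%N)) ?sum1_card ?card_ord //.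
Qed.

(** This is exactness on the polynomial X, whose value at the new level 0 is 0. *)
Lemma ssp_sum_beta r : (1 <= r)%N -> ssp_multistep r alpha beta ->
  \sum_l beta l = \sum_l alpha l * l.+1%:R.
Proof.
move=> r1 [_ _ /(_ 'X)]; rewrite size_polyX ltnS => /(_ r1).
rewrite hornerX derivX; under eq_bigr do rewrite hornerX hornerC mulr1 mulrN.
by rewrite big_split /= sumrN addrC => /esym/eqP; rewrite subr_eq0 => /eqP.
Qed.

Lemma method_coefficients r : (1 <= r)%N ->
  forward_euler alpha beta \/ ssp_multistep r alpha beta ->
  [/\ forall l, 0 <= alpha l, \sum_l alpha l = 1,
      \sum_l beta l = \sum_l alpha l * l.+1%:R & 1 <= \sum_l alpha l * l.+1%:R].
Proof.
move=> r1 H.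
have [a0 a1 b1] : [/\ forall l, 0 <= alpha l, \sum_l alpha l = 1 &
    \sum_l beta l = \sum_l alpha l * l.+1%:R].
  case: H => [[ms1 a1 b1]|]; last by move=> H; split; [case: H..|exact: ssp_sum_beta H].
  split => [l||]; first by rewrite a1.
    by under eq_bigr do rewrite a1; rewrite sumr_const card_ord ms1.
  apply: eq_bigr => l _; rewrite a1 b1 mul1r; have := ltn_ord l.
  by rewrite [X in (_ < X)%N]ms1 ltnS leqn0 => /eqP ->.
split => //; rewrite -{1}a1; apply: ler_sum => l _.
by rewrite ler_peMr // ler1n.
Qed.

End Coefficients.

(** * Local variation and pointwise errors *)

Section Quadrature.
Context {R : realType} (N : nat) (node weight : 'I_N -> R).
Hypothesis hquad : gauss_lobatto node weight.

Lemma sum_weight : \sum_q weight q = 1.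
Proof.
have [N2 _ _ _ /(_ 1)] := hquad; rewrite size_poly1 => H.
have n1 : (1 <= 2 * N - 2)%N by lia.
have {H} := H n1.
under eq_bigr do rewrite hornerC mulr1.
move=> ->; under eq_Rintegral do rewrite hornerC.
rewrite Rintegral_cst //.
have mu2 : @lebesgue_measure R `[-1, 1] = 2%:E.
  rewrite lebesgue_measure_itv /= lte_fin ifT; last by lra.
  by rewrite opprK -EFinD; congr EFin; ring.
by apply: (eq_trans (congr1 (fun z => 2^-1 * (1 * fine z)) mu2)); rewrite /= mul1r mulVf.
Qed.

Lemma node_itv q : -1 <= node q <= 1.
Proof.
have [N2 lt_node n0 n1 _] := hquad.
have N0 : (0 < N)%N by exact: leq_trans N2.
have N1 : (N.-1 < N)%N by rewrite prednK.
apply/andP; split.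
  have [q0|q0] := posnP q; first by rewrite n0.
  by rewrite -(n0 (Ordinal N0) erefl) ltW // lt_node.
have [q1|q1] := eqVneq (val q) N.-1; first by rewrite n1.
rewrite -(n1 (Ordinal N1) erefl) ltW // lt_node //= ltn_neqAle q1 /=.
by rewrite -ltnS prednK.
Qed.

End Quadrature.

Section Variation.
Context {R : realType} {d : nat} (K : set (state R d)).
Hypotheses (cK : compact K) (KG : K `<=` admissible).
Variables (m : mesh R) (u : pwpoly R d).
Hypotheses (h0 : 0 < dx m) (uK : forall i x, cell m i x -> K (peval (u i) x)).

(** [max_variation] is a [sup], an upper bound only for a set that is bounded; compactness of K
    provides this. *)
Lemma max_variation_ub i i' x : i' \in [:: i - 1; i; i + 1] -> cell m i' x ->
  enorm (peval (u i') x - peval (u i) (xcenter m i)) <= max_variation m u i.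
Proof.
move=> ii' xi'; apply: sup_upper_bound; last by exists i', x.
split; first by exists (enorm (peval (u i') x - peval (u i) (xcenter m i))), i', x.
have [M M0 HM] := bounded_within_compact cK (continuous_subspaceT (@norm_continuous _ _)).
exists ((1 + (d.+1 + (1 + d.+1)))%:R * (M + M)) => _ [k [y [ik yk ->]]].
apply: (le_trans (enorm_le _)); apply: ler_wpM2l => //.
apply: (le_trans (ler_normB _ _)); apply: lerD.
  by rewrite -normr_id; apply: HM; exact: uK.
by rewrite -normr_id; apply: HM; apply: uK; exact: xcenter_cell.
Qed.

Lemma max_variation_ge0 i : 0 <= max_variation m u i.
Proof.
apply: le_trans (max_variation_ub _ (xcenter_cell h0 i)); first exact: sqrtr_ge0.
by rewrite !inE eqxx orbT.
Qed.

Lemma max_variation_dist i i' i'' x y :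
  i' \in [:: i - 1; i; i + 1] -> i'' \in [:: i - 1; i; i + 1] ->
  cell m i' x -> cell m i'' y ->
  `|peval (u i') x - peval (u i'') y| <= 2 * max_variation m u i.
Proof.
move=> H1 H2 xi yi.
have -> : peval (u i') x - peval (u i'') y =
   (peval (u i') x - peval (u i) (xcenter m i)) - (peval (u i'') y - peval (u i) (xcenter m i)).
  by rewrite opprB addrA subrK.
rewrite mulr2n mulrDl mul1r (le_trans (ler_normB _ _)) // lerD //;
  by apply: le_trans (norm_le_enorm _) _; exact: max_variation_ub.
Qed.

End Variation.

Section Traces.
Context {R : realType} (m : mesh R) (h0 : 0 < dx m).

Lemma xhalf_cell_left i : cell m i (xhalf m i).
Proof. by rewrite /cell /= in_itv /= lexx xhalfD1 // lerDl ltW. Qed.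

Lemma xhalf_cell_right i : cell m i (xhalf m (i + 1)).
Proof. by rewrite /cell /= in_itv /= lexx xhalfD1 // lerDl ltW. Qed.

Lemma node_cell i (s : R) : -1 <= s <= 1 -> cell m i (xcenter m i + dx m / 2 * s).
Proof.
move=> /andP[s1 s2]; rewrite /cell /= in_itv /= xhalfD1 /xcenter; move: h0; set h := dx m => hp.
have := ler_wpM2l (ltW hp) s1; have := ler_wpM2l (ltW hp) s2.
rewrite mulrAC mulr1 mulrN mulr1; lra.
Qed.

End Traces.

Section PointwiseErrors.
Context {R : realType} {d : nat} (K : set (state R d)).
Hypotheses (cK : compact K) (KG : K `<=` admissible).
Variables (N : nat) (node weight : 'I_N -> R).
Hypothesis hquad : gauss_lobatto node weight.

(** The weights sum to 1, so the reference value can be averaged with the same weights; each node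
    lies in the cell, and its state differs from that at [x] by at most twice the local
    variation. *)
Lemma cell_entropy_error : exists2 C : R, 0 <= C &
  forall (m : mesh R) (u : pwpoly R d) i x w, 0 < dx m ->
    (forall i x, cell m i x -> K (peval (u i) x)) -> cell m i x -> K w ->
    `|cell_entropy m node weight u i - entropy w|
      <= C * (max_variation m u i + enorm (peval (u i) x - w)).
Proof.
have [L L0 HL] := C1_lipschitz1 cK KG (@isC1_entropy R d).
pose W := \sum_q `|weight q|.
have W0 : 0 <= W by apply: sumr_ge0.
exists (W * L * 2); first by rewrite !mulr_ge0 // ltW.
move=> m u i x w h0 uK xi Kw.
have V0 := max_variation_ge0 cK h0 uK i.
set V := max_variation m u i in V0 *.
have -> : entropy w = \sum_q weight q * entropy w.
  by rewrite -mulr_suml (sum_weight hquad) mul1r.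
rewrite /cell_entropy -sumrB.
apply: (le_trans (ler_norm_sum _ _ _)).
rewrite -2!mulrA [leRHS]mulr_suml; apply: ler_sum => q _.
rewrite -mulrBr normrM; apply: ler_wpM2l => //.
have ci := node_cell h0 i (node_itv hquad q).
set y := xcenter m i + _ in ci *.
rewrite -mulrA; apply: le_trans (HL _ _ Kw (uK _ _ ci)) _; apply: ler_wpM2l; first exact: ltW.
have -> : peval (u i) y - w = (peval (u i) y - peval (u i) x) + (peval (u i) x - w).
  by rewrite addrA subrK.
apply: (le_trans (ler_normD _ _)); rewrite mulrDr lerD //.
  by apply: (max_variation_dist cK h0 uK) => //; rewrite !inE eqxx orbT.
apply: (le_trans (norm_le_enorm _)); rewrite ler_peMl ?sqrtr_ge0 //; lra.
Qed.

Variables (Psi : R -> state R d -> state R d -> state R d) (hPsi : prescribed_path Psi).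

(** The traces at the right interface belong to the cells i and i + 1, both in B_i, so the variation
    around the single index [i] controls them. The operator is assumed to exist because it carries
    the strict order of the wave speeds. *)
Lemma entropy_flux_error : exists2 C : R, 0 <= C &
  forall (m : mesh R) (u L : pwpoly R d) (b : R) k i x w, 0 < dx m ->
    (forall i x, cell m i x -> K (peval (u i) x)) -> cell m i x -> K w ->
    spatial_operator m Psi k b u L ->
    `|entropy_flux m Psi b u i - mhd_eflux w|
      <= C * (max_variation m u i + enorm (peval (u i) x - w)).
Proof.
have [C C0 HC] := hll_eflux_consistent hPsi cK KG.
(* Each of the two traces contributes twice the variation and once the distance at [x]. *)
exists (C * 4); first by rewrite mulr_ge0.
move=> m u L b k i x w h0 uK xi Kw opL.
have V0 := max_variation_ge0 cK h0 uK i.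
have KUm : K (Um m u i) by apply: uK; exact: xhalf_cell_right.
have KUp : K (Up m u i) by apply: uK; exact: xhalf_cell_left.
have HUm : `|Um m u i - w| <= 2 * max_variation m u i + enorm (peval (u i) x - w).
  have -> : Um m u i - w = (Um m u i - peval (u i) x) + (peval (u i) x - w).
    by rewrite addrA subrK.
  apply: (le_trans (ler_normD _ _)); rewrite lerD ?norm_le_enorm //.
  apply: (max_variation_dist cK h0 uK) => //; rewrite ?inE ?eqxx ?orbT //.
  exact: xhalf_cell_right.
have HUp : `|Up m u i - w| <= 2 * max_variation m u i + enorm (peval (u i) x - w).
  have -> : Up m u i - w = (Up m u i - peval (u i) x) + (peval (u i) x - w).
    by rewrite addrA subrK.
  apply: (le_trans (ler_normD _ _)); rewrite lerD ?norm_le_enorm //.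
  apply: (max_variation_dist cK h0 uK) => //; rewrite ?inE ?eqxx ?orbT //.
  exact: xhalf_cell_left.
have HE : forall e : R, `|e - mhd_eflux w| <= C * (`|Um m u i - w| + `|Up m u i - w|) ->
    `|e - mhd_eflux w| <= C * 4 * (max_variation m u i + enorm (peval (u i) x - w)).
  move=> e /le_trans -> //; rewrite -mulrA; apply: ler_wpM2l => //.
  apply: (le_trans (lerD HUm HUp)).
  have := sqrtr_ge0 (dotv (peval (u i) x - w) (peval (u i) x - w)); rewrite -/(enorm _).
  by move: (max_variation _ _ _) (enorm _) => p q; lra.
apply: HE; move: opL; rewrite /spatial_operator /entropy_flux.
case: ifP => _ [/(_ i)] + _ _; rewrite ?opp_mhd_scaled ?mhd_scaled => lt_S.
  by have := HC (-1) _ _ _ (normrN1 _) KUm KUp Kw lt_S; rewrite mulN1r.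
by have := HC 1 _ _ _ (normr1 _) KUm KUp Kw lt_S; rewrite mul1r.
Qed.

End PointwiseErrors.

Local Notation mu1 R := (@lebesgue_measure R).
Local Notation mu2 R := (@lebesgue_measure R \x @lebesgue_measure R)%E.

Section Intervals.
Context {R : realType}.
Implicit Types x y : R.

Lemma lebesgue_measure_cc x y : x <= y -> mu1 R `[x, y] = (y - x)%:E.
Proof.
move=> xy; rewrite lebesgue_measure_itv /= lte_fin; case: ifPn => [_|].
  by rewrite -EFinD.
by rewrite -leNgt => yx; rewrite (le_anti (introT andP (conj xy yx))) subrr.
Qed.

Lemma lebesgue_measure_co x y : x <= y -> mu1 R `[x, y[ = (y - x)%:E.
Proof.
move=> xy; rewrite lebesgue_measure_itv /= lte_fin; case: ifPn => [_|].
  by rewrite -EFinD.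
by rewrite -leNgt => yx; rewrite (le_anti (introT andP (conj xy yx))) subrr.
Qed.

Lemma lebesgue_measure2_co x y s t : x <= y -> s <= t ->
  mu2 R ((`[x, y[%classic : set (measurableTypeR R))
         `*` (`[s, t[%classic : set (measurableTypeR R)))
    = ((y - x) * (t - s))%:E.
Proof.
move=> xy st; rewrite product_measure1E; [|exact: measurable_itv|exact: measurable_itv].
by rewrite EFinM -(lebesgue_measure_co xy) -(lebesgue_measure_co st).
Qed.

End Intervals.

Definition segment {R : realType} (a : R) : set (measurableTypeR R) := `[- a, a]%classic.

Definition box {R : realType} (a : R) : set (measurableTypeR R * measurableTypeR R) :=
  segment a `*` `[0 : R, a]%classic.

(** * Integrals over a space-time box as sums over cells *)

Section BoxSums.
Context {R : realType} (m : mesh R) (a : R) (ms : nat).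
Hypotheses (h0 : 0 < dx m) (t0 : 0 < dt m) (a0 : 0 < a).

Definition first_cell : int := cell_index m (- a).
Definition num_cells : nat := `|cell_index m a - first_cell|%N.+1.
(** The additional [ms] levels guarantee [ms <= num_levels], as the summation by parts in time
    requires. *)
Definition num_levels : nat := (time_index m a + ms).+1.

Local Notation i0 := first_cell.
Local Notation P := num_cells.
Local Notation N := num_levels.

Local Notation segment := (segment a).
Local Notation box := (box a).

Lemma cell_index_range x : segment x -> exists p : 'I_P, cell_index m x = i0 + p%:Z.
Proof.
rewrite /segment /= in_itv /= => /andP[ax xa].
have l1 : i0 <= cell_index m x by exact: cell_index_le.
have l2 : cell_index m x <= cell_index m a by exact: cell_index_le.
have lt_p : (`|(cell_index m x - i0)|%N < P)%N by rewrite /P; lia.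
by exists (Ordinal lt_p) => /=; lia.
Qed.

Lemma time_index_range t : 0 <= t <= a -> (time_index m t < N)%N.
Proof.
move=> /andP[t1 ta]; rewrite ltnS (leq_trans _ (leq_addr _ _)) //.
by apply: le_truncn; rewrite ler_pM2r ?invr_gt0.
Qed.

Definition mesh_idx (k : 'I_P * 'I_N) : int * nat := (i0 + (k.1 : nat)%:Z, k.2 : nat).

Lemma mesh_index_range z : box z -> exists k, mesh_index m z = mesh_idx k.
Proof.
case: z => x t [/cell_index_range [p px]] /=; rewrite in_itv /= => /time_index_range tN.
by exists (p, Ordinal tN); rewrite /mesh_index /= px.
Qed.

Lemma mesh_idx_inj : injective mesh_idx.
Proof.
move=> [p n] [p' n'] [] /= /addrI [pp nn]; congr pair; exact: val_inj.
Qed.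

Lemma cell_idx_inj : injective (fun p : 'I_P => i0 + (p : nat)%:Z).
Proof. by move=> p p' /= /addrI [pp]; exact: val_inj. Qed.

Lemma boxP x t : box (x, t) <-> (- a <= x <= a) /\ (0 <= t <= a).
Proof. by rewrite /box /segment /= !in_itv. Qed.

Lemma measurable_segment : measurable segment.
Proof. exact: measurable_itv. Qed.

Lemma measurable_box : measurable box.
Proof. by apply: measurableX; [exact: measurable_segment|exact: measurable_itv]. Qed.

Lemma segment_measure : mu1 R segment = (2 * a)%:E.
Proof.
apply: (eq_trans (lebesgue_measure_cc _)); last by congr EFin; rewrite opprK mulr2n mulrDl mul1r.
by rewrite ge0_cp // ltW.
Qed.

Lemma box_measure : mu2 R box = (2 * a * a)%:E.
Proof.
rewrite product_measure1E; [|exact: measurable_segment|exact: measurable_itv].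
rewrite (EFinM (2 * a)) -segment_measure; congr (_ * _)%E.
by apply: (eq_trans (lebesgue_measure_cc (ltW a0))); rewrite subr0.
Qed.

Lemma segment_lty : (mu1 R segment < +oo)%E.
Proof. by rewrite segment_measure ltry. Qed.

Lemma box_lty : (mu2 R box < +oo)%E.
Proof. by rewrite box_measure ltry. Qed.

Lemma measurable_segment_piece i : measurable (segment `&` cell_index m @^-1` [set i]).
Proof. by apply: measurableI; [exact: measurable_segment|exact: measurable_cell_index]. Qed.

Lemma measurable_box_piece k : measurable (box `&` mesh_index m @^-1` [set k]).
Proof. by apply: measurableI; [exact: measurable_box|exact: measurable_mesh_index]. Qed.

Lemma segment_piece_measure i :
  (mu1 R (segment `&` cell_index m @^-1` [set i]) <= (dx m)%:E)%E.
Proof.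
apply: (@le_trans _ _ (mu1 R (cell_index m @^-1` [set i]))).
  apply: le_measure; rewrite ?inE //; first exact: measurable_segment_piece.
  exact: measurable_cell_index.
rewrite cell_index_fibre // lebesgue_measure_co xhalfD1; last by rewrite lerDl ltW.
by rewrite addrAC subrr add0r.
Qed.

(** Cells cut by the ends of the segment have smaller pieces. The exact value is used on the cells
    where the test function does not vanish, which lie inside once the mesh is fine. *)
Lemma segment_piece_measureE i : - a <= xhalf m i -> xhalf m (i + 1) <= a ->
  mu1 R (segment `&` cell_index m @^-1` [set i]) = (dx m)%:E.
Proof.
move=> H1 H2; rewrite setIidr cell_index_fibre //.
  by rewrite lebesgue_measure_co xhalfD1 ?lerDl ?ltW // addrAC subrr add0r.
move=> x; rewrite /segment /= !in_itv /= => /andP[x1 x2].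
by rewrite (le_trans H1 x1) (le_trans (ltW x2) H2).
Qed.

Lemma box_piece_measure_le k :
  (mu2 R (box `&` mesh_index m @^-1` [set k]) <= (dx m * dt m)%:E)%E.
Proof.
pose B : set (measurableTypeR R * measurableTypeR R) :=
  (`[xhalf m k.1, xhalf m (k.1 + 1)[%classic : set (measurableTypeR R))
  `*` (`[k.2%:R * dt m, k.2.+1%:R * dt m[%classic : set (measurableTypeR R)).
apply: (@le_trans _ _ (mu2 R B)).
  apply: le_measure; rewrite ?inE.
  - exact: measurable_box_piece.
  - by apply: measurableX; exact: measurable_itv.
  move=> [x t] [/boxP [_ /andP[t1 _]] E].
  have {}E : mesh_index m (x, t) = k := E; rewrite /B -E.
  by split; rewrite /= in_itv /=; [exact: cell_index_itv|exact: time_index_itv].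
rewrite lebesgue_measure2_co; last 2 first.
- by rewrite xhalfD1 lerDl ltW.
- by rewrite ler_pM2r // ler_nat.
rewrite lee_fin xhalfD1 -mulrBl -natrB // subSnn mul1r.
by rewrite addrAC subrr add0r.
Qed.

Lemma box_piece_measureE k : - a <= xhalf m k.1 -> xhalf m (k.1 + 1) <= a ->
  k.2.+1%:R * dt m <= a ->
  mu2 R (box `&` mesh_index m @^-1` [set k]) = (dx m * dt m)%:E.
Proof.
move=> H1 H2 H3.
pose B : set (measurableTypeR R * measurableTypeR R) :=
  (`[xhalf m k.1, xhalf m (k.1 + 1)[%classic : set (measurableTypeR R))
  `*` (`[k.2%:R * dt m, k.2.+1%:R * dt m[%classic : set (measurableTypeR R)).
have -> : box `&` mesh_index m @^-1` [set k] = B.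
  apply/seteqP; split => -[x t].
    move=> [/boxP [_ /andP[t1 _]] E].
    have {}E : mesh_index m (x, t) = k := E; rewrite /B -E.
    by split; rewrite /= in_itv /=; [exact: cell_index_itv|exact: time_index_itv].
  rewrite /B /= !in_itv /= -cell_index_eq // => -[/[dup] /eqP xk].
  rewrite cell_index_eq // => /andP[x1 x2] /[dup] tk /andP[t1 t2].
  have tp : 0 <= t by apply: le_trans t1; rewrite mulr_ge0 // ltW.
  split; first apply/boxP.
    by rewrite (le_trans H1 x1) (le_trans (ltW x2) H2) tp (le_trans (ltW t2) H3).
  by rewrite /mesh_index /= xk; move: tk; rewrite -time_index_eq // => /eqP ->; case: (k).
rewrite lebesgue_measure2_co; last 2 first.
- by rewrite xhalfD1 lerDl ltW.
- by rewrite ler_pM2r // ler_nat.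
rewrite xhalfD1 -mulrBl -natrB // subSnn mul1r.
by rewrite addrAC subrr add0r.
Qed.

Lemma integrable_segment_step (G : int -> R) :
  (mu1 R).-integrable segment (EFin \o (fun x => G (cell_index m x))).
Proof.
apply: (@integrable_step _ _ _ (mu1 R) segment measurable_segment segment_lty
  _ _ _ _ cell_idx_inj) => //.
  exact: cell_index_range.
by move=> p; exact: measurable_segment_piece.
Qed.

Lemma Rintegral_segment_step (G : int -> R) :
  (forall p : 'I_P, G (i0 + (p : nat)%:Z) != 0 ->
     - a <= xhalf m (i0 + (p : nat)%:Z) /\ xhalf m (i0 + (p : nat)%:Z + 1) <= a) ->
  Rintegral (mu1 R) segment (fun x => G (cell_index m x)) =
    \sum_(p < P) dx m * G (i0 + (p : nat)%:Z).
Proof.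
move=> G0; rewrite (@Rintegral_step _ _ _ (mu1 R) segment measurable_segment segment_lty
  _ _ _ _ cell_idx_inj) //.
- apply: eq_bigr => p _; have [->|/G0 [H1 H2]] := eqVneq (G (i0 + (p : nat)%:Z)) 0.
    by rewrite mul0r mulr0.
  transitivity (G (i0 + (p : nat)%:Z) * dx m); last exact: mulrC.
  by congr (_ * _); exact: (congr1 fine (segment_piece_measureE H1 H2)).
- exact: cell_index_range.
by move=> p; exact: measurable_segment_piece.
Qed.

Lemma integral_segment_step_le (G : int -> R) : (forall i, 0 <= G i) ->
  (\int[mu1 R]_(x in segment) (G (cell_index m x))%:E
    <= (\sum_(p < P) dx m * G (i0 + (p : nat)%:Z))%:E)%E.
Proof.
move=> G0.
rewrite -(fineK (integrable_fin_num measurable_segment (integrable_segment_step G))) // lee_fin.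
have := @Rintegral_step _ _ _ (mu1 R) segment measurable_segment segment_lty _ _ _ _ cell_idx_inj
  cell_index_range (fun p => measurable_segment_piece _) G.
rewrite /Rintegral => ->; apply: ler_sum => p _; rewrite mulrC ler_wpM2r //.
have := segment_piece_measure (i0 + (p : nat)%:Z); rewrite -lee_fin => /(le_trans _); apply.
by rewrite fineK // ge0_fin_numE // (le_lt_trans (segment_piece_measure _)) ?ltry.
Qed.

Lemma integrable_box_step (G : int * nat -> R) :
  (mu2 R).-integrable box (EFin \o (fun z => G (mesh_index m z))).
Proof.
apply: (@integrable_step _ _ _ (mu2 R) box measurable_box box_lty _ _ _ _ mesh_idx_inj).
  exact: mesh_index_range.
by move=> k; exact: measurable_box_piece.
Qed.

(** The sum gives every cell its full measure dx dt, so [G] has to vanish on cells that stick out of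
    the box. *)
Lemma Rintegral_box_step (G : int * nat -> R) :
  (forall k, G (mesh_idx k) != 0 -> [/\ - a <= xhalf m (mesh_idx k).1,
     xhalf m ((mesh_idx k).1 + 1) <= a & (mesh_idx k).2.+1%:R * dt m <= a]) ->
  Rintegral (mu2 R) box (fun z => G (mesh_index m z)) =
    \sum_(p < P) \sum_(n < N) dx m * dt m * G (i0 + (p : nat)%:Z, n : nat).
Proof.
move=> G0.
rewrite (@Rintegral_step _ _ _ (mu2 R) box measurable_box box_lty _ _ _ _ mesh_idx_inj
  mesh_index_range (fun k => measurable_box_piece _)).
rewrite pair_big /=; apply: eq_bigr => k _.
rewrite -[(i0 + (k.1 : nat)%:Z, k.2 : nat)]/(mesh_idx k).
have [->|/G0 [H1 H2 H3]] := eqVneq (G (mesh_idx k)) 0; first by rewrite mul0r mulr0.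
transitivity (G (mesh_idx k) * (dx m * dt m)); last exact: mulrC.
by congr (_ * _); exact: (congr1 fine (box_piece_measureE H1 H2 H3)).
Qed.

Lemma integral_box_step_le (G : int * nat -> R) : (forall k, 0 <= G k) ->
  (\int[mu2 R]_(z in box) (G (mesh_index m z))%:E
    <= (\sum_(p < P) \sum_(n < N) dx m * dt m * G (i0 + (p : nat)%:Z, n : nat))%:E)%E.
Proof.
move=> G0.
rewrite -(fineK (integrable_fin_num measurable_box (integrable_box_step G))) // lee_fin.
have := @Rintegral_step _ _ _ (mu2 R) box measurable_box box_lty _ _ _ _ mesh_idx_inj
  mesh_index_range (fun k => measurable_box_piece _) G.
rewrite /Rintegral => ->; rewrite pair_big /=; apply: ler_sum => k _; rewrite mulrC ler_wpM2r //.
have := box_piece_measure_le (mesh_idx k); rewrite -lee_fin => /(le_trans _); apply.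
by rewrite fineK // ge0_fin_numE // (le_lt_trans (box_piece_measure_le _)) ?ltry.
Qed.

End BoxSums.

Section VariationIntegrals.
Context {R : realType} {d : nat} (m : mesh R) (a : R) (ms : nat).
Hypotheses (h0 : 0 < dx m) (t0 : 0 < dt m) (a0 : 0 < a).
Variable U : nat -> pwpoly R d.
Hypothesis V0 : forall n i, 0 <= max_variation m (U n) i.

Lemma sum_variation_le n i (P : nat) :
  ((\sum_(p < P) dx m * max_variation m (U n) (i + (p : nat)%:Z))%:E <= TVB_seminorm m U)%E.
Proof.
apply: (@le_trans _ _ ((dx m)%:E * \esum_(i in setT) (max_variation m (U n) i)%:E)%E); last first.
  by apply: ereal_sup_ubound; exists n.
rewrite -mulr_sumr EFinM; apply: lee_wpmul2l; first by rewrite lee_fin ltW.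
pose s := [seq i + (p : nat)%:Z | p : 'I_P].
have us : uniq s by rewrite map_inj_uniq ?enum_uniq // => p q /addrI [] /val_inj.
apply: esum_ge; exists [set` s]; first by split => //; exact: finite_seq.
by rewrite -fsbig_seq // big_map big_enum /= sumEFin.
Qed.

Lemma segment_variation_le n :
  (\int[mu1 R]_(x in segment a) (max_variation m (U n) (cell_index m x))%:E <= TVB_seminorm m U)%E.
Proof.
have H := integral_segment_step_le h0 t0 a0 (V0 n).
exact: le_trans H (sum_variation_le n (first_cell m a) (num_cells m a)).
Qed.

(** Every time level contributes dt times at most the seminorm, and the levels have total length
    [num_levels] dt <= a + (ms + 1) when dt <= 1. *)
Lemma box_variation_le : dt m <= 1 ->
  (\int[mu2 R]_(z in box a)
     (max_variation m (U (mesh_index m z).2) (mesh_index m z).1)%:E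
     <= (a + ms.+1%:R)%:E * TVB_seminorm m U)%E.
Proof.
move=> t1.
apply: (le_trans (integral_box_step_le (G := fun k => max_variation m (U k.2) k.1) ms h0 t0 a0 _)).
  by move=> k; exact: V0.
rewrite exchange_big /=.
have T0 : (0 <= TVB_seminorm m U)%E.
  by apply: le_trans (sum_variation_le 0 0 0); rewrite big_ord0.
apply: (@le_trans _ _ (\sum_(n < num_levels m a ms) (dt m)%:E * TVB_seminorm m U)%E).
  rewrite -sumEFin; apply: lee_sum => n _.
  rewrite (eq_bigr (fun p : 'I_(num_cells m a) => dt m *
     (dx m * max_variation m (U n) (first_cell m a + (p : nat)%:Z)))); last first.
    by move=> p _; rewrite mulrA [dt m * _]mulrC.
  rewrite -mulr_sumr EFinM; apply: lee_wpmul2l; first by rewrite lee_fin ltW.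
  exact: sum_variation_le.
rewrite -ge0_sume_distrl => [|n _]; last by rewrite lee_fin ltW.
apply: lee_wpmul2r => //; rewrite sumEFin lee_fin sumr_const card_ord -[leLHS]mulr_natl.
rewrite /num_levels -addnS natrD mulrDl; apply: lerD; last by rewrite ler_piMr.
by have /andP[] := time_index_itv t0 (ltW a0).
Qed.

(** The first [ms] levels fill a strip of width ms dt. Outside it all indicators left by the
    summation by parts equal 1. *)
Lemma box_initial_layer_le :
  (\int[mu2 R]_(z in box a) ((time_index m z.2 < ms)%N%:R)%:E
     <= (2 * a * (ms%:R * dt m))%:E)%E.
Proof.
pose S : set (measurableTypeR R * measurableTypeR R) :=
  segment a `*` (`[0 : R, ms%:R * dt m]%classic : set (measurableTypeR R)).
have mS : measurable S.
  by apply: measurableX; [exact: measurable_segment|exact: measurable_itv].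
have muS : mu2 R S = (2 * a * (ms%:R * dt m))%:E.
  rewrite product_measure1E; [|exact: measurable_segment|exact: measurable_itv].
  rewrite EFinM -(segment_measure a0); congr (_ * _)%E.
  have tp : 0 <= ms%:R * dt m by rewrite mulr_ge0 // ltW.
  by apply: (eq_trans (lebesgue_measure_cc tp)); rewrite subr0.
apply: (@le_trans _ _ (\int[mu2 R]_(z in box a) (\1_S z)%:E)%E).
  apply: ge0_le_integral_nm => -[x t] /boxP [xa /andP[t1 ta]]; rewrite lee_fin ?ler0n //.
  rewrite indicE /=; case: ltnP => [tm|//]; rewrite mem_set // /S /segment.
  split => /=; rewrite in_itv //=.
  rewrite t1 /=; have /andP[_ /ltW] := time_index_itv t0 t1; move/le_trans; apply.
  by rewrite ler_pM2r // ler_nat.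
rewrite integral_indic //; last exact: measurable_box.
rewrite -muS; apply: le_measure; rewrite ?inE //.
by apply: measurableI => //; exact: measurable_box.
Qed.

End VariationIntegrals.

Section Convergence.
Context {R : realType} {d : nat} (ms : nat) (a : R) (a0 : 0 < a).
Variables (m : nat -> mesh R) (U : nat -> nat -> pwpoly R d).
Hypotheses (hdx : forall j, 0 < dx (m j)) (hdt : forall j, 0 < dt (m j)).
Hypothesis (hdt0 : dt (m j) @[j --> \oo] --> (0 : R)).
Hypothesis hTVB : TVB_seminorm (m j) (U j) @[j --> \oo] --> 0%E.
Hypothesis V0 : forall j n i, 0 <= max_variation (m j) (U j n) i.

Lemma cvg_segment_variation n :
  (\int[mu1 R]_(x in segment a) (max_variation (m j) (U j n) (cell_index (m j) x))%:E)%E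
    @[j --> \oo] --> 0%E.
Proof.
apply: squeeze_cvge hTVB; last exact: cvg_cst.
apply: nearW => j; rewrite segment_variation_le // andbT.
by apply: integral_ge0 => x _; rewrite lee_fin.
Qed.

Lemma cvg_box_variation :
  (\int[mu2 R]_(z in box a)
     (max_variation (m j) (U j (mesh_index (m j) z).2) (mesh_index (m j) z).1)%:E)%E
    @[j --> \oo] --> 0%E.
Proof.
have c1 : ((a + ms.+1%:R)%:E * TVB_seminorm (m j) (U j))%E @[j --> \oo] --> 0%E.
  rewrite -(mule0 (a + ms.+1%:R)%:E); exact: cvgeMl.
apply: squeeze_cvge c1; last exact: cvg_cst.
have : \forall j \near \oo, dt (m j) <= 1 by apply: (cvgr_le _ hdt0).
apply: filterS => j tj; rewrite box_variation_le // andbT.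
by apply: integral_ge0 => x _; rewrite lee_fin.
Qed.

Lemma cvg_box_initial_layer :
  (\int[mu2 R]_(z in box a) ((time_index (m j) z.2 < ms)%N%:R)%:E)%E @[j --> \oo] --> 0%E.
Proof.
have c1 : (2 * a * (ms%:R * dt (m j)))%:E @[j --> \oo] --> 0%E.
  apply: cvg_EFin; first exact: nearW.
  have := cvgM (cvg_cst (2 * a)) (cvgM (cvg_cst (ms%:R : R)) hdt0).
  by rewrite !mulr0; exact.
apply: squeeze_cvge c1; last exact: cvg_cst.
apply: nearW => j; rewrite box_initial_layer_le // andbT.
by apply: integral_ge0 => x _; rewrite lee_fin.
Qed.

End Convergence.

Section MeshDistance.
Context {R : realType} (m : mesh R).
Hypotheses (h0 : 0 < dx m) (t0 : 0 < dt m).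

Lemma xcenter_dist x : `|xcenter m (cell_index m x) - x| <= dx m.
Proof.
have := cell_index_itv h0 x; rewrite xhalfD1 /xcenter ler_norml.
by move: h0; set h := dx m; set y := xhalf _ _ => hp /andP[y1 y2]; apply/andP; split; lra.
Qed.

Lemma time_dist t : 0 <= t -> `|(time_index m t)%:R * dt m - t| <= dt m.
Proof.
move=> t1; have := time_index_itv t0 t1; rewrite -natr1 mulrDl mul1r ler_norml.
by set s := _ * _ => /andP[s1 s2]; apply/andP; split; lra.
Qed.

End MeshDistance.

(** * The test function on the mesh *)

Section TestFunctionOnMesh.
Context {R : realType} (phi : R * R -> R) (a : R) (c : nat).
Hypotheses (Cphi : forall n, Cn n phi) (a0 : 0 < a).
Variable m : nat -> mesh R.
Hypotheses (hdx : forall j, 0 < dx (m j)) (hdt : forall j, 0 < dt (m j)).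
Hypotheses (hdx0 : dx (m j) @[j --> \oo] --> (0 : R)).
Hypotheses (hdt0 : dt (m j) @[j --> \oo] --> (0 : R)).

Lemma near_small (L C D eps : R) : 0 < eps ->
  \forall j \near \oo, L * (C * dx (m j) + D * dt (m j)) <= eps.
Proof.
move=> eps0; have : L * (C * dx (m j) + D * dt (m j)) @[j --> \oo] --> (0 : R).
  have := cvgM (cvg_cst L) (cvgD (cvgM (cvg_cst C) hdx0) (cvgM (cvg_cst D) hdt0)).
  by rewrite !mulr0 addr0 mulr0; exact.
by move/cvgr_le; exact.
Qed.

Lemma near_dx_le e : 0 < e -> \forall j \near \oo, dx (m j) <= e.
Proof. exact: (cvgr_le _ hdx0). Qed.

Lemma near_dt_le e : 0 < e -> \forall j \near \oo, dt (m j) <= e.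
Proof. exact: (cvgr_le _ hdt0). Qed.

(** All evaluation points lie within two cells in space and [c] steps in time of points of the box,
    and the mesh widths are eventually at most 1. *)
Let r := a + c.+2%:R.

Lemma segment_norm x : segment a x -> `|x| <= a.
Proof. by rewrite /segment /= in_itv /= ler_norml. Qed.

Lemma mesh_point_le j k x : dx (m j) <= 1 -> `|x| <= a -> (k <= 1)%N ->
  `|xcenter (m j) (cell_index (m j) x) + k%:R * dx (m j)| <= r.
Proof.
move=> h1 xa k1; have := xcenter_dist (hdx j) x; set y := xcenter _ _ => yx.
have -> : y + k%:R * dx (m j) = (y - x) + x + k%:R * dx (m j) by ring.
have kh : `|k%:R * dx (m j)| <= 1.
  rewrite ger0_norm ?mulr_ge0 // ?(ltW (hdx j)) //; have := hdx j.
  by case: k k1 => [|[|//]] _ H; rewrite ?mul0r ?mul1r //; lra.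
apply: (le_trans (ler_normD _ _)).
apply: (le_trans (lerD (ler_normD _ _) (lexx _))).
rewrite /r -addn2 natrD; have := ler0n R c; lra.
Qed.

Lemma mesh_time_le j k t : dt (m j) <= 1 -> 0 <= t <= a -> (k <= c)%N ->
  `|(time_index (m j) t + k)%N%:R * dt (m j)| <= r.
Proof.
move=> t1 /andP[tp ta] kc; rewrite ger0_norm ?mulr_ge0 // ?(ltW (hdt j)) //.
have /andP[H _] := time_index_itv (hdt j) tp.
rewrite natrD mulrDl.
have : k%:R * dt (m j) <= c%:R.
  apply: (@le_trans _ _ k%:R); first by rewrite ler_piMr.
  by rewrite ler_nat.
rewrite /r -addn2 natrD; lra.
Qed.

Lemma mesh_time_dist j k t : 0 <= t -> (k <= c)%N ->
  `|(time_index (m j) t + k)%N%:R * dt (m j) - t| <= c.+1%:R * dt (m j).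
Proof.
move=> tp kc; have := time_dist (hdt j) tp; rewrite natrD mulrDl.
set s := _ * _ => st; have -> : s + k%:R * dt (m j) - t = (s - t) + k%:R * dt (m j) by ring.
apply: (le_trans (ler_normD _ _)); rewrite -natr1 mulrDl mul1r addrC lerD //.
by rewrite ger0_norm ?mulr_ge0 ?(ltW (hdt j)) // ler_pM2r // ler_nat.
Qed.

(** The difference spans [k] time steps but is divided by one, hence the factor k in the limit. *)
Lemma quotient_t_error k eps : (0 < k <= c)%N -> 0 < eps ->
  \forall j \near \oo, forall x t, box a (x, t) ->
    `|(phi (xcenter (m j) (cell_index (m j) x), (time_index (m j) t + k)%N%:R * dt (m j))
       - phi (xcenter (m j) (cell_index (m j) x), (time_index (m j) t)%:R * dt (m j))) / dt (m j)
      - k%:R * ddt phi (x, t)| <= eps.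
Proof.
move=> /andP[k0 kc] eps0.
have [L L0 HL] := difference_quotient_t r (Cphi 2).
near=> j => x t /boxP [xa tta]; have /andP[tp ta] := tta.
have h1 : dx (m j) <= 1 by near: j; exact: near_dx_le.
have t1 : dt (m j) <= 1 by near: j; exact: near_dt_le.
have k0' : (k%:R : R) != 0 by rewrite pnatr_eq0 -lt0n.
have d0 : dt (m j) != 0 by rewrite gt_eqF.
have xr : `|x| <= a by rewrite ler_norml.
have -> : (time_index (m j) t + k)%N%:R * dt (m j) =
    (time_index (m j) t)%:R * dt (m j) + k%:R * dt (m j) by rewrite natrD mulrDl.
set s := _%:R * _; set y := xcenter _ _.
have -> : (phi (y, s + k%:R * dt (m j)) - phi (y, s)) / dt (m j) - k%:R * ddt phi (x, t) =
   k%:R * ((phi (y, s + k%:R * dt (m j)) - phi (y, s)) / (k%:R * dt (m j)) - ddt phi (x, t)).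
  by field; rewrite d0.
rewrite normrM ger0_norm //.
have yr : `|y| <= r by have := @mesh_point_le j 0 x h1 xr isT; rewrite mul0r addr0.
have sr : `|s| <= r by have := @mesh_time_le j 0 t t1 tta isT; rewrite addn0.
have skr : `|s + k%:R * dt (m j)| <= r.
  by have := @mesh_time_le j k t t1 tta kc; rewrite natrD mulrDl.
have ar : a <= r by rewrite lerDl.
have tr : `|t| <= r by rewrite ger0_norm // (le_trans ta).
have kd : 0 < k%:R * dt (m j) by rewrite mulr_gt0 // ltr0n.
have xr' : `|x| <= r by exact: le_trans xr ar.
apply: (@le_trans _ _ (k%:R * (L * (`|y - x| + `|s - t| + k%:R * dt (m j))))).
  by apply: ler_wpM2l => //; exact: HL.
apply: (@le_trans _ _ (k%:R * L * (1 * dx (m j) + (1 + k%:R) * dt (m j)))); last first.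
  by near: j; exact: near_small.
rewrite -mulrA; do 2 apply: ler_wpM2l => //.
rewrite mulrDl !mul1r addrA !lerD //; first exact: xcenter_dist.
exact: time_dist.
Unshelve. all: by end_near. Qed.

Lemma quotient_x_error k eps : (k <= c)%N -> 0 < eps ->
  \forall j \near \oo, forall x t, box a (x, t) ->
    `|(phi (xcenter (m j) (cell_index (m j) x + 1), (time_index (m j) t + k)%N%:R * dt (m j))
       - phi (xcenter (m j) (cell_index (m j) x), (time_index (m j) t + k)%N%:R * dt (m j)))
      / dx (m j)
      - ddx phi (x, t)| <= eps.
Proof.
move=> kc eps0.
have [L L0 HL] := difference_quotient_x r (Cphi 2).
near=> j => x t /boxP [xa tta]; have /andP[tp ta] := tta.
have h1 : dx (m j) <= 1 by near: j; exact: near_dx_le.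
have t1 : dt (m j) <= 1 by near: j; exact: near_dt_le.
have xr : `|x| <= a by rewrite ler_norml.
have ar : a <= r by rewrite lerDl.
have tr : `|t| <= r by rewrite ger0_norm // (le_trans ta).
have sr := @mesh_time_le j k t t1 tta kc.
have yr : `|xcenter (m j) (cell_index (m j) x)| <= r.
  by have := @mesh_point_le j 0 x h1 xr isT; rewrite mul0r addr0.
have yr1 : `|xcenter (m j) (cell_index (m j) x) + dx (m j)| <= r.
  by have := @mesh_point_le j 1 x h1 xr isT; rewrite mul1r.
rewrite xcenterD1.
have xr' : `|x| <= r by exact: le_trans xr ar.
apply: le_trans (HL _ x t _ _ yr xr' tr sr yr1 (hdx j)) _.
apply: (@le_trans _ _ (L * (2 * dx (m j) + c.+1%:R * dt (m j)))); last first.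
  by near: j; exact: near_small.
apply: ler_wpM2l => //.
have := xcenter_dist (hdx j) x; have := @mesh_time_dist j k t tp kc; lra.
Unshelve. all: by end_near. Qed.

Lemma initial_value_error n eps : (n <= c)%N -> 0 < eps ->
  \forall j \near \oo, forall x, segment a x ->
    `|phi (xcenter (m j) (cell_index (m j) x), n%:R * dt (m j)) - phi (x, 0)| <= eps.
Proof.
move=> nc eps0.
have [L L0 HL] := Cn_lipschitz r (Cphi 1).
near=> j => x /segment_norm xr.
have h1 : dx (m j) <= 1 by near: j; exact: near_dx_le.
have t1 : dt (m j) <= 1 by near: j; exact: near_dt_le.
have ar : a <= r by rewrite lerDl.
have yr : `|xcenter (m j) (cell_index (m j) x)| <= r.
  by have := @mesh_point_le j 0 x h1 xr isT; rewrite mul0r addr0.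
have a00 : 0 <= (0 : R) <= a by rewrite lexx ltW.
have T0 : time_index (m j) 0 = 0%N by rewrite /time_index mul0r truncn0.
have sr : `|n%:R * dt (m j)| <= r by have := @mesh_time_le j n 0 t1 a00 nc; rewrite T0.
have zr : `|0 : R| <= r by rewrite normr0 (le_trans (ltW a0)).
have xr' : `|x| <= r by exact: le_trans xr ar.
apply: le_trans (HL _ _ _ _ yr xr' sr zr) _.
apply: (@le_trans _ _ (L * (1 * dx (m j) + c.+1%:R * dt (m j)))); last first.
  by near: j; exact: near_small.
apply: ler_wpM2l => //; rewrite mul1r lerD ?xcenter_dist //.
by have := @mesh_time_dist j n 0 (lexx _) nc; rewrite T0.
Unshelve. all: by end_near. Qed.

End TestFunctionOnMesh.

(** * Measurability of the entropy and its flux *)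

Section MeasurableStates.
Context {R : realType} {d : nat} d0 (T : measurableType d0) (D : set T).
Variable V : T -> state R d.
Hypothesis mV : forall j, measurable_fun D (fun z => V z 0 j).

Lemma measurable_rho : measurable_fun D (fun z => rho (V z)).
Proof. by under eq_fun do rewrite /rho mxE; exact: mV. Qed.

Lemma measurable_energy : measurable_fun D (fun z => energy (V z)).
Proof. by under eq_fun do rewrite /energy !mxE; exact: mV. Qed.

Lemma measurable_mag j : measurable_fun D (fun z => mag (V z) 0 j).
Proof. by under eq_fun do rewrite /mag !mxE; exact: mV. Qed.

Lemma measurable_vel j : measurable_fun D (fun z => vel (V z) 0 j).
Proof.
under eq_fun do rewrite /vel /mom !mxE.
apply: measurable_funM; last exact: mV.
exact/measurable_fun_inv/measurable_rho.
Qed.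

Lemma measurable_pres : measurable_fun D (fun z => pres (V z)).
Proof.
have mE n (u : T -> 'rV[R]_n) : (forall j, measurable_fun D (fun x => u x 0 j)) ->
    measurable_fun D (fun x => enorm (u x) ^+ 2).
  by move=> mu; apply: measurable_funX; exact: measurable_enorm.
apply: measurable_funM => //; apply: measurable_funB.
  apply: measurable_funB; first exact: measurable_energy.
  apply: measurable_funM; last exact/mE/measurable_vel.
  by apply: measurable_funM => //; exact: measurable_rho.
by apply: measurable_funM => //; exact/mE/measurable_mag.
Qed.

Lemma measurable_rho_spec_entropy : measurable_fun D (fun z => rho (V z) * spec_entropy (V z)).
Proof.
apply: measurable_funM; first exact: measurable_rho.
have H : measurable_fun D (fun z => pres (V z) * rho (V z) `^ (- gam)).
  apply: measurable_funM; first exact: measurable_pres.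
  by have := @measurableT_comp _ _ _ _ _ _ _ D _ (@measurable_powR R (- gam)) measurable_rho.
exact: (measurableT_comp (@measurable_ln R) H).
Qed.

Lemma measurable_entropy : measurable_fun D (fun z => entropy (V z)).
Proof.
apply: measurable_funM => //; apply: measurableT_comp => //.
exact: measurable_rho_spec_entropy.
Qed.

Lemma measurable_mhd_eflux : measurable_fun D (fun z => mhd_eflux (V z)).
Proof.
apply: measurable_funM => //; apply: measurableT_comp => //.
by apply: measurable_funM; [exact: measurable_rho_spec_entropy|exact: measurable_vel].
Qed.

End MeasurableStates.

Lemma cvg_finsum {R : realType} (I : Type) (s : seq I) (f : I -> nat -> R) (l : I -> R) :
  (forall i, f i j @[j --> \oo] --> l i) ->
  \sum_(i <- s) f i j @[j --> \oo] --> \sum_(i <- s) l i.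
Proof.
move=> fl; elim: s => [|i s IH].
  by rewrite big_nil; under eq_fun do rewrite big_nil; exact: cvg_cst.
by rewrite big_cons; under eq_fun do rewrite big_cons; exact: cvgD.
Qed.

Lemma cvge0D {R : realType} (f g : nat -> \bar R) : f j @[j --> \oo] --> 0%E ->
  g j @[j --> \oo] --> 0%E -> (f j + g j)%E @[j --> \oo] --> 0%E.
Proof. by move=> f0 g0; rewrite -[X in _ --> X]adde0; exact: cvgeD. Qed.

(** * Passage to the limit *)

Section LaxWendroff.
Context {R : realType} {d : nat}.
Variables (Psi : R -> state R d -> state R d -> state R d) (hPsi : prescribed_path Psi).
Variables (k N : nat) (node weight : 'I_N -> R) (hquad : gauss_lobatto node weight).
Variables (ms : nat) (alpha beta : 'I_ms -> R).
Variables (m : nat -> mesh R) (U : nat -> nat -> pwpoly R d).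
Variables (U0 : R -> state R d) (Ustar : R * R -> state R d).
Hypotheses (hdx : forall j, 0 < dx (m j)) (hdt : forall j, 0 < dt (m j)).
Hypotheses (hdx0 : dx (m j) @[j --> \oo] --> (0 : R)).
Hypotheses (hdt0 : dt (m j) @[j --> \oo] --> (0 : R)).
Hypothesis hU : forall j, numerical_solution (m j) Psi node weight alpha beta k (U j).
Hypothesis hinit : forall n, (n < ms)%N -> cvg_L1loc_space (fun j => at_point (m j) (U j n)) U0.
Variables (K : set (state R d)) (hK : compact K) (hKG : K `<=` admissible).
Hypothesis hUK : forall j n i x, cell (m j) i x -> K (peval (U j n i) x).
Hypothesis hcvg : cvg_L1loc_spacetime (fun j => in_time (m j) (U j)) Ustar.
Hypothesis hTVB : TVB_seminorm (m j) (U j) @[j --> \oo] --> 0%E.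
Variables (phi : R * R -> R) (Cphi : forall n, Cn n phi) (a : R) (a0 : 0 < a).

Let cK : closed K. Proof. by apply: compact_closed hK; exact: norm_hausdorff. Qed.

Let V0 j n i : 0 <= max_variation (m j) (U j n) i.
Proof. by apply: (max_variation_ge0 hK (hdx j)) => i' x; exact: hUK. Qed.

Definition cell_entropies j (q : int * nat) : R :=
  cell_entropy (m j) node weight (U j q.2) q.1.

(* The indicators come from the summation by parts in time of an inequality that
   starts at the level [ms]. *)
Definition cell_fluxes (l : 'I_ms) j (q : int * nat) : R :=
  (ms <= q.2 + l.+1)%N%:R * entropy_flux (m j) Psi (beta l) (U j q.2) q.1.

Definition time_quotient (l : 'I_ms) j (q : int * nat) : R :=
  (ms <= q.2)%N%:R * ((phi (xcenter (m j) q.1, (q.2 + l.+1)%N%:R * dt (m j))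
    - phi (xcenter (m j) q.1, q.2%:R * dt (m j))) / dt (m j)).

Definition space_quotient (l : 'I_ms) j (q : int * nat) : R :=
  (phi (xcenter (m j) (q.1 + 1), (q.2 + l.+1)%N%:R * dt (m j))
   - phi (xcenter (m j) q.1, (q.2 + l.+1)%N%:R * dt (m j))) / dx (m j).

Definition initial_product n l j (i : int) : R :=
  cell_entropy (m j) node weight (U j n) i
  * phi (xcenter (m j) i, (n + l)%N%:R * dt (m j)).

(** The three sources of error: variation within neighbouring cells, distance to the limit, and the
    initial layer. The last summand absorbs the levels on which the indicators in [time_quotient]
    and [cell_fluxes] vanish. *)
Definition box_error j (z : R * R) : R :=
  max_variation (m j) (U j (mesh_index (m j) z).2) (mesh_index (m j) z).1
  + enorm (in_time (m j) (U j) z - Ustar z) + (time_index (m j) z.2 < ms)%N%:R.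

Lemma measurable_Ustar j : measurable_fun (box a) (fun z => Ustar z 0 j).
Proof.
apply: (measurable_funS _ _ (hcvg.1 j)).
  by apply: measurableX => //; exact: measurable_itv.
move=> [x t] /boxP [_ /andP[t1 _]]; split => //=.
by rewrite in_itv /= t1.
Qed.

Let mUd j : measurable_fun (box a) (fun z => enorm (in_time (m j) (U j) z - Ustar z)).
Proof.
apply: measurable_enorm => i.
rewrite (_ : (fun x => _) = (fun x => in_time (m j) (U j) x 0 i - Ustar x 0 i)); last first.
  by apply/funext => x; rewrite !mxE.
apply: measurable_funB; last exact: measurable_Ustar.
by apply: measurable_funTS; exact: measurable_in_time.
Qed.

Let mbox (G : int * nat -> R) j : measurable_fun (box a) (fun z => G (mesh_index (m j) z)).
Proof.
by apply/measurable_EFinP; exact: measurable_int (integrable_box_step 0 (hdx j) (hdt j) a0 G).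
Qed.

Lemma measurable_box_error j : measurable_fun (box a) (box_error j).
Proof.
apply: measurable_funD; first apply: measurable_funD => //.
  exact: (mbox (fun k => max_variation (m j) (U j k.2) k.1)).
exact: (mbox (fun k => (k.2 < ms)%N%:R)).
Qed.

Lemma box_error_ge0 j z : 0 <= box_error j z.
Proof. by rewrite !addr_ge0 // sqrtr_ge0. Qed.

Lemma cvg_box_error : (\int[mu2 R]_(z in box a) (box_error j z)%:E)%E @[j --> \oo] --> 0%E.
Proof.
have E j : (\int[mu2 R]_(z in box a) (box_error j z)%:E)%E =
  (\int[mu2 R]_(z in box a)
     (max_variation (m j) (U j (mesh_index (m j) z).2) (mesh_index (m j) z).1)%:E
   + \int[mu2 R]_(z in box a) (enorm (in_time (m j) (U j) z - Ustar z))%:E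
   + \int[mu2 R]_(z in box a) ((time_index (m j) z.2 < ms)%N%:R)%:E)%E.
  have mb := @measurable_box R a.
  have m1 := mbox (fun k => max_variation (m j) (U j k.2) k.1) j.
  have m3 := mbox (fun k => (k.2 < ms)%N%:R) j.
  rewrite -ge0_integralD //; last 4 first.
  - by move=> z _; rewrite lee_fin.
  - exact/measurable_EFinP.
  - by move=> z _; rewrite lee_fin sqrtr_ge0.
  - by apply/measurable_EFinP; exact: mUd.
  rewrite -ge0_integralD //.
  - by move=> z _; rewrite adde_ge0 // lee_fin // sqrtr_ge0.
  - by apply: emeasurable_funD; apply/measurable_EFinP => //; exact: mUd.
  - exact/measurable_EFinP.
rewrite (funext E); apply: cvge0D (cvg_box_initial_layer ms a0 hdt hdt0).
exact: cvge0D (cvg_box_variation ms a0 hdx hdt hdt0 hTVB V0) (hcvg.2 (- a) a a).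
Qed.

Lemma ae_Ustar : {ae mu2 R, forall z, box a z -> K (Ustar z)}.
Proof.
apply: (ae_limit_in_closed _ cK _ mUd (hcvg.2 (- a) a a)); first exact: measurable_box.
by move=> j z _; apply: hUK; exact: cell_index_cell.
Qed.

Let C1_bounded f df : isC1 (@admissible R d) f df ->
  exists2 C : R, 0 <= C & forall w, K w -> `|f w| <= C.
Proof.
move=> fC; have [C C0 HC] := bounded_on_compact hK (fun w Kw => isC1_continuous fC (hKG Kw)).
by exists C => //; exact: ltW.
Qed.

Let mddt : measurable_fun (box a) (ddt phi).
Proof.
apply: measurable_funTS; apply: continuous_measurable_fun2.
by case: (Cphi 1) => _ [_ _ _ []].
Qed.

Let mddx : measurable_fun (box a) (ddx phi).
Proof.
apply: measurable_funTS; apply: continuous_measurable_fun2.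
by case: (Cphi 1) => _ [_ _ []].
Qed.

Let mphi0 : measurable_fun (segment a) (fun x => phi (x, 0)).
Proof.
apply: measurable_funTS; apply: continuous_measurable_fun => x.
apply: differentiable_continuous; apply/derivable1_diffP.
by have [_ [/(_ (x, 0)) /is_derive_ddx []]] := Cphi 1.
Qed.

Lemma box_norm (f : R * R -> R) : continuous f ->
  exists2 M, 0 <= M & forall z, box a z -> `|f z| <= M.
Proof.
move=> cf; have [M M0 HM] := bounded_on_box a cf; exists M => // -[x t] /boxP [xa /andP[t1 ta]].
by apply: HM; rewrite ?ler_norml // (le_trans _ t1) ?ta //; have := a0; lra.
Qed.

(** The estimate on [A] assumes [K (Ustar z)], which holds at almost every point only. [A] stands
    for entropies or fluxes, [B] for quotients of the test function. *)
Lemma cvg_box_product (f : state R d -> R) df (A B : nat -> int * nat -> R) (b : R * R -> R)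
    (CA CB Ce : R) :
  isC1 (@admissible R d) f df -> measurable_fun (box a) (fun z => f (Ustar z)) ->
  continuous b -> [/\ 0 <= CA, 0 <= CB & 0 <= Ce] ->
  (forall j z, box a z -> K (Ustar z) ->
     `|A j (mesh_index (m j) z) - f (Ustar z)| <= CA * box_error j z) ->
  (\forall j \near \oo, forall z, box a z -> `|B j (mesh_index (m j) z)| <= CB) ->
  (forall eps : R, 0 < eps -> \forall j \near \oo, forall z, box a z ->
     `|B j (mesh_index (m j) z) - b z| <= eps + Ce * box_error j z) ->
  Rintegral (mu2 R) (box a) (fun z => A j (mesh_index (m j) z) * B j (mesh_index (m j) z))
    @[j --> \oo] --> Rintegral (mu2 R) (box a) (fun z => f (Ustar z) * b z).
Proof.
move=> fC mf cb [CA0 CB0 Ce0] HA HB HBb.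
have [Cf Cf0 HCf] := C1_bounded fC.
have [Cb Cb0 HCb] := box_norm cb.
apply: (@cvg_Rintegral_mul _ _ _ (mu2 R) (box a) _ _ _ _ box_error Cf Cb CA CB Ce) => //.
- exact: measurable_box.
- exact: box_lty.
- by move=> j; exact: (integrable_box_step 0 (hdx j) (hdt j) a0 (fun k => A j k * B j k)).
- by apply: measurable_funTS; exact: continuous_measurable_fun2.
- exact: measurable_box_error.
- by move=> j x _; exact: box_error_ge0.
- exact: cvg_box_error.
- by move: ae_Ustar; apply: filterS => z Kz bz; exact/HCf/Kz.
by move=> j; move: ae_Ustar; apply: filterS => z Kz bz; exact/HA/Kz.
Qed.

Lemma cvg_time_term (l : 'I_ms) :
  Rintegral (mu2 R) (box a) (fun z =>
    cell_entropies j (mesh_index (m j) z) * time_quotient l j (mesh_index (m j) z))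
    @[j --> \oo] -->
  Rintegral (mu2 R) (box a) (fun z => entropy (Ustar z) * (l.+1%:R * ddt phi z)).
Proof.
have ct : continuous (ddt phi) by case: (Cphi 1) => _ [_ _ _ []].
have [Ct Ct0 HCt] := box_norm ct.
have [CA CA0 HCA] := cell_entropy_error hK hKG hquad.
have lms : (0 < l.+1 <= ms)%N by exact: ltn_ord.
(* The bound on the quotient uses the error estimate with eps = 1. On the initial layer the quotient
   is 0 instead of about (l + 1) ddt phi, at most (l + 1) Ct in modulus, which [box_error] pays for
   there. *)
apply: (@cvg_box_product _ _ cell_entropies (time_quotient l)
  _ CA (1 + l.+1%:R * Ct) (l.+1%:R * Ct) (@isC1_entropy R d)).
- by apply: measurable_entropy; exact: measurable_Ustar.
- by move=> z; apply: cvgM; [exact: cvg_cst|exact: ct].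
- by split => //; rewrite ?addr_ge0 ?mulr_ge0.
- move=> j [x t] bz Kz.
  apply: (le_trans (HCA (m j) _ _ x _ (hdx j) _ _ Kz)).
  + exact: hUK.
  + exact: cell_index_cell.
  by apply: ler_wpM2l => //; rewrite /box_error lerDl.
- have := quotient_t_error a Cphi hdx hdt hdx0 hdt0 lms ltr01.
  apply: filterS => j Hj [x t] bz; rewrite /time_quotient /mesh_index /=.
  case: leqP => _; last by rewrite mul0r normr0 addr_ge0 // mulr_ge0.
  rewrite mul1r; set q := _ / _.
  have -> : q = (q - l.+1%:R * ddt phi (x, t)) + l.+1%:R * ddt phi (x, t) by rewrite subrK.
  apply: (le_trans (ler_normD _ _)); apply: lerD; first exact: Hj.
  by rewrite normrM ger0_norm // ler_wpM2l // HCt.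
move=> eps eps0; have := quotient_t_error a Cphi hdx hdt hdx0 hdt0 lms eps0.
apply: filterS => j Hj [x t] bz; rewrite /time_quotient /mesh_index /=.
have e0 := box_error_ge0 j (x, t).
have [mn|nm] := leqP ms.
  rewrite mul1r; apply: (le_trans (Hj x t bz)); rewrite lerDl.
  by rewrite !mulr_ge0.
rewrite mul0r sub0r normrN normrM ger0_norm //.
apply: (@le_trans _ _ (l.+1%:R * Ct * 1)); first by rewrite mulr1 ler_wpM2l // HCt.
apply: ler_wpDl; first exact: ltW.
apply: ler_wpM2l; first exact: mulr_ge0.
by rewrite /box_error /= nm lerDr addr_ge0 // sqrtr_ge0.
Qed.

Lemma cvg_space_term (l : 'I_ms) :
  Rintegral (mu2 R) (box a) (fun z =>
    cell_fluxes l j (mesh_index (m j) z) * space_quotient l j (mesh_index (m j) z))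
    @[j --> \oo] -->
  Rintegral (mu2 R) (box a) (fun z => mhd_eflux (Ustar z) * ddx phi z).
Proof.
have cx : continuous (ddx phi) by case: (Cphi 1) => _ [_ _ []].
have [Cx Cx0 HCx] := box_norm cx.
have [dF FC] := @mhd_eflux_C1 R d.
have [CF CF0 HCF] := C1_bounded FC.
have [CA CA0 HCA] := entropy_flux_error hK hKG hPsi.
have lms : (l.+1 <= ms)%N by exact: ltn_ord.
apply: (@cvg_box_product _ _ (cell_fluxes l) (space_quotient l)
  _ (CA + CF) (1 + Cx) 0 FC).
- by apply: measurable_mhd_eflux; exact: measurable_Ustar.
- exact: cx.
- by split => //; rewrite ?addr_ge0.
- move=> j [x t] bz Kz; rewrite /cell_fluxes /mesh_index /=; set n := time_index _ _.
  have [mn|nm] := leqP ms (n + l.+1)%N.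
    (* The step to level n + l + 1 applies the spatial operator to level n, and the definition of
       that operator contains the order of the wave speeds that the flux estimate needs. *)
    have [_ /(_ _ mn) [L [pre [/(_ l) opL _ _]]] _] := hU j.
    rewrite addnK in opL.
    rewrite mul1r; apply: (le_trans (HCA (m j) _ _ _ k _ x _ (hdx j) _ _ Kz opL)).
    + exact: hUK.
    + exact: cell_index_cell.
    apply: ler_pM; rewrite ?addr_ge0 ?sqrtr_ge0 ?lerDl //.
  (* Here the flux is replaced by 0; the error is at most CF, and the level lies in the initial
     layer, where [box_error] is at least 1. *)
  rewrite mul0r sub0r normrN; apply: (le_trans (HCF _ Kz)).
  have n_ms : (n < ms)%N by apply: leq_ltn_trans nm; exact: leq_addr.
  rewrite -[leLHS]mulr1; apply: ler_pM; rewrite ?lerDr //.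
  by rewrite /box_error /= -/n n_ms lerDr addr_ge0 // sqrtr_ge0.
- have := quotient_x_error a Cphi hdx hdt hdx0 hdt0 lms ltr01.
  apply: filterS => j Hj [x t] bz; rewrite /space_quotient /mesh_index /=.
  set q := _ / _; have -> : q = (q - ddx phi (x, t)) + ddx phi (x, t) by rewrite subrK.
  by apply: (le_trans (ler_normD _ _)); apply: lerD; [exact: Hj|exact: HCx].
move=> eps eps0; have := quotient_x_error a Cphi hdx hdt hdx0 hdt0 lms eps0.
by apply: filterS => j Hj [x t] bz; rewrite mul0r addr0; exact: Hj.
Qed.

Definition segment_error n j (x : R) : R :=
  max_variation (m j) (U j n) (cell_index (m j) x) + enorm (at_point (m j) (U j n) x - U0 x).

Let mU0 n j : (n < ms)%N ->
  measurable_fun (segment a) (fun x => enorm (at_point (m j) (U j n) x - U0 x)).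
Proof.
move=> /hinit [mU0 _]; apply: measurable_enorm => i.
rewrite (_ : (fun x => _) = (fun x => at_point (m j) (U j n) x 0 i - U0 x 0 i)); last first.
  by apply/funext => x; rewrite !mxE.
apply: measurable_funB; last by apply: measurable_funTS; exact: mU0.
by apply: measurable_funTS; exact: measurable_at_point.
Qed.

Let mseg (G : int -> R) j : measurable_fun (segment a) (fun x => G (cell_index (m j) x)).
Proof.
by apply/measurable_EFinP; exact: measurable_int (integrable_segment_step (hdx j) (hdt j) a0 G).
Qed.

Lemma cvg_segment_error n : (n < ms)%N ->
  (\int[mu1 R]_(x in segment a) (segment_error n j x)%:E)%E @[j --> \oo] --> 0%E.
Proof.
move=> nms.
have E j : (\int[mu1 R]_(x in segment a) (segment_error n j x)%:E)%E =
  (\int[mu1 R]_(x in segment a) (max_variation (m j) (U j n) (cell_index (m j) x))%:E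
   + \int[mu1 R]_(x in segment a) (enorm (at_point (m j) (U j n) x - U0 x))%:E)%E.
  have mb := @measurable_segment R a.
  rewrite -ge0_integralD //.
  - by move=> z _; rewrite lee_fin.
  - by apply/measurable_EFinP; exact: mseg.
  - by move=> z _; rewrite lee_fin sqrtr_ge0.
  - by apply/measurable_EFinP; exact: mU0.
rewrite (funext E).
exact: cvge0D (cvg_segment_variation a0 hdx hdt hTVB V0 n) ((hinit nms).2 (- a) a).
Qed.

Lemma ae_U0 : (0 < ms)%N -> {ae mu1 R, forall x, segment a x -> K (U0 x)}.
Proof.
move=> ms0.
apply: (ae_limit_in_closed _ cK _ (fun j => mU0 j ms0) ((hinit ms0).2 (- a) a)).
  exact: measurable_segment.
by move=> j z _; apply: hUK; exact: cell_index_cell.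
Qed.

Lemma cvg_initial_term n l : (n < ms)%N -> (l <= ms)%N ->
  Rintegral (mu1 R) (segment a) (fun x => initial_product n l j (cell_index (m j) x))
    @[j --> \oo] -->
  Rintegral (mu1 R) (segment a) (fun x => entropy (U0 x) * phi (x, 0)).
Proof.
move=> nms lms.
have cphi : continuous phi by case: (Cphi 0).
have ms0 : (0 < ms)%N by exact: leq_ltn_trans nms.
have [Ca Ca0 HCa] := C1_bounded (@isC1_entropy R d).
have [Cb Cb0 HCb] := box_norm cphi.
have [CA CA0 HCA] := cell_entropy_error hK hKG hquad.
have bx x : segment a x -> box a (x, 0).
  by move=> sx; split => //=; rewrite in_itv /= lexx ltW.
(* Up to level 2 ms the times still tend to 0, so the test function may be compared with its initial
   values. *)
have nl : (n + l <= ms + ms)%N by rewrite leq_add // ltnW.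
apply: (@cvg_Rintegral_mul _ _ _ (mu1 R) (segment a) _ _ _ _ (segment_error n) Ca Cb CA (1 + Cb) 0).
- exact: measurable_segment.
- exact: segment_lty.
- by move=> j; exact: (integrable_segment_step (hdx j) (hdt j) a0 (initial_product n l j)).
- by apply: measurable_entropy => i; apply: measurable_funTS; exact: (hinit ms0).1.
- exact: mphi0.
- move=> j; apply: measurable_funD; first exact: mseg.
  exact: mU0.
- by move=> j x _; rewrite addr_ge0 // sqrtr_ge0.
- exact: cvg_segment_error.
- by split => //; rewrite addr_ge0.
- by move: (ae_U0 ms0); apply: filterS => z Kz bz; exact/HCa/Kz.
- by move=> x sx; exact/HCb/bx.
- move=> j; move: (ae_U0 ms0); apply: filterS => x Kx sx.
  apply: (HCA (m j) _ _ x _ (hdx j) _ _ (Kx sx)); first exact: hUK.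
  exact: cell_index_cell.
- have := initial_value_error Cphi a0 hdx hdt hdx0 hdt0 nl ltr01.
  apply: filterS => j Hj x sx.
  set q := phi _; have -> : q = (q - phi (x, 0)) + phi (x, 0) by rewrite subrK.
  by apply: (le_trans (ler_normD _ _)); apply: lerD; [exact: Hj|exact/HCb/bx].
move=> eps eps0; have := initial_value_error Cphi a0 hdx hdt hdx0 hdt0 nl eps0.
by apply: filterS => j Hj x sx; rewrite mul0r addr0; exact: Hj.
Qed.

Variables (r0 : R) (r00 : 0 <= r0) (ar0 : a = r0 + 1).
Hypothesis supp : forall x t : R, 0 <= t -> r0 < `|x| \/ r0 < t -> phi (x, t) = 0.
Hypothesis phi_ge0 : forall x t : R, 0 <= t -> 0 <= phi (x, t).

Lemma phi_neq0 x t : 0 <= t -> phi (x, t) != 0 -> - r0 <= x <= r0 /\ t <= r0.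
Proof.
move=> t0 n0; split; first rewrite -ler_norml.
  by rewrite leNgt; apply: contraNN n0 => H; rewrite supp //; left.
by rewrite leNgt; apply: contraNN n0 => H; rewrite supp //; right.
Qed.

(** The unit margin between [r0] and [a] absorbs three half-cells in space and one step in time. The
    alternative with i + 1 occurs because a space quotient involves the next center as well. *)
Lemma support_rectangle j i n n' : dx (m j) <= 2^-1 -> dt (m j) <= 1 -> (n <= n')%N ->
  phi (xcenter (m j) i, n'%:R * dt (m j)) != 0 \/
  phi (xcenter (m j) (i + 1), n'%:R * dt (m j)) != 0 ->
  [/\ - a <= xhalf (m j) i, xhalf (m j) (i + 1) <= a & n.+1%:R * dt (m j) <= a].
Proof.
move=> h1 t1 nn' H; have h0 := hdx j.
have tn : 0 <= n'%:R * dt (m j) by rewrite mulr_ge0 // ltW.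
have [H1 H2] : - r0 - dx (m j) <= xcenter (m j) i <= r0 /\ n'%:R * dt (m j) <= r0.
  case: H => /(phi_neq0 tn) [/andP[x1 x2] ->]; split => //; first by apply/andP; split; lra.
  by move: x1 x2; rewrite xcenterD1 => x1 x2; apply/andP; split; lra.
have H3 : n%:R * dt (m j) <= n'%:R * dt (m j) by rewrite ler_pM2r // ler_nat.
move: H1; rewrite xhalfD1 /xcenter -[n.+1%:R]natr1 mulrDl mul1r ar0 => /andP[x1 x2].
by split; lra.
Qed.

(** The sums of [discrete_weak_inequality] written as integrals of functions constant on the mesh
    cells, in which form the limit can be taken. *)
Definition weak_sum j : R :=
  \sum_(l < ms)
    (alpha l *
      (Rintegral (mu2 R) (box a) (fun z =>
         cell_entropies j (mesh_index (m j) z) * time_quotient l j (mesh_index (m j) z))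
       + \sum_(n < ms) (ms <= n + l.+1)%N%:R *
           Rintegral (mu1 R) (segment a) (fun x => initial_product n l.+1 j (cell_index (m j) x)))
     + beta l * Rintegral (mu2 R) (box a) (fun z =>
         cell_fluxes l j (mesh_index (m j) z) * space_quotient l j (mesh_index (m j) z))).

Lemma weak_sum_ge0 j : \sum_l alpha l = 1 -> dx (m j) <= 2^-1 -> dt (m j) <= 1 ->
  0 <= weak_sum j.
Proof.
move=> sum_alpha h1 t1; have h0 := hdx j; have tau0 := hdt j.
(* Cell 0 of the discrete inequality contains -a and cell P lies beyond the cell of a; the centers
   of both are outside the support, so the boundary terms in space vanish. *)
pose i0 := first_cell (m j) a; pose P := num_cells (m j) a; pose M := num_levels (m j) a ms.
pose ph (p n : nat) := phi (xcenter (m j) (i0 + p%:Z), n%:R * dt (m j)).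
pose eta (p n : nat) := cell_entropy (m j) node weight (U j n) (i0 + p%:Z).
(* The shift by -1: [F l p] is the flux at the left interface of cell p, whereas [entropy_flux] at
   index i belongs to the right interface of cell i. *)
pose F (l : 'I_ms) (p n : nat) := entropy_flux (m j) Psi (beta l) (U j n) (i0 + p%:Z - 1).
have i1 p : i0 + p.+1%:Z - 1 = i0 + p%:Z by lia.
have i2 (p : nat) : i0 + p.+1%:Z = i0 + p%:Z + 1 by lia.
have tn (n : nat) : 0 <= n%:R * dt (m j) by rewrite mulr_ge0 // ltW.
have ph0 p n : 0 <= ph p n by exact: phi_ge0.
have phL n : ph 0%N n = 0.
  apply: supp => //; left; have /andP[x1 _] := cell_index_itv h0 (- a).
  rewrite addr0 /xcenter ltr_normr; apply/orP; right.
  by move: x1; rewrite -/(first_cell _ _) -/i0 ar0; move: (xhalf _ _) => y; lra.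
have phR n : ph P n = 0.
  apply: supp => //; left.
  have i3 : i0 <= cell_index (m j) a.
    by apply: cell_index_le => //; rewrite ge0_cp // ltW.
  have -> : i0 + P%:Z = cell_index (m j) a + 1 by rewrite /P /num_cells -/i0; lia.
  have /andP[_ x1] := cell_index_itv h0 a; rewrite ltr_normr; apply/orP; left.
  by move: x1; rewrite /xcenter {1}ar0; move: (xhalf _ _) => y; lra.
have phM p n : (M <= n)%N -> ph p n = 0.
  move=> Mn; apply: supp => //; right; have /andP[_ t2] := time_index_itv tau0 (ltW a0).
  apply: (@lt_le_trans _ _ a); first by rewrite ar0; lra.
  apply: (le_trans (ltW t2)); rewrite ler_pM2r // ler_nat (leq_trans _ Mn) //.
  by rewrite /M /num_levels ltnS leq_addr.
have msM : (ms <= M)%N by rewrite /M /num_levels leqW // leq_addl.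
have ci p n : (ms <= n)%N -> eta p n <= \sum_l (alpha l * eta p (n - l.+1)%N
    - beta l * (dt (m j) / dx (m j)) * (F l p.+1 (n - l.+1)%N - F l p (n - l.+1)%N)).
  move=> mn; have [_ _ /(_ n mn (i0 + p%:Z)) H] := hU j.
  apply: (le_trans H); rewrite le_eqVlt; apply/orP; left; apply/eqP.
  by apply: eq_bigr => l _; rewrite /F i1.
have := discrete_weak_inequality h0 tau0 sum_alpha msM ph0 phL phR phM ci.
rewrite /weak_sum; congr (_ <= _); apply: eq_bigr => l _; congr (_ * (_ + _) + _ * _).
- rewrite (Rintegral_box_step (ms := ms) (G := fun q => cell_entropies j q * time_quotient l j q)
    h0 tau0 a0) // => -[p n] /= H.
  (* A nonzero time quotient forces the test function to be nonzero at one of the two levels, and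
     either case places the cell inside the box. *)
  have [E|n0] := eqVneq (phi (xcenter (m j) (i0 + (p : nat)%:Z), (n : nat)%:R * dt (m j))) 0.
    apply: (@support_rectangle j _ n (n + l.+1)%N h1 t1 (leq_addr _ _)); left.
    by apply: contraNN H => /eqP E'; rewrite /time_quotient E' E subrr mul0r !mulr0.
  by apply: (@support_rectangle j _ n n h1 t1 (leqnn _)); left.
- apply: eq_bigr => n _; congr (_ * _).
  rewrite (Rintegral_segment_step (G := initial_product n l.+1 j) h0 tau0 a0) // => p H.
  have [] := @support_rectangle j (i0 + (p : nat)%:Z) 0 (n + l.+1)%N h1 t1 (leq0n _) _; last by [].
  by left; apply: contraNN H => /eqP E; rewrite /initial_product E mulr0.
rewrite (Rintegral_box_step (ms := ms) (G := fun q => cell_fluxes l j q * space_quotient l j q)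
  h0 tau0 a0).
  by apply: eq_bigr => p _; apply: eq_bigr => n _; rewrite /F /ph i1 i2.
move=> [p n] /= H.
apply: (@support_rectangle j _ n (n + l.+1)%N h1 t1 (leq_addr _ _)).
have [E|n0] := eqVneq (phi (xcenter (m j) (i0 + (p : nat)%:Z), (n + l.+1)%N%:R * dt (m j))) 0.
  by right; apply: contraNN H => /eqP E'; rewrite /space_quotient E' E subrr mul0r mulr0.
by left.
Qed.

Lemma cvg_weak_sum : weak_sum j @[j --> \oo] -->
  \sum_(l < ms)
    (alpha l * (Rintegral (mu2 R) (box a) (fun z => entropy (Ustar z) * (l.+1%:R * ddt phi z))
       + \sum_(n < ms) (ms <= n + l.+1)%N%:R *
           Rintegral (mu1 R) (segment a) (fun x => entropy (U0 x) * phi (x, 0)))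
     + beta l * Rintegral (mu2 R) (box a) (fun z => mhd_eflux (Ustar z) * ddx phi z)).
Proof.
apply: cvg_finsum => l; apply: cvgD; apply: cvgM; try exact: cvg_cst.
  apply: cvgD; first exact: cvg_time_term.
  apply: cvg_finsum => n; apply: cvgM; first exact: cvg_cst.
  apply: cvg_initial_term; exact: ltn_ord.
exact: cvg_space_term.
Qed.

Lemma integrable_limit_time :
  (mu2 R).-integrable (box a) (EFin \o (fun z => entropy (Ustar z) * ddt phi z)).
Proof.
have ct : continuous (ddt phi) by case: (Cphi 1) => _ [_ _ _ []].
have [Ct Ct0 HCt] := box_norm ct.
have [Ca Ca0 HCa] := C1_bounded (@isC1_entropy R d).
apply: (@ae_bounded_integrable _ _ _ _ _ _ (Ca * Ct)); first exact: measurable_box.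
- exact: box_lty.
- by apply: measurable_funM; [apply: measurable_entropy; exact: measurable_Ustar|exact: mddt].
move: ae_Ustar; apply: filterS => z Kz bz; rewrite normrM ler_pM ?HCt //; exact/HCa/Kz.
Qed.

Lemma integrable_limit_space :
  (mu2 R).-integrable (box a) (EFin \o (fun z => mhd_eflux (Ustar z) * ddx phi z)).
Proof.
have cx : continuous (ddx phi) by case: (Cphi 1) => _ [_ _ []].
have [Cx Cx0 HCx] := box_norm cx.
have [dF FC] := @mhd_eflux_C1 R d.
have [CF CF0 HCF] := C1_bounded FC.
apply: (@ae_bounded_integrable _ _ _ _ _ _ (CF * Cx)); first exact: measurable_box.
- exact: box_lty.
- by apply: measurable_funM; [apply: measurable_mhd_eflux; exact: measurable_Ustar|exact: mddx].
move: ae_Ustar; apply: filterS => z Kz bz; rewrite normrM ler_pM ?HCx //; exact/HCF/Kz.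
Qed.

Lemma integrable_limit_initial : (0 < ms)%N ->
  (mu1 R).-integrable (segment a) (EFin \o (fun x => entropy (U0 x) * phi (x, 0))).
Proof.
move=> ms0.
have cphi : continuous phi by case: (Cphi 0).
have [Cb Cb0 HCb] := box_norm cphi.
have [Ca Ca0 HCa] := C1_bounded (@isC1_entropy R d).
apply: (@ae_bounded_integrable _ _ _ _ _ _ (Ca * Cb)); first exact: measurable_segment.
- exact: segment_lty.
- apply: measurable_funM.
    by apply: measurable_entropy => i; apply: measurable_funTS; exact: (hinit ms0).1.
  exact: mphi0.
move: (ae_U0 ms0); apply: filterS => x Kx sx; rewrite normrM ler_pM //; first exact/HCa/Kx.
by apply: HCb; split => //=; rewrite in_itv /= lexx ltW.
Qed.

Lemma weak_inequality : \sum_l alpha l = 1 -> \sum_l beta l = \sum_l alpha l * l.+1%:R ->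
  1 <= \sum_l alpha l * l.+1%:R ->
  0 <= Rintegral (mu2 R) (box a)
         (fun z => entropy (Ustar z) * ddt phi z + mhd_eflux (Ustar z) * ddx phi z)
       + Rintegral (mu1 R) (segment a) (fun x => entropy (U0 x) * phi (x, 0)).
Proof.
move=> sum_alpha sum_beta C1.
have H : 0 <= \sum_(l < ms)
    (alpha l * (Rintegral (mu2 R) (box a) (fun z => entropy (Ustar z) * (l.+1%:R * ddt phi z))
       + \sum_(n < ms) (ms <= n + l.+1)%N%:R *
           Rintegral (mu1 R) (segment a) (fun x => entropy (U0 x) * phi (x, 0)))
     + beta l * Rintegral (mu2 R) (box a) (fun z => mhd_eflux (Ustar z) * ddx phi z)).
  have W : \forall j \near \oo, 0 <= weak_sum j.
    near=> j; apply: weak_sum_ge0 => //; near: j; first exact: near_dx_le.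
    exact: near_dt_le.
  rewrite -(cvg_lim _ cvg_weak_sum) //; apply: limr_ge => //.
  exact: (cvgP _ cvg_weak_sum).
rewrite RintegralD; last 3 first.
- exact: measurable_box.
- exact: integrable_limit_time.
- exact: integrable_limit_space.
have C0 : 0 < \sum_l alpha l * l.+1%:R by exact: lt_le_trans C1.
(* Time, space and initial terms all carry the positive factor sum_l l alpha_l, which is divided
   out. *)
rewrite -(pmulr_rge0 _ C0); apply: (le_trans H); rewrite le_eqVlt; apply/orP; left; apply/eqP.
have E (l : 'I_ms) : Rintegral (mu2 R) (box a) (fun z => entropy (Ustar z) * (l.+1%:R * ddt phi z))
    = l.+1%:R * Rintegral (mu2 R) (box a) (fun z => entropy (Ustar z) * ddt phi z).
  rewrite -RintegralZl; [|exact: measurable_box|exact: integrable_limit_time].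
  by apply: eq_Rintegral => z _; rewrite mulrCA.
rewrite big_split /= -mulr_suml sum_beta.
rewrite (eq_bigr (fun l : 'I_ms => alpha l * l.+1%:R *
    (Rintegral (mu2 R) (box a) (fun z => entropy (Ustar z) * ddt phi z)
     + Rintegral (mu1 R) (segment a) (fun x => entropy (U0 x) * phi (x, 0))))); last first.
  by move=> l _; rewrite E -mulr_suml sum_ord_geq -mulrDr mulrA.
rewrite -mulr_suml -mulrDr; congr (_ * _).
exact: addrAC.
Unshelve. all: by end_near. Qed.

End LaxWendroff.

(** * From the box to the half-plane *)

Section SupportedIntegrals.
Context {R : realType} (a : R) (a0 : 0 < a).

Lemma integral_segment_supported (g : R -> R) : (forall x, a < `|x| -> g x = 0) ->
  (mu1 R).-integrable (segment a) (EFin \o g) ->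
  (\int[mu1 R]_(x in [set: R]) (g x)%:E)%E = (Rintegral (mu1 R) (segment a) g)%:E.
Proof.
move=> g0 ig; have F := integrable_fin_num (@measurable_segment R a) ig.
rewrite /Rintegral fineK; last exact: F.
rewrite [RHS]integral_mkcond; apply: eq_integral => x _; rewrite patchE; case: ifPn => // xa.
rewrite g0 // ltNge; apply: contraNN xa; rewrite ler_norml => xa.
by apply/mem_set; rewrite /segment /= in_itv.
Qed.

(** Fubini for the extension by zero from the box. The support condition concerns t > 0, so the time
    t = 0 is discarded as a null set. *)
Lemma iterated_integral_supported (g : R * R -> R) :
  (forall x t, 0 < t -> a < `|x| \/ a < t -> g (x, t) = 0) ->
  (mu2 R).-integrable (box a) (EFin \o g) ->
  (\int[mu1 R]_(t in `[0%R, +oo[) \int[mu1 R]_(x in [set: R]) (g (x, t))%:E)%E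
   = (Rintegral (mu2 R) (box a) g)%:E.
Proof.
move=> g0 ig.
have F := integrable_fin_num (@measurable_box R a) ig.
rewrite /Rintegral fineK; last exact: F.
have ig' : (mu2 R).-integrable setT ((EFin \o g) \_ (box a)).
  exact: (integrable_mkcond _ (@measurable_box R a)).1 ig.
rewrite [RHS]integral_mkcond -(integral21_prod_meas1 ig') integral_mkcond.
apply: (@ae_eq_integral_nm _ _ _ (mu1 R) setT ([set 0] : set (measurableTypeR R))).
- exact: measurable_set1.
- exact: lebesgue_measure_set1.
move=> t _ /= /eqP tn0; rewrite patchE; case: ifPn => ht; last first.
  rewrite /fubini_G integral0_eq // => x _; rewrite patchE memNset // => /boxP [_ /andP[t1 _]].
  by move/negP: ht; apply; apply/mem_set; rewrite /= in_itv /= t1.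
have tp : 0 < t by move: ht; rewrite inE /= in_itv /= andbT lt_def tn0.
apply: eq_integral => x _; rewrite patchE; case: ifPn => // xa; rewrite /= g0 //.
have [xb|] := ltP a `|x|; first by left.
have [tb|] := ltP a t; first by right.
move=> ta; rewrite ler_norml => xb; move/negP: xa; case; apply/mem_set/boxP.
by rewrite xb ta ltW.
Qed.

End SupportedIntegrals.

Theorem theorem4p9 (R : realType) (d : nat) (hd : (d < 3)%N)
  (* the prescribed path *)
  (Psi : R -> state R d -> state R d -> state R d)
  (hPsi : prescribed_path Psi)
  (* polynomial degree and Gauss-Lobatto rule *)
  (k N : nat) (node weight : 'I_N -> R)
  (hN : (k.+1 <= N)%N) (hquad : gauss_lobatto node weight)
  (* coefficients and order of the time discretization *)
  (r ms : nat) (alpha beta : 'I_ms -> R) (hr : (1 <= r)%N)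
  (* sequence of meshes, numerical solutions, initial datum and limit *)
  (m : nat -> mesh R) (U : nat -> nat -> pwpoly R d)
  (U0 : R -> state R d) (Ustar : R * R -> state R d)
  (hdx : forall j, 0 < dx (m j)) (hdt : forall j, 0 < dt (m j))
  (hdx0 : dx (m j) @[j --> \oo] --> (0 : R))
  (hdt0 : dt (m j) @[j --> \oo] --> (0 : R))
  (hU : forall j,
    numerical_solution (m j) Psi node weight alpha beta k (U j))
  (* forward Euler, or a multistep method with consistent starting values *)
  (hmethod : forward_euler alpha beta \/
    ssp_multistep r alpha beta /\
    forall n, (n < ms)%N ->
      cvg_L1loc_space (fun j => at_point (m j) (U j n)) U0)
  (* convergence *)
  (K : set (state R d)) (hK : compact K) (hKG : K `<=` admissible)
  (hUK : forall j n i x, cell (m j) i x -> K (peval (U j n i) x))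
  (hcvg0 : cvg_L1loc_space (fun j => at_point (m j) (U j 0%N)) U0)
  (hcvg : cvg_L1loc_spacetime (fun j => in_time (m j) (U j)) Ustar)
  (* TVB-like property *)
  (hTVB : TVB_seminorm (m j) (U j) @[j --> \oo] --> 0%E)
  (phi : R * R -> R) (hphi : test_function phi)
  (hphi0 : forall x t : R, 0 <= t -> 0 <= phi (x, t)) :
  (- (\int[lebesgue_measure]_(x in [set: R])
       (entropy (U0 x) * phi (x, 0))%R%:E)
   <= \int[lebesgue_measure]_(t in `[0%R, +oo[)
        \int[lebesgue_measure]_(x in [set: R])
          (entropy (Ustar (x, t)) * ddt phi (x, t)
           + mhd_eflux (Ustar (x, t)) * ddx phi (x, t))%R%:E)%E.
Proof.
(* For forward Euler the only starting level is 0, whose convergence is the assumption on the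
   initial data. *)
have hinit n : (n < ms)%N -> cvg_L1loc_space (fun j => at_point (m j) (U j n)) U0.
  move=> nms; case: hmethod => [[ms1 _ _]|[_ H]]; last exact: (H n nms).
  by move: nms; rewrite ms1 ltnS leqn0 => /eqP ->.
have [alpha0 sum_alpha sum_beta C1] : [/\ forall l, 0 <= alpha l, \sum_l alpha l = 1,
    \sum_l beta l = \sum_l alpha l * l.+1%:R & 1 <= \sum_l alpha l * l.+1%:R].
  apply: (@method_coefficients _ _ _ _ r hr); case: hmethod => [|[]]; [by left|by right].
(* An empty family of coefficients would sum to 0 instead of 1. *)
have ms0 : (0 < ms)%N.
  case: (ms) alpha sum_alpha {alpha0 C1 sum_beta hU hmethod beta} => [|//] alpha.
  by rewrite big_ord0 => /eqP; rewrite eq_sym oner_eq0.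
(* The given radius may be negative; its absolute value is a larger and nonnegative one. *)
case: hphi => Cphi [r1 supp1]; pose r0 := `|r1|; pose a := r0 + 1.
have r00 : 0 <= r0 by exact: normr_ge0.
have supp x t : 0 <= t -> r0 < `|x| \/ r0 < t -> phi (x, t) = 0.
  move=> t0 H; apply: supp1 => //; have := ler_norm r1; rewrite -/r0 => r10.
  by case: H => H; [left|right]; exact: le_lt_trans H.
have a0 : 0 < a by rewrite ltr_wpDl.
have := weak_inequality hPsi hquad hdx hdt hdx0 hdt0 hU hinit hK hKG hUK hcvg hTVB Cphi a0
  r00 erefl supp hphi0 sum_alpha sum_beta C1.
have i1 := integrable_limit_time hdx hdt hK hKG hUK hcvg Cphi a0.
have i2 := integrable_limit_space hdx hdt hK hKG hUK hcvg Cphi a0.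
have i3 := integrable_limit_initial hdx hinit hK hKG hUK Cphi a0 ms0.
have ra : r0 < a by rewrite ltrDl.
rewrite (integral_segment_supported (a := a)); [|move=> x xa|exact: i3]; last first.
  by rewrite supp ?mulr0 //; left; exact: lt_trans xa.
have [_ [dx1 dt1 _ _]] := Cphi 1.
rewrite (iterated_integral_supported (a := a)
  (g := fun z => entropy (Ustar z) * ddt phi z + mhd_eflux (Ustar z) * ddx phi z)); last first.
- have := integrableD (@measurable_box R a) i1 i2; apply: eq_integrable => //.
  exact: measurable_box.
- move=> x t t0 H; have H' : r0 < `|x| \/ r0 < t.
    by case: H => H; [left|right]; exact: lt_trans H.
  by rewrite (ddt_supp supp) // (ddx_supp supp (dx1 _) (ltW t0)) // !mulr0 addr0.
by rewrite -EFinN lee_fin -subr_ge0 opprK.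
Qed.
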